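(* Let $\mathfrak m=\bigoplus_{p<0}\mathfrak g_p$ be a free fundamental graded Lie algebra of type $(n,\mu)$ over $\mathbb C$. Then the prolongation $\mathfrak g(\mathfrak m)=\bigoplus_{p\in\mathbb Z}\mathfrak g(\mathfrak m)_p$ of $\mathfrak m$ is of one of the following types: (a) $(n,\mu)$ is neither of the form $(n,2)$ with $n\geq 2$ nor equal to $(2,3)$. In this case, $\mathfrak g(\mathfrak m)_1=\{0\}$. (b) $(n,\mu)=(n,2)$ with $n\geq 3$, or $(n,\mu)=(2,3)$. In this case, $\dim\mathfrak g(\mathfrak m)<\infty$ and $\mathfrak g(\mathfrak m)_1\neq\{0\}$. Furthermore $\mathfrak g(\mathfrak m)$ is isomorphic (as a graded Lie algebra) to a finite-dimensional simple graded Lie algebra of type $(B_n,\{\alpha_n\})$ (when $n\geq 3$) or $(G_2,\{\alpha_1\})$ (when $n=2$). (c) $(n,\mu)=(2,2)$. In this case, $\dim\mathfrak g(\mathfrak m)=\infty$. Furthermore $\mathfrak g(\mathfrak m)$ is isomorphic to the contact algebra $K(1)$ as a graded Lie algebra.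
   Context: All vector spaces are over $\mathbb C$. A graded Lie algebra (GLA) is a Lie algebra $\mathfrak g=\bigoplus_{p\in\mathbb Z}\mathfrak g_p$ with $\dim\mathfrak g_p<\infty$ and $[\mathfrak g_p,\mathfrak g_q]\subset\mathfrak g_{p+q}$ for all $p,q$; $\mathfrak g_-=\bigoplus_{p<0}\mathfrak g_p$. It is transitive if for $p\ge 0$ and $X\in\mathfrak g_p$, $[X,\mathfrak g_-]=\{0\}$ implies $X=0$. Homomorphisms of GLAs preserve the gradation. A fundamental graded Lie algebra (FGLA) is a finite-dimensional GLA $\mathfrak m=\bigoplus_{p<0}\mathfrak g_p$ with $\mathfrak g_{-1}\ne\{0\}$ that is generated by $\mathfrak g_{-1}$; it is of the $\mu$-th kind if $\mathfrak g_{-\mu}\neq\{0\}$ and $\mathfrak g_p=\{0\}$ for $p<-\mu$. An FGLA $\mathfrak m$ of the $\mu$-th kind with $\mu\ge 2$ is a free FGLA of type $(n,\mu)$ if $\dim\mathfrak g_{-1}=n$ and, for every FGLA $\mathfrak m'=\bigoplus_{p<0}\mathfrak g'_p$ of the $\mu$-th kind, every surjective linear map $\mathfrak g_{-1}\to\mathfrak g'_{-1}$ extends uniquely to a GLA epimorphism $\mathfrak m\to\mathfrak m'$. The prolongation $\mathfrak g(\mathfrak m)=\bigoplus_{p\in\mathbb Z}\mathfrak g(\mathfrak m)_p$ of an FGLA $\mathfrak m$ is the maximal transitive GLA with $\mathfrak g(\mathfrak m)_p=\mathfrak g_p$ for all $p<0$. Explicitly, $\mathfrak g(\mathfrak m)_0$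 is the Lie algebra of degree-$0$ derivations of $\mathfrak m$, and for $k\ge1$, inductively, $\mathfrak g(\mathfrak m)_k$ is the space of linear maps $X:\mathfrak m\to\bigoplus_{p\le k-1}\mathfrak g(\mathfrak m)_p$ of degree $k$ with $X([u,v])=[X(u),v]+[u,X(v)]$ for all $u,v\in\mathfrak m$, where $[X,u]=-[u,X]=X(u)$ for $X\in\mathfrak g(\mathfrak m)_r$ ($r\ge 0$), $u\in\mathfrak m$; for $X,Y$ of nonnegative degree, $[X,Y](u)=[X,[Y,u]]-[Y,[X,u]]$ inductively. Type of a simple GLA: let $\mathfrak g=\bigoplus_p\mathfrak g_p$ be a finite-dimensional simple GLA over $\mathbb C$ with $\mathfrak g_-$ an FGLA. Let $E\in\mathfrak g_0$ satisfy $[E,x]=px$ for $x\in\mathfrak g_p$; choose a Cartan subalgebra $\mathfrak h$ of $\mathfrak g_0$ (it is a Cartan subalgebra of $\mathfrak g$ containing $E$) and a simple root system $\Pi=\{\alpha_1,\dots,\alpha_l\}$ with $\alpha_i(E)\ge0$ for all $i$ (then $\alpha_i(E)\in\{0,1\}$). Put $\Pi_1=\{\alpha_i:\alpha_i(E)=1\}$. If $\mathfrak g$ has Dynkin diagram $X_l$, with simple roots numbered as in Bourbaki's tables, $\mathfrak g$ is said to be of type $(X_l,\Pi_1)$; types differing by a diagram automorphism are identified. $K(1)$: let $W(3)$ be the Lie algebra of polynomial vector fields $\sum_{i=1}^3P_i\,\partial/\partial x_i$, $P_i\in\mathbb C[x_1,x_2,x_3]$, acting on differential forms by Lie derivative,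 and $\omega_K=dx_3-x_2\,dx_1$. Then $K(1)=\{D\in W(3): D\omega_K\in\mathbb C[x_1,x_2,x_3]\,\omega_K\}$, graded by $K(1)=\bigoplus_{p\ge-2}K(1)_p$, where $K(1)_p$ consists of those $D=\sum P_i\partial/\partial x_i\in K(1)$ with $P_i$ weighted homogeneous of degree $p+s_i$, the variables $x_1,x_2,x_3$ having weights $(s_1,s_2,s_3)=(1,1,2)$. *)

(* Defs.v *)
(* The complex numbers are R[i] for R : realType. *)
From HB Require Import structures.
From mathcomp Require Import all_boot all_order all_algebra.
From mathcomp Require Import reals complex mpoly.

Set Implicit Arguments.
Unset Strict Implicit.
Unset Printing Implicit Defensive.

Import Order.TTheory GRing.Theory Num.Theory.
Local Open Scope ring_scope.

Section Subspaces.
Variables (F : fieldType) (L : lmodType F).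
Implicit Types A : L -> Prop.

Definition is_subspace A :=
  A 0 /\ forall a x y, A x -> A y -> A (a *: x + y).

Definition has_dim A (n : nat) := exists b : 'I_n -> L,
  [/\ forall i, A (b i),
      forall c : 'I_n -> F, \sum_i c i *: b i = 0 -> forall i, c i = 0
    & forall x, A x -> exists c : 'I_n -> F, x = \sum_i c i *: b i].

Definition finite_dim A := exists n, has_dim A n.

Definition is_zero A := forall x, A x -> x = 0.

End Subspaces.

HB.mixin Record Lmodule_isLie (F : fieldType) L of GRing.Lmodule F L := {
  lie_bracket : L -> L -> L;
  lie_bracketPl : forall a x y z,
    lie_bracket (a *: x + y) z = a *: lie_bracket x z + lie_bracket y z;
  lie_bracketPr : forall a x y z,
    lie_bracket z (a *: x + y) = a *: lie_bracket z x + lie_bracket z y;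
  lie_bracketxx : forall x, lie_bracket x x = 0;
  lie_jacobi : forall x y z,
    lie_bracket x (lie_bracket y z) + lie_bracket y (lie_bracket z x)
      + lie_bracket z (lie_bracket x y) = 0
}.

#[short(type="lieAlgType")]
HB.structure Definition LieAlgebra (F : fieldType) :=
  {L of GRing.Lmodule F L & Lmodule_isLie F L}.

Notation "[ 'lie' x , y ]" := (lie_bracket x y)
  (at level 0, format "[ 'lie'  x ,  y ]") : ring_scope.

(* The last two axioms together say that L is the (internal) direct sum of
   the subspaces grade p. *)
HB.mixin Record LieAlgebra_isGraded (F : fieldType) L of LieAlgebra F L := {
  grade : int -> L -> Prop;
  grade_subspace : forall p, is_subspace (grade p);
  grade_finite_dim : forall p, finite_dim (grade p);
  grade_lie : forall p q x y,
    grade p x -> grade q y -> grade (p + q) [lie x, y];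
  grade_span : forall x, exists (s : seq int) (c : int -> L),
    (forall p, grade p (c p)) /\ x = \sum_(p <- s) c p;
  grade_free : forall (s : seq int) (c : int -> L), uniq s ->
    (forall p, grade p (c p)) -> \sum_(p <- s) c p = 0 ->
    forall p, p \in s -> c p = 0
}.

#[short(type="glaType")]
HB.structure Definition GradedLieAlgebra (F : fieldType) :=
  {L of LieAlgebra F L & LieAlgebra_isGraded F L}.

Section LieNotions.
Variables (F : fieldType) (L : lieAlgType F).
Implicit Types A S I h : L -> Prop.

Definition is_subalgebra S :=
  is_subspace S /\ forall x y, S x -> S y -> S [lie x, y].

Definition generated_by A : L -> Prop := fun x =>
  forall S, is_subalgebra S -> (forall y, A y -> S y) -> S x.

Definition is_ideal I :=
  is_subspace I /\ forall x y, I y -> I [lie x, y].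

Definition simple_lie :=
  (exists x y : L, [lie x, y] <> 0) /\
  forall I, is_ideal I -> is_zero I \/ forall x, I x.

(* The lower central series vanishes: it is spanned by the iterated brackets
   [x_1, [x_2, ..., [x_k, y]]]. *)
Definition nilpotent_sub h := exists k, forall (s : seq L) (y : L),
  size s = k -> (forall x, x \in s -> h x) -> h y ->
  foldr (@lie_bracket F L) y s = 0.

Definition is_cartan_subalgebra A h :=
  [/\ is_subalgebra h, forall x, h x -> A x, nilpotent_sub h
    & forall x, A x -> (forall y, h y -> h [lie x, y]) -> h x].

(* Linear forms on h are represented by functions on L of which only the
   values on h matter. *)
Definition linear_form_on h (f : L -> F) :=
  forall a x y, h x -> h y -> f (a *: x + y) = a * f x + f y.

Definition root_space h (f : L -> F) : L -> Prop :=
  fun x => forall y, h y -> [lie y, x] = f y *: x.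

Definition is_root h (f : L -> F) :=
  [/\ linear_form_on h f, exists2 y, h y & f y <> 0
    & exists2 x, root_space h f x & x <> 0].

Definition is_simple_root_system h (l : nat) (alpha : 'I_l -> L -> F) :=
  [/\ forall i, is_root h (alpha i),
      forall c : 'I_l -> F,
        (forall y, h y -> \sum_i c i * alpha i y = 0) -> forall i, c i = 0
    & forall f, is_root h f -> exists k : 'I_l -> nat,
        (forall y, h y -> f y = \sum_i (k i)%:R * alpha i y) \/
        (forall y, h y -> f y = - \sum_i (k i)%:R * alpha i y)].

(* The coroot of f is the element of [L_f, L_(-f)] on which f takes the
   value 2; as root spaces are lines, [L_f, L_(-f)] consists of brackets. *)
Definition is_coroot h (f : L -> F) (H : L) :=
  [/\ h H, f H = 2 & exists x y,
      [/\ root_space h f x, root_space h (fun z => - f z) y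
        & H = [lie x, y]]].

(* The Cartan matrix is C i j = <alpha_i, alpha_j^vee>. *)
Definition has_cartan_matrix h (l : nat) (alpha : 'I_l -> L -> F)
    (C : 'M[int]_l) :=
  exists2 H : 'I_l -> L, forall i, is_coroot h (alpha i) (H i)
    & forall i j, alpha i (H j) = (C i j)%:~R.

End LieNotions.

(* Bourbaki's numbering: alpha_n is the short simple root of B_n. *)
Definition cartanB (n : nat) : 'M[int]_n :=
  \matrix_(i, j)
    if i == j then 2
    else if (j == i.+1 :> nat) then (if j.+1 == n then - 2 else - 1)
    else if (i == j.+1 :> nat) then - 1
    else 0.

(* Bourbaki's numbering: alpha_1 is the short simple root of G_2. *)
Definition cartanG2 : 'M[int]_2 :=
  \matrix_(i, j) if i == j then 2 else if i == 0 then - 1 else - 3.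

Section GradedNotions.
Variable F : fieldType.

Definition negative_part (g : glaType F) : g -> Prop := fun x =>
  exists (s : seq int) (c : int -> g),
    (forall p, p \in s -> p < 0 /\ grade p (c p)) /\ x = \sum_(p <- s) c p.

Definition transitive_gla (g : glaType F) :=
  forall (p : int) (x : g), 0 <= p -> grade p x ->
    (forall y, negative_part y -> [lie x, y] = 0) -> x = 0.

Definition gla_hom (g g' : glaType F) (phi : {linear g -> g'}) :=
  (forall x y, phi [lie x, y] = [lie phi x, phi y]) /\
  (forall p x, grade p x -> grade p (phi x)).

Definition gla_iso (g g' : glaType F) :=
  exists2 phi : {linear g -> g'}, gla_hom phi & bijective phi.

Definition negative_part_fundamental (g : glaType F) :=
  [/\ finite_dim (@negative_part g),
      ~ is_zero (@grade F g (- 1))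
    & forall x : g, negative_part x <-> generated_by (grade (- 1)) x].

Definition is_FGLA (m : glaType F) :=
  negative_part_fundamental m /\
  forall p : int, 0 <= p -> is_zero (@grade F m p).

Definition of_kind (m : glaType F) (mu : nat) :=
  ~ is_zero (@grade F m (- mu%:Z)) /\
  forall p : int, p < - mu%:Z -> is_zero (@grade F m p).

(* f represents a surjective linear map g_(-1) -> g'_(-1); its values outside
   g_(-1) are irrelevant. *)
Definition linear_surj_deg1 (m m' : glaType F) (f : m -> m') :=
  [/\ forall x, grade (- 1) x -> grade (- 1) (f x),
      forall a x y, grade (- 1) x -> grade (- 1) y ->
        f (a *: x + y) = a *: f x + f y
    & forall y, grade (- 1) y -> exists2 x, grade (- 1) x & f x = y].

Definition gla_epi_extending (m m' : glaType F) (f : m -> m')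
    (phi : {linear m -> m'}) :=
  [/\ gla_hom phi, forall y, exists x, phi x = y
    & forall x, grade (- 1) x -> phi x = f x].

Definition is_free_FGLA (m : glaType F) (n mu : nat) :=
  [/\ is_FGLA m, of_kind m mu, (2 <= mu)%N, has_dim (@grade F m (- 1)) n
    & forall m' : glaType F, is_FGLA m' -> of_kind m' mu ->
      forall f : m -> m', linear_surj_deg1 f ->
      exists2 phi : {linear m -> m'}, gla_epi_extending f phi
        & forall psi : {linear m -> m'},
            gla_epi_extending f psi -> psi =1 phi].

(* Linear maps X : m -> g of degree k with X [u, v] = [X u, v] + [u, X v],
   where m is viewed inside g via iota. As m lives in negative degrees, they
   take values in the sum of the g_p with p <= k - 1. *)
Definition degree_derivation (m g : glaType F) (iota : {linear m -> g})
    (k : nat) (X : {linear m -> g}) :=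
  (forall p u, grade p u -> grade (p + k%:Z) (X u)) /\
  (forall u v, X [lie u, v] = [lie X u, iota v] + [lie iota u, X v]).

(* g, with iota identifying m with the negative part of g, is the prolongation
   of m: for every k >= 0, the map sending X in g_k to u |-> [X, u] identifies
   g_k with the space of all degree_derivations of degree k. Transitivity is
   the injectivity of this map; the bracket of g in nonnegative degrees is then
   forced by the Jacobi identity to be [X, Y](u) = [X, [Y, u]] - [Y, [X, u]]. *)
Definition is_prolongation (m g : glaType F) (iota : {linear m -> g}) :=
  [/\ gla_hom iota, injective iota,
      forall (p : int) (y : g), p < 0 -> grade p y ->
        exists2 x : m, grade p x & iota x = y,
      transitive_gla g
    & forall (k : nat) (X : {linear m -> g}), degree_derivation iota k X ->
        exists2 x : g, grade k%:Z x & forall u, [lie x, iota u] = X u].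

End GradedNotions.

(* g is a finite-dimensional simple graded Lie algebra of type (X_l, Pi1),
   where C is the Cartan matrix of X_l. *)
Definition simple_gla_of_type (F : numFieldType) (g : glaType F) (l : nat)
    (C : 'M[int]_l) (Pi1 : {set 'I_l}) :=
  [/\ finite_dim (fun _ : g => True), simple_lie g,
      negative_part_fundamental g
    & exists (E : g) (h : g -> Prop) (alpha : 'I_l -> g -> F),
      [/\ grade 0 E /\ (forall p x, grade p x -> [lie E, x] = p%:~R *: x),
          is_cartan_subalgebra (grade 0) h,
          is_simple_root_system h alpha /\ has_cartan_matrix h alpha C,
          forall i, 0 <= alpha i E
        & Pi1 = [set i | alpha i E == 1]]].

Section ContactAlgebra.
Variable F : fieldType.

(* (P_i) stands for the vector field sum_i P_i d/dx_i. *)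
Definition vector_field (n : nat) : lmodType F := {ffun 'I_n -> {mpoly F[n]}}.

(* (a_i) stands for the 1-form sum_i a_i dx_i. *)
Definition one_form (n : nat) := {ffun 'I_n -> {mpoly F[n]}}.

Definition vf_apply n (D : vector_field n) (f : {mpoly F[n]}) : {mpoly F[n]} :=
  \sum_i D i * mderiv i f.

Definition vf_bracket n (D D' : vector_field n) : vector_field n :=
  [ffun i => vf_apply D (D' i) - vf_apply D' (D i)].

(* L_D (a dx_i) = D(a) dx_i + a d(D x_i). *)
Definition lie_derivative n (D : vector_field n) (w : one_form n) :
    one_form n :=
  [ffun j => vf_apply D (w j) + \sum_i w i * mderiv j (D i)].

(* dx_3 - x_2 dx_1; the variables x_1, x_2, x_3 have indices 0, 1, 2. *)
Definition omegaK : one_form 3 :=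
  [ffun j : 'I_3 => if j == 0 then - 'X_1 else if j == 1 then 0 else 1].

Definition contact_field (D : vector_field 3) :=
  exists f : {mpoly F[3]}, forall j, lie_derivative D omegaK j = f * omegaK j.

Definition K1_weight (i : 'I_3) : nat := if (i < 2)%N then 1%N else 2%N.

Definition weighted_homogeneous n (wt : 'I_n -> nat) (d : int)
    (P : {mpoly F[n]}) :=
  forall u, u \in msupp P -> (\sum_i u i * wt i)%N%:Z = d.

Definition K1_grade (p : int) (D : vector_field 3) := contact_field D /\
  forall i, weighted_homogeneous K1_weight (p + (K1_weight i)%:Z) (D i).

(* g is isomorphic, as a graded Lie algebra, to the graded subalgebra
   K(1) = contact_field, with pieces K1_grade p, of the algebra of polynomial
   vector fields. *)
Definition gla_iso_K1 (g : glaType F) :=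
  exists phi : {linear g -> vector_field 3},
    [/\ forall x y, phi [lie x, y] = vf_bracket (phi x) (phi y),
        injective phi,
        forall D, contact_field D <-> exists x, phi x = D
      & forall p D, K1_grade p D <-> exists2 x, grade p x & phi x = D].

End ContactAlgebra.

(* Main.v *)
Require Import Defs.
From HB Require Import structures.
From mathcomp Require Import all_boot all_order all_algebra.
From mathcomp Require Import boolp reals complex mpoly.
From mathcomp Require Import ring zify.

Set Implicit Arguments.
Unset Strict Implicit.
Unset Printing Implicit Defensive.

Import Order.TTheory GRing.Theory Num.Theory.
Local Open Scope ring_scope.

(** Write V for g_(-1). An element X of degree 1 of the prolongation is
    determined by the maps A_x = [X, x] of g_0, x in V, and ad X kills every
    word of length mu + 1 in V. Freeness is only used through homomorphisms
    onto the filiform algebra with basis X, Y_1, ..., Y_mu and brackets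
    [X, Y_i] = Y_(i+1): they detect enough words to force
      2 A_x y = (2 - mu) c(x) y + mu c(y) x
    for a linear form c on V, unless (n, mu) = (2, 2). If moreover mu >= 3 and
    (n, mu) <> (2, 3), one more word forces c = 0. For (n, 2), n >= 3, and for
    (2, 3) all these maps extend to derivations; the words of length mu + 1 also
    determine g_2, g_3 and g_4, and the simplicity and the root system of g are
    read off from the resulting basis of weight vectors. For (2, 2), projecting
    the iterated brackets of x with V to g_(-2) gives the Taylor coefficients
    of a contact Hamiltonian, which identifies g with K(1). *)

(** What sets (2, 2) apart is the first step, A_x x in F x. If y = A_x x were not proportional to x,
    a contradiction needs a zero word that still shows y after a homomorphism: for mu >= 3 the word
    can contain x three times, for mu = 2 it needs a z independent of x and y. Two generators and
    two steps offer neither. The existence half needs no model of the free algebra. Homomorphisms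
    onto the filiform algebra also provide linear forms dual to the words of length at most mu, for
    mu = 2 and for (2, 3). A map given on V therefore extends to these words by a formula, and the
    Leibniz rule has to be checked only on the vanishing words of length mu + 1. The same zero words
    bound the higher degrees from above. In the simple cases everything is expressed by a basis v_i
    of V, the elementary matrices E_ij of g_0 = gl(V), and elements c_k of g_1 whose linear forms
    are the coordinates. *)

(** * Linear identities and brackets *)

(* The square-zero extension of F by an F-module L is a commutative ring
   containing L, so [ring] can decide linear identities in L. *)
Section SquareZero.
Variables (F : fieldType) (L : lmodType F).

Definition sqz : Type := (F * L)%type.
HB.instance Definition _ := GRing.Zmodule.on sqz.

Definition sqz_mul (u v : sqz) : sqz :=
  (u.1 * v.1, u.1 *: v.2 + v.1 *: u.2).
Definition sqz_one : sqz := (1, 0).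

Fact sqz_mulA : associative sqz_mul.
Proof.
move=> [a x] [b y] [c z]; rewrite /sqz_mul /=; congr pair; first by rewrite mulrA.
rewrite !scalerDr !scalerA -!addrA; congr (_ + _).
by rewrite [c * a]mulrC [c * b]mulrC.
Qed.
Fact sqz_mulC : commutative sqz_mul.
Proof. by move=> [a x] [b y]; rewrite /sqz_mul /= mulrC addrC. Qed.
Fact sqz_mul1 : left_id sqz_one sqz_mul.
Proof. by move=> [a x]; rewrite /sqz_mul /= mul1r scale1r scaler0 addr0. Qed.
Fact sqz_mulDl : left_distributive sqz_mul +%R.
Proof.
move=> [a x] [b y] [c z]; rewrite /sqz_mul; congr pair; first exact: mulrDl.
by rewrite /= scalerDl scalerDr addrACA.
Qed.
Fact sqz_one_neq0 : sqz_one != 0.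
Proof. by rewrite xpair_eqE oner_eq0. Qed.

HB.instance Definition _ := GRing.Zmodule_isComNzRing.Build sqz
  sqz_mulA sqz_mulC sqz_mul1 sqz_mulDl sqz_one_neq0.

Definition sqz_scal (a : F) : sqz := (a, 0).
Definition sqz_vec (x : L) : sqz := (0, x).

Fact sqz_scal_additive : zmod_morphism sqz_scal.
Proof. by move=> a b; congr pair; rewrite /= subr0. Qed.
Fact sqz_scal_multiplicative : monoid_morphism sqz_scal.
Proof.
by split=> // a b; congr pair; rewrite /= !scaler0 addr0.
Qed.
HB.instance Definition _ := GRing.isZmodMorphism.Build F sqz sqz_scal
  sqz_scal_additive.
HB.instance Definition _ := GRing.isMonoidMorphism.Build F sqz sqz_scal
  sqz_scal_multiplicative.

Lemma sqz_vec_inj : injective sqz_vec. Proof. by move=> x y []. Qed.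
Lemma sqz_vecD x y : sqz_vec (x + y) = sqz_vec x + sqz_vec y.
Proof. by congr pair; rewrite /= addr0. Qed.
Lemma sqz_vecN x : sqz_vec (- x) = - sqz_vec x.
Proof. by congr pair; rewrite /= oppr0. Qed.
Lemma sqz_vec0 : sqz_vec 0 = 0. Proof. by []. Qed.
Lemma sqz_vecZ a x : sqz_vec (a *: x) = sqz_scal a * sqz_vec x.
Proof. by congr pair; rewrite /= ?mulr0 // scale0r addr0. Qed.
Lemma sqz_vecMn x n : sqz_vec (x *+ n) = sqz_vec x *+ n.
Proof. by elim: n => [|n IHn]; rewrite ?mulr0n // !mulrS sqz_vecD IHn. Qed.
Definition sqz_vecE := (sqz_vecD, sqz_vecN, sqz_vec0, sqz_vecZ, sqz_vecMn).
End SquareZero.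

Ltac lmod := apply: sqz_vec_inj; rewrite ?sqz_vecE; ring.

Section LieBasics.
Variables (F : fieldType) (L : lieAlgType F).
Implicit Types x y z : L.

Lemma lieDl x y z : [lie x + y, z] = [lie x, z] + [lie y, z].
Proof. by rewrite -[x in LHS]scale1r lie_bracketPl scale1r. Qed.
Lemma lieDr x y z : [lie z, x + y] = [lie z, x] + [lie z, y].
Proof. by rewrite -[x in LHS]scale1r lie_bracketPr scale1r. Qed.
Lemma lie0l z : [lie 0, z] = 0 :> L.
Proof. by apply: (@addrI _ [lie 0, z]); rewrite -lieDl !addr0. Qed.
Lemma lie0r z : [lie z, 0] = 0 :> L.
Proof. by apply: (@addrI _ [lie z, 0]); rewrite -lieDr !addr0. Qed.
Lemma lieZl a x z : [lie a *: x, z] = a *: [lie x, z].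
Proof. by rewrite -[a *: x]addr0 lie_bracketPl lie0l addr0. Qed.
Lemma lieZr a x z : [lie z, a *: x] = a *: [lie z, x].
Proof. by rewrite -[a *: x]addr0 lie_bracketPr lie0r addr0. Qed.
Lemma lieNl x z : [lie - x, z] = - [lie x, z].
Proof. by rewrite -scaleN1r lieZl scaleN1r. Qed.
Lemma lieNr x z : [lie z, - x] = - [lie z, x].
Proof. by rewrite -scaleN1r lieZr scaleN1r. Qed.
Definition lieE :=
  (lieDl, lieDr, lieZl, lieZr, lieNl, lieNr, lie0l, lie0r).

Lemma lie_suml I (r : seq I) P (f : I -> L) z :
  [lie \sum_(i <- r | P i) f i, z] = \sum_(i <- r | P i) [lie f i, z].
Proof. by apply: (big_morph (fun x => [lie x, z])) => [x y|]; rewrite lieE. Qed.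
Lemma lie_sumr I (r : seq I) P (f : I -> L) z :
  [lie z, \sum_(i <- r | P i) f i] = \sum_(i <- r | P i) [lie z, f i].
Proof. by apply: (big_morph (fun x => [lie z, x])) => [x y|]; rewrite lieE. Qed.

Lemma lieC x y : [lie x, y] = - [lie y, x].
Proof.
have := lie_bracketxx (x + y); rewrite !lieE !lie_bracketxx add0r addr0.
by move/eqP; rewrite addr_eq0 => /eqP.
Qed.

Lemma lieJr x y z : [lie x, [lie y, z]] = [lie [lie x, y], z] + [lie y, [lie x, z]].
Proof.
have /eqP := lie_jacobi x y z.
rewrite [[lie z, [lie x, y]]]lieC [[lie z, x]]lieC lieNr -addrA -opprD subr_eq0.
by move/eqP->; rewrite addrC.
Qed.

Lemma lieJl x y z : [lie [lie x, y], z] = [lie x, [lie y, z]] - [lie y, [lie x, z]].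
Proof. by rewrite lieJr addrK. Qed.

End LieBasics.

Section Subspaces.
Variables (F : fieldType) (L : lmodType F) (A : L -> Prop).
Hypothesis sA : is_subspace A.

Lemma subspace0 : A 0. Proof. by case: sA. Qed.
Lemma subspaceZ a x : A x -> A (a *: x).
Proof. by case: sA => A0 /[apply] /(_ a 0 A0); rewrite addr0. Qed.
Lemma subspaceD x y : A x -> A y -> A (x + y).
Proof. by case: sA => _ /(_ 1 x y) h Ax Ay; move: h; rewrite scale1r; apply. Qed.
Lemma subspaceN x : A x -> A (- x).
Proof. by rewrite -scaleN1r; apply: subspaceZ. Qed.
Lemma subspaceB x y : A x -> A y -> A (x - y).
Proof. by move=> Ax /subspaceN; apply: subspaceD. Qed.
Lemma subspace_sum I (r : seq I) (P : pred I) (f : I -> L) :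
  (forall i, P i -> A (f i)) -> A (\sum_(i <- r | P i) f i).
Proof. by move=> Af; apply: big_ind; [exact: subspace0|exact: subspaceD|]. Qed.
Lemma subspace_sum_seq (I : eqType) (r : seq I) (f : I -> L) :
  (forall i, i \in r -> A (f i)) -> A (\sum_(i <- r) f i).
Proof. by rewrite big_seq => Af; apply: subspace_sum. Qed.

Lemma finite_dim_span n (b : 'I_n -> L) : (forall i, A (b i)) ->
  (forall x, A x -> exists c : 'I_n -> F, x = \sum_i c i *: b i) ->
  finite_dim A.
Proof.
elim: n b => [|n IHn] b Ab spb; first by exists 0%N, b; split=> // c _ [].
have [fb|/existsNP [c /not_implyP [c0 /existsNP [i ci]]]] :=
  pselect (forall c : 'I_n.+1 -> F, \sum_i c i *: b i = 0 -> forall i, c i = 0).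
  by exists n.+1, b.
apply: (IHn (b \o lift i)) => [j|x /spb [d ->]]; first exact: Ab.
exists (fun j => d (lift i j) - d i / c i * c (lift i j)).
rewrite (bigD1_ord i) //=.
move: c0; rewrite (bigD1_ord i) //= => /eqP; rewrite addr_eq0 => /eqP c0.
have -> : d i *: b i = (d i / c i) *: (c i *: b i).
  by rewrite scalerA divfK //; apply/eqP.
rewrite c0 scalerN scaler_sumr -sumrN -big_split; apply: eq_bigr => j _ /=.
by rewrite scalerBl scalerA addrC.
Qed.

Lemma finite_dim_span_fin (I : finType) (b : I -> L) : (forall i, A (b i)) ->
  (forall x, A x -> exists c : I -> F, x = \sum_i c i *: b i) ->
  finite_dim A.
Proof.
move=> Ab spb; apply: (finite_dim_span (b := b \o @enum_val I xpredT)) => [i|x /spb[c ->]].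
  exact: Ab.
exists (c \o @enum_val I xpredT); rewrite (reindex_onto (@enum_val I xpredT) enum_rank) /=.
  by apply: eq_bigl => i; rewrite enum_valK eqxx.
by move=> i _; rewrite enum_rankK.
Qed.
End Subspaces.

Section Linearize.
Variables (F : fieldType) (U V : lmodType F) (f : U -> V).
Lemma linearize : (forall a x y, f (a *: x + y) = a *: f x + f y) ->
  exists phi : {linear U -> V}, phi =1 f.
Proof.
move=> lf; pose h := GRing.isLinear.Build F U V *:%R f lf.
by exists (HB.pack_for {linear U -> V} f h).
Qed.
End Linearize.

(** * Homogeneous components *)

Lemma sum_support (V : nmodType) (I : eqType) (d : I -> V) (r s : seq I) :
  uniq r -> uniq s -> {subset r <= s} -> (forall i, i \notin r -> d i = 0) ->
  \sum_(i <- r) d i = \sum_(i <- s) d i.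
Proof.
move=> ur us rs d0; rewrite (bigID (mem r) xpredT (r := s)) /=.
rewrite [X in _ = _ + X]big1 // addr0 -[RHS]big_filter.
apply: perm_big; apply: uniq_perm => //; first by rewrite filter_uniq.
by move=> q; rewrite mem_filter; case: (boolP (q \in r)) => // /rs ->.
Qed.

Section Graded.
Variables (F : fieldType) (g : glaType F).
Implicit Types (x y : g) (p q : int).

Lemma grade0 p : grade p (0 : g).
Proof. exact: subspace0 (grade_subspace p). Qed.
Lemma gradeD p x y : grade p x -> grade p y -> grade p (x + y).
Proof. exact: (subspaceD (grade_subspace p)). Qed.
Lemma gradeB p x y : grade p x -> grade p y -> grade p (x - y).
Proof. exact: (subspaceB (grade_subspace p)). Qed.
Lemma gradeN p x : grade p x -> grade p (- x).
Proof. exact: (subspaceN (grade_subspace p)). Qed.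
Lemma gradeZ p a x : grade p x -> grade p (a *: x).
Proof. exact: (subspaceZ (grade_subspace p)). Qed.
Lemma grade_sum p I (r : seq I) (P : pred I) (f : I -> g) :
  (forall i, P i -> grade p (f i)) -> grade p (\sum_(i <- r | P i) f i).
Proof. exact: (subspace_sum (grade_subspace p)). Qed.

Lemma gradeL p q x y : grade p x -> grade q y -> grade (p + q) [lie x, y].
Proof. exact: grade_lie. Qed.
Lemma grade_lie_eq p q r x y : grade p x -> grade q y -> r = p + q ->
  grade r [lie x, y].
Proof. by move=> gx gy ->; apply: grade_lie. Qed.

Definition decomposition x (c : int -> g) := (forall p, grade p (c p)) /\
  exists s : seq int,
    [/\ uniq s, forall p, p \notin s -> c p = 0 & x = \sum_(p <- s) c p].

Lemma decomposition_exists x : exists c, decomposition x c.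
Proof.
have [s [c [cg ->]]] := grade_span x.
(* [grade_span] allows repeated degrees; they become multiplicities. *)
exists (fun p => c p *+ count_mem p s); split=> [p|].
  by rewrite -scaler_nat; apply: gradeZ.
exists (undup s); split=> [|p|]; first exact: undup_uniq.
  by rewrite mem_undup => ps; rewrite (count_memPn ps).
rewrite -(@big_undup_iterop_count _ _ +%R _ s xpredT c).
by apply: eq_bigr.
Qed.

Lemma decomposition_uniq x c c' :
  decomposition x c -> decomposition x c' -> c =1 c'.
Proof.
move=> [cg [s [us cs xs]]] [cg' [s' [us' cs' xs']]] p.
have sub1 : {subset s <= undup (s ++ s')} by move=> q qs; rewrite mem_undup mem_cat qs.
have sub2 : {subset s' <= undup (s ++ s')} by move=> q qs; rewrite mem_undup mem_cat qs orbT.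
have d0 : \sum_(q <- undup (s ++ s')) (c q - c' q) = 0.
  by rewrite sumrB -(sum_support (d := c) us) ?undup_uniq // -(sum_support (d := c') us') ?undup_uniq // -xs -xs' subrr.
have [pS|pS] := boolP (p \in undup (s ++ s')).
  apply/eqP; rewrite -subr_eq0; apply/eqP.
  apply: (@grade_free F g (undup (s ++ s')) (fun q => c q - c' q)) => //.
    exact: undup_uniq.
  by move=> q; apply: gradeB.
move: pS; rewrite mem_undup mem_cat negb_or => /andP[ps ps'].
by rewrite cs // cs'.
Qed.

(** A choice of components, but [decomposition_uniq] makes it independent of the choice and hence
    linear in x. *)
Definition pr p x : g := sval (cid (decomposition_exists x)) p.

Lemma pr_decomposition x : decomposition x (pr^~ x).
Proof. by rewrite /pr; case: cid. Qed.

Lemma grade_pr p x : grade p (pr p x).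
Proof. by case: (pr_decomposition x). Qed.

Lemma pr_is_linear p a x y : pr p (a *: x + y) = a *: pr p x + pr p y.
Proof.
apply: (decomposition_uniq (c := pr^~ (a *: x + y))
  (c' := fun p => a *: pr p x + pr p y)); first exact: pr_decomposition.
have [gx [s [us s0 xs]]] := pr_decomposition x.
have [gy [s' [us' s0' xs']]] := pr_decomposition y.
split=> [q|].
  by apply: gradeD => //; apply: gradeZ.
exists (undup (s ++ s')); split=> [|q|]; first exact: undup_uniq.
  rewrite mem_undup mem_cat negb_or => /andP[qs qs'].
  by rewrite s0 // s0' // scaler0 addr0.
rewrite big_split -scaler_sumr /=.
rewrite -(sum_support (d := pr^~ x) us) ?undup_uniq // => [|q qs]; last by rewrite mem_undup mem_cat qs.
rewrite -(sum_support (d := pr^~ y) us') ?undup_uniq // => [|q qs]; last by rewrite mem_undup mem_cat qs orbT.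
by rewrite -xs -xs'.
Qed.
HB.instance Definition _ p :=
  GRing.isLinear.Build F g g *:%R (pr p) (@pr_is_linear p).

Lemma pr_grade p q x : grade p x -> pr q x = if q == p then x else 0.
Proof.
move=> gx; apply: (decomposition_uniq (c := pr^~ x)
   (c' := fun q => if q == p then x else 0)); first exact: pr_decomposition.
split=> [r|].
  by case: eqP => [->//|_]; apply: grade0.
exists [:: p]; split=> // [r|]; first by rewrite inE => /negPf ->.
by rewrite big_seq1 eqxx.
Qed.

Lemma pr_id p x : grade p x -> pr p x = x.
Proof. by move/(pr_grade p); rewrite eqxx. Qed.

Lemma grade_disjoint p q x : grade p x -> grade q x -> p <> q -> x = 0.
Proof. by move=> /pr_id {2}<- /(pr_grade p) -> /eqP/negPf ->. Qed.

Lemma pr_eq x y : (forall p, pr p x = pr p y) -> x = y.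
Proof.
move=> e; apply/eqP; rewrite -subr_eq0; apply/eqP.
have [_ [s [_ _ ->]]] := pr_decomposition (x - y).
by apply: big1 => p _; rewrite linearB /= e subrr.
Qed.

Lemma grade_ind (P : g -> Prop) : is_subspace P ->
  (forall p x, grade p x -> P x) -> forall x, P x.
Proof.
move=> sP Pg x; have [_ [s [_ _ ->]]] := pr_decomposition x.
by apply: subspace_sum => // p _; apply: Pg (grade_pr _ _).
Qed.

Lemma negative_part_pr x : negative_part x <-> forall p, 0 <= p -> pr p x = 0.
Proof.
split=> [[s [c [sc ->]]] p p0|px].
  rewrite linear_sum big_seq big1 // => q /sc [q0 gq] /=.
  by rewrite (pr_grade _ gq); case: eqP => // e; move: q0; rewrite -e ltNge p0.
have [gx [s [_ _ xs]]] := pr_decomposition x.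
exists [seq p <- s | p < 0], (pr^~ x); split=> [p|].
  by rewrite mem_filter => /andP[].
rewrite big_filter {1}xs (bigID (fun p => p < 0)) /= [X in _ + X]big1 ?addr0 //.
by move=> p; rewrite -leNgt => /px.
Qed.

End Graded.

(** * The filiform algebra *)

Section Filiform.
Variables (F : fieldType) (mu : nat).

(* Coordinate 0 is that of X, coordinate i >= 1 that of Y_i; the only nonzero
   brackets of basis vectors are [X, Y_i] = Y_(i+1). *)
Definition filiform : Type := 'rV[F]_mu.+1.
HB.instance Definition _ := GRing.Lmodule.on filiform.

Definition fil_bracket (x y : filiform) : filiform :=
  \row_k if (1 < k)%N
         then x 0 0 * y 0 (inord k.-1) - y 0 0 * x 0 (inord k.-1) else 0.

Fact fil_bracketPl a x y z :
  fil_bracket (a *: x + y) z = a *: fil_bracket x z + fil_bracket y z.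
Proof. by apply/rowP => k; rewrite !mxE; case: ifP => _; ring. Qed.
Fact fil_bracketPr a x y z :
  fil_bracket z (a *: x + y) = a *: fil_bracket z x + fil_bracket z y.
Proof. by apply/rowP => k; rewrite !mxE; case: ifP => _; ring. Qed.
Fact fil_bracketxx x : fil_bracket x x = 0.
Proof. by apply/rowP => k; rewrite !mxE subrr if_same. Qed.
Fact fil_jacobi x y z :
  fil_bracket x (fil_bracket y z) + fil_bracket y (fil_bracket z x)
    + fil_bracket z (fil_bracket x y) = 0.
Proof.
apply/rowP => k; rewrite !mxE /=; case: ifP => k1; last by rewrite !addr0.
have lk := ltn_ord k.
rewrite inordK ?(leq_ltn_trans (leq_pred k)) //.
by case: ifP => _; ring.
Qed.
HB.instance Definition _ := Lmodule_isLie.Build F filiform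
  fil_bracketPl fil_bracketPr fil_bracketxx fil_jacobi.

(** X (index 0) and Y_1 (index 1) both have degree -1, which the maximum with 1 expresses; Y_i has
    degree -i. *)
Definition fil_deg (k : 'I_mu.+1) : int := - (maxn k 1)%:Z.
Definition fil_grade (p : int) (x : filiform) :=
  forall k, x 0 k != 0 -> fil_deg k = p.

Fact fil_grade_subspace p : is_subspace (fil_grade p).
Proof.
split=> [k|a x y gx gy k]; first by rewrite mxE eqxx.
rewrite !mxE; have [->|/gx //] := eqVneq (x 0 k) 0.
by rewrite mulr0 add0r => /gy.
Qed.

Fact fil_grade_finite_dim p : finite_dim (fil_grade p).
Proof.
apply: (@finite_dim_span F filiform (fil_grade p) mu.+1
  (fun k => if fil_deg k == p then delta_mx 0 k else 0)) => [i|x gx].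
  case: eqP => [ip|_] k; last by rewrite mxE eqxx.
  by rewrite mxE /=; case: (k =P i) => [->|_]; rewrite ?eqxx.
exists (fun k => x 0 k); rewrite {1}[x]row_sum_delta.
apply: eq_bigr => k _; case: eqP => // /eqP ip.
have [->|/gx /eqP] := eqVneq (x 0 k) 0; first by rewrite !scale0r.
by rewrite (negPf ip).
Qed.

Fact fil_grade_lie p q x y :
  fil_grade p x -> fil_grade q y -> fil_grade (p + q) (fil_bracket x y).
Proof.
move=> gx gy k; rewrite mxE; case: ifP => [k1|]; last by rewrite eqxx.
have lk := ltn_ord k.
have h : fil_deg 0 + fil_deg (inord k.-1) = fil_deg k.
  rewrite /fil_deg inordK; last by lia.
  rewrite /=; lia.
have [x0|/gx px] := eqVneq (x 0 0) 0.
  have [y0|/gy <-] := eqVneq (y 0 0) 0.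
    by rewrite x0 y0 !mul0r subrr eqxx.
  have [xk|/gx <-] := eqVneq (x 0 (inord k.-1)) 0.
    by rewrite x0 xk mul0r mulr0 subrr eqxx.
  by rewrite -h [RHS]addrC.
have [yk|/gy <-] := eqVneq (y 0 (inord k.-1)) 0; last by rewrite -px h.
have [y0|/gy <-] := eqVneq (y 0 0) 0.
  by rewrite y0 yk mul0r mulr0 subrr eqxx.
have [xk|/gx <-] := eqVneq (x 0 (inord k.-1)) 0.
  by rewrite xk yk !mulr0 subrr eqxx.
by rewrite -h [RHS]addrC.
Qed.

Fact fil_grade_span (x : filiform) : exists (s : seq int) (c : int -> filiform),
  (forall p, fil_grade p (c p)) /\ x = \sum_(p <- s) c p.
Proof.
exists (undup [seq fil_deg k | k <- enum 'I_mu.+1]).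
exists (fun p => \row_k if fil_deg k == p then x 0 k else 0); split=> [p k|].
  by rewrite mxE; case: (fil_deg k =P p) => // _; rewrite eqxx.
apply/rowP => k; rewrite summxE.
rewrite (eq_bigr (fun p => if p == fil_deg k then x 0 k else 0)); last first.
  by move=> p _; rewrite mxE eq_sym.
rewrite (bigD1_seq (fil_deg k)) ?undup_uniq //=; last first.
  by rewrite mem_undup map_f ?mem_enum.
by rewrite eqxx big1 ?addr0 // => p /negPf ->.
Qed.

Fact fil_grade_free (s : seq int) (c : int -> filiform) : uniq s ->
  (forall p, fil_grade p (c p)) -> \sum_(p <- s) c p = 0 ->
  forall p, p \in s -> c p = 0.
Proof.
move=> us gc c0 p ps; apply/rowP => k; rewrite mxE.
have [//|cpk] := eqVneq (c p 0 k) 0.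
move/rowP/(_ k): c0; rewrite summxE (bigD1_seq p) //= mxE big1 ?addr0 // => q qp.
have [//|/gc cqk] := eqVneq (c q 0 k) 0.
by move: qp; rewrite -cqk (gc _ _ cpk) eqxx.
Qed.

HB.instance Definition _ := LieAlgebra_isGraded.Build F filiform
  fil_grade_subspace fil_grade_finite_dim fil_grade_lie fil_grade_span
  fil_grade_free.

Definition filX : filiform := delta_mx 0 0.
Definition filY (i : nat) : filiform := delta_mx 0 (inord i).

Lemma fil_grade_pos p : 0 <= p -> is_zero (@grade F filiform p).
Proof.
move=> p0 x gx; apply/rowP => k; rewrite mxE.
have [//|/gx kp] := eqVneq (x 0 k) 0.
by move: p0; rewrite -kp /fil_deg; lia.
Qed.

Lemma fil_negative (x : filiform) : negative_part x.
Proof.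
by apply/negative_part_pr => p p0; apply: (fil_grade_pos p0); apply: grade_pr.
Qed.

Hypothesis mu1 : (1 < mu)%N.

Lemma filX_grade : grade (- 1) filX.
Proof.
move=> k; rewrite mxE /=; case: (k =P 0) => [->|_]; last by rewrite eqxx.
by rewrite /fil_deg.
Qed.

Lemma filY_grade i : (0 < i <= mu)%N -> grade (- i%:Z) (filY i).
Proof.
move=> imu k; rewrite mxE /=; case: (k =P _) => [->|_]; last by rewrite eqxx.
by rewrite /fil_deg inordK; lia.
Qed.

Lemma filY1_grade : grade (- 1) (filY 1).
Proof. by have := @filY_grade 1; rewrite /= ltnW //; apply. Qed.

Lemma filXY i : (0 < i < mu)%N -> [lie filX, filY i] = filY i.+1.
Proof.
move=> imu; apply/rowP => k; have lk := ltn_ord k.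
rewrite !mxE /= -!val_eqE /= !inordK; try lia.
have -> : (0%N == i) = false by lia.
case: ifP => k1; rewrite ?mul0r ?subr0 ?mul1r; last by case: eqP => //; lia.
by congr (nat_of_bool _)%:R; lia.
Qed.

Lemma filYY i j : (0 < i <= mu)%N -> (0 < j <= mu)%N ->
  [lie filY i, filY j] = 0.
Proof.
move=> imu jmu; apply/rowP => k; have lk := ltn_ord k; rewrite !mxE /= -!val_eqE /= !inordK; try lia.
have -> : (0%N == i) = false by lia.
have -> : (0%N == j) = false by lia.
by rewrite !mul0r subrr if_same.
Qed.

Lemma filX0 : filX 0 0 = 1.
Proof. by rewrite mxE !eqxx. Qed.

Lemma filY0 i : (0 < i <= mu)%N -> filY i 0 0 = 0.
Proof.
move=> imu; rewrite mxE -[X in _ && X]val_eqE /= inordK; last by lia.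
by have -> : (0%N == i) = false by lia.
Qed.

Lemma filYmu_neq0 i : filY i <> 0.
Proof.
move/rowP/(_ (inord i)); rewrite !mxE !eqxx => /eqP.
by rewrite oner_eq0.
Qed.

Lemma fil_FGLA : is_FGLA filiform.
Proof.
split; last exact: fil_grade_pos.
split=> [||x].
- apply: (@finite_dim_span F filiform (@negative_part F filiform) mu.+1
    (fun k => delta_mx 0 k)) => [i|x _]; first exact: fil_negative.
  by exists (fun k => x 0 k); rewrite {1}[x]row_sum_delta.
- move=> /(_ filX filX_grade)/rowP/(_ 0); rewrite !mxE !eqxx => /eqP.
  by rewrite oner_eq0.
split=> [_ S [sS lS] S1|_]; last exact: fil_negative.
have SX : S filX by apply: S1; apply: filX_grade.
have SY i : (0 < i <= mu)%N -> S (filY i).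
  elim: i => // -[|i] IHi imu.
    by apply: S1; apply: (@filY_grade 1); lia.
  rewrite -filXY; last by lia.
  by apply: lS => //; apply: IHi; lia.
rewrite [x]row_sum_delta; apply: subspace_sum => // k _.
apply: subspaceZ => //.
have [->//|k0] := eqVneq k 0.
have -> : delta_mx 0 k = filY k by rewrite /filY inord_val.
have lk := ltn_ord k.
by apply: SY; move: k0; rewrite -val_eqE /=; lia.
Qed.

Lemma fil_kind : of_kind filiform mu.
Proof.
split=> [/(_ (filY mu) (filY_grade _)) h|p pmu x gx].
  by apply: (@filYmu_neq0 mu); apply: h; lia.
apply/rowP => k; rewrite mxE.
have [//|/gx kp] := eqVneq (x 0 k) 0.
have lk := ltn_ord k.
by move: pmu; rewrite -kp /fil_deg; lia.
Qed.

Lemma filYmu_ge i : (0 < i)%N -> forall x : filiform, grade (- i.+1%:Z) x -> x 0 0 = 0.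
Proof.
move=> i0 x gx; have [//|/gx] := eqVneq (x 0 0) 0.
by rewrite /fil_deg /=; lia.
Qed.

Lemma filY1l (x : filiform) : [lie filY 1, x] = - x 0 0 *: filY 2.
Proof.
apply/rowP => k; have lk := ltn_ord k; rewrite !mxE /= -!val_eqE /=.
rewrite !inordK; try lia.
case: ifP => k1; last first.
  by rewrite [_ == 2%N](_ : _ = false) ?mulr0 //; lia.
rewrite [(0 == 1)%N](_ : _ = false) // mul0r add0r mulNr.
by congr (- (_ * (nat_of_bool _)%:R)); lia.
Qed.

Lemma fil_grade1E (x : filiform) : grade (- 1) x ->
  x = x 0 0 *: filX + x 0 (inord 1) *: filY 1.
Proof.
move=> gx; apply/rowP => k; rewrite !mxE /=.
have lk := ltn_ord k.
have [->|k0] := eqVneq k 0.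
  by rewrite -val_eqE /= inordK; [rewrite mulr1 mulr0 addr0|lia].
have [->|k1] := eqVneq k (inord 1); first by rewrite mulr0 add0r mulr1.
rewrite !mulr0 addr0; have [//|/gx] := eqVneq (x 0 k) 0.
move: k0 k1; rewrite -!val_eqE /= inordK ?/fil_deg; lia.
Qed.

End Filiform.

(** * Free fundamental algebras and their prolongations *)

Section Transfer.
Variables (F : fieldType) (m : glaType F) (n mu : nat).

(** The universal property with the filiform algebra as target. The vectors a and b are dual to the
    forms xi and eta; they witness that v_i -> xi_i X + eta_i Y_1 maps g_(-1) onto the span of X and
    Y_1. *)
Lemma free_to_filiform (v : 'I_n -> m) (xi eta a b : 'I_n -> F) :
  is_free_FGLA m n mu ->
  (forall i, grade (- 1) (v i)) ->
  (forall c : 'I_n -> F, \sum_i c i *: v i = 0 -> forall i, c i = 0) ->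
  (forall x, grade (- 1) x -> exists c : 'I_n -> F, x = \sum_i c i *: v i) ->
  \sum_i a i * xi i = 1 -> \sum_i a i * eta i = 0 ->
  \sum_i b i * xi i = 0 -> \sum_i b i * eta i = 1 ->
  exists2 phi : {linear m -> filiform F mu}, gla_hom phi &
    forall i, phi (v i) = xi i *: filX F mu + eta i *: filY F mu 1.
Proof.
move=> [_ _ mu1 _ univ] gv fv spv axi aeta bxi beta.
(* Coordinates default to 0 outside degree -1, where the values of [f] do not matter. *)
have cex x : exists c : 'I_n -> F, grade (- 1) x -> x = \sum_i c i *: v i.
  by have [/spv [c xc]|nx] := pselect (grade (- 1) x); [exists c|exists (fun=> 0)].
have [c cP] := choice cex.
have cuniq x d : grade (- 1) x -> x = \sum_i d i *: v i -> c x =1 d.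
  move=> gx xd i; apply/eqP; rewrite -subr_eq0; apply/eqP.
  apply: (fv (fun i => c x i - d i)).
  rewrite (eq_bigr (fun i => c x i *: v i - d i *: v i)) => [|j _]; last exact: scalerBl.
  by rewrite sumrB -xd -cP // subrr.
have gsum (d : 'I_n -> F) : grade (- 1) (\sum_i d i *: v i).
  by apply: grade_sum => i _; apply: gradeZ.
pose f u : filiform F mu :=
  (\sum_i c u i * xi i) *: filX F mu + (\sum_i c u i * eta i) *: filY F mu 1.
have fc d : f (\sum_i d i *: v i) =
  (\sum_i d i * xi i) *: filX F mu + (\sum_i d i * eta i) *: filY F mu 1.
  by rewrite /f; congr (_ *: _ + _ *: _); apply: eq_bigr => i _;
     rewrite (cuniq _ d).
have lf : linear_surj_deg1 f.
  split=> [x gx|t x y gx gy|y gy].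
  - apply: gradeD; apply: gradeZ; first exact: filX_grade.
    exact: filY1_grade.
  - rewrite (cP x gx) (cP y gy) scaler_sumr -big_split /=.
    rewrite (eq_bigr (fun i => (t * c x i + c y i) *: v i)); last first.
      by move=> i _; rewrite scalerDl scalerA.
    rewrite !fc.
    have e zeta : \sum_i (t * c x i + c y i) * zeta i =
      t * (\sum_i c x i * zeta i) + \sum_i c y i * zeta i.
      rewrite mulr_sumr -big_split; apply: eq_bigr => i _ /=; ring.
    by rewrite !e; lmod.
  - rewrite (fil_grade1E mu1 gy); set s := y 0 0; set t := y 0 _.
    exists (\sum_i (s * a i + t * b i) *: v i); first exact: gsum.
    have e zeta : \sum_i (s * a i + t * b i) * zeta i =
      s * (\sum_i a i * zeta i) + t * (\sum_i b i * zeta i).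
      rewrite !mulr_sumr -big_split; apply: eq_bigr => i _ /=; ring.
    by rewrite fc !e axi aeta bxi beta !mulr0 !mulr1 addr0 add0r.
have [phi [hphi _ phif] _] := univ _ (fil_FGLA F mu1) (fil_kind F mu1) f lf.
exists phi => // i; rewrite phif //.
have vi : v i = \sum_j (j == i)%:R *: v j.
  rewrite (bigD1 i) //= eqxx scale1r big1 ?addr0 // => j /negPf ->.
  by rewrite scale0r.
have e zeta : \sum_j (j == i)%:R * zeta j = zeta i :> F.
  rewrite (bigD1 i) //= eqxx mul1r big1 ?addr0 // => j /negPf ->.
  by rewrite mul0r.
by rewrite {1}vi fc !e.
Qed.

End Transfer.

(* g is the prolongation of a free FGLA identified with its negative part, v is
   a basis of g_(-1), and [fp_fil] is all that is kept of freeness. *)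
Record free_prolongation (F : fieldType) (g : glaType F) (n mu : nat)
    (v : 'I_n -> g) : Prop := FreeProlongation {
  fp_mu : (1 < mu)%N;
  fp_grade : forall i, grade (- 1) (v i);
  fp_free : forall c : 'I_n -> F, \sum_i c i *: v i = 0 -> forall i, c i = 0;
  fp_span : forall x, grade (- 1) x -> exists c : 'I_n -> F, x = \sum_i c i *: v i;
  fp_low : forall p : int, p < - mu%:Z -> is_zero (@grade F g p);
  fp_kind : ~ is_zero (@grade F g (- mu%:Z));
  fp_gen : forall S : g -> Prop, is_subalgebra S ->
    (forall i, S (v i)) -> forall x, negative_part x -> S x;
  fp_trans : transitive_gla g;
  fp_fil : forall xi eta a b : 'I_n -> F,
    \sum_i a i * xi i = 1 -> \sum_i a i * eta i = 0 ->
    \sum_i b i * xi i = 0 -> \sum_i b i * eta i = 1 ->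
    exists phi : {linear g -> filiform F mu},
    [/\ forall x y, negative_part x -> negative_part y ->
          phi [lie x, y] = [lie phi x, phi y],
        forall p x, p < 0 -> grade p x -> grade p (phi x)
      & forall i, phi (v i) = xi i *: filX F mu + eta i *: filY F mu 1];
  fp_prol : forall (k : nat) (X : {linear g -> g}),
    (forall p u, p < 0 -> grade p u -> grade (p + k%:Z) (X u)) ->
    (forall u w, negative_part u -> negative_part w ->
      X [lie u, w] = [lie X u, w] + [lie u, X w]) ->
    exists2 x, grade k%:Z x & forall u, negative_part u -> [lie x, u] = X u
}.

Section FromProlongation.
Variables (F : fieldType) (m g : glaType F) (n mu : nat).
Variable iota : {linear m -> g}.
Hypotheses (free_m : is_free_FGLA m n mu) (g_prol : is_prolongation iota).

Let iota_lie x y : iota [lie x, y] = [lie iota x, iota y].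
Proof. by case: g_prol => [[h _] _ _ _ _]. Qed.
Let iota_grade p x : grade p x -> grade p (iota x).
Proof. by case: g_prol => [[_ h] _ _ _ _]; apply: h. Qed.
Let iota_inj : injective iota. Proof. by case: g_prol. Qed.
Let m_nonneg (p : int) : 0 <= p -> is_zero (@grade F m p).
Proof. by case: free_m => [[_ h] _ _ _ _]; apply: h. Qed.

Let m_neg (x : m) : negative_part x.
Proof.
by apply/negative_part_pr => p p0; apply: (m_nonneg p0); apply: grade_pr.
Qed.

Let pr_iota p x : pr p (iota x) = iota (pr p x).
Proof.
move: x; apply: grade_ind.
  split=> [|a x y ex ey]; first by rewrite !linear0.
  by rewrite !linearP /= ex ey.
move=> q x gx; rewrite (pr_grade _ gx) (pr_grade _ (iota_grade gx)).
by case: eqP => // _; rewrite linear0.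
Qed.

Let iota_neg x : negative_part (iota x).
Proof.
apply/negative_part_pr => p p0; rewrite pr_iota.
by rewrite (m_nonneg p0 (grade_pr p x)) linear0.
Qed.

(** The inverse of [iota] on the negative part, continued by 0 to nonnegative degrees. Composing
    with it turns maps out of m into maps defined on all of g, the form in which [free_prolongation]
    states them. *)
Let retract : exists rho : {linear g -> m}, forall x p,
  pr p (iota (rho x)) = if p < 0 then pr p x else 0.
Proof.
have ex x : exists u : m, forall p, pr p (iota u) = if p < 0 then pr p x else 0.
  move: x; apply: grade_ind.
    split=> [|a x y [u hu] [w hw]].
      by exists 0 => p; rewrite !linear0 if_same.
    exists (a *: u + w) => p; rewrite !linearP /= hu hw.
    by case: ifP; rewrite // scaler0 addr0.
  move=> q x gx; have [q0|q0] := ltP q 0.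
    case: g_prol => _ _ /(_ q x q0 gx) [u gu <-] _ _; exists u => p.
    rewrite (pr_grade _ (iota_grade gu)); case: eqP => [->|]; first by rewrite q0.
    by rewrite if_same.
  exists 0 => p; rewrite !linear0 (pr_grade _ gx).
  by case: eqP => [->|]; rewrite ?if_same // ltNge q0.
have [rho hrho] := choice ex.
have [a x y|phi phiE] := @linearize F g m rho; last first.
  by exists phi => x p; rewrite phiE.
apply: iota_inj; apply: pr_eq => p; rewrite !linearP /= !hrho !linearP /=.
by case: ifP; rewrite // scaler0 addr0.
Qed.

Lemma prolongation_free : exists v : 'I_n -> g, free_prolongation mu v.
Proof.
have [[[_ _ mgen] _] [mu0 mlow] mu1 [v [gv fv spv]] univ] := free_m.
have [rho hrho] := retract.
have iotaK x : negative_part x -> iota (rho x) = x.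
  move=> /negative_part_pr nx; apply: pr_eq => p; rewrite hrho.
  by case: ltP => // /nx ->.
have iotaKr u : rho (iota u) = u by apply: iota_inj; apply: iotaK.
have [_ _ glow gtr gprol] := g_prol.
exists (iota \o v); split=> //=.
- by move=> i; apply: iota_grade.
- move=> c; have -> : \sum_i c i *: iota (v i) = iota (\sum_i c i *: v i).
    by rewrite linear_sum; apply: eq_bigr => i _; rewrite linearZ.
  by rewrite -[RHS](linear0 iota) => /iota_inj; apply: fv.
- move=> x /(glow (-1) x (erefl _)) [u /spv [c ->] <-]; exists c.
  by rewrite linear_sum; apply: eq_bigr => i _; rewrite linearZ.
- move=> p pmu x gx; have p0 : p < 0 by lia.
  by have [u /(mlow _ pmu) -> <-] := glow p x p0 gx; rewrite linear0.
- move=> z; apply: mu0 => u /iota_grade /z; rewrite -[in X in X -> _](linear0 iota).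
  by move/iota_inj.
- move=> S [sS lS] Sv x /iotaK <-.
  have /mgen/(_ (fun u => S (iota u))) := m_neg (rho x); apply=> [|y /spv [c ->]].
    split=> [|u w Su Sw]; last by rewrite iota_lie; apply: lS.
    split=> [|a u w Su Sw]; first by rewrite linear0; apply: subspace0.
    by rewrite linearP; case: sS => _; apply.
  rewrite linear_sum; apply: subspace_sum => // i _.
  by rewrite linearZ; apply: subspaceZ => //; apply: Sv.
- move=> xi eta a b axi aeta bxi beta.
  have [phi [hphi gphi] phiv] := free_to_filiform free_m gv fv spv axi aeta bxi beta.
  have [c x y|psi psiE] := @linearize F g (filiform F mu) (phi \o rho).
    by rewrite /= !linearP.
  exists psi; split=> [x y nx ny|p x p0 gx|i]; rewrite !psiE /=.
  + by rewrite -hphi -{1}(iotaK x nx) -{1}(iotaK y ny) -iota_lie iotaKr.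
  + apply: gphi; have [u gu ux] := glow p x p0 gx.
    by rewrite -ux iotaKr.
  + by rewrite iotaKr phiv.
- move=> k X gX dX.
  have [c x y|Y YE] := @linearize F m g (X \o iota).
    by rewrite /= !linearP.
  have [|x gx xE] := gprol k Y.
    split=> [p u gu|u w]; rewrite !YE /= ?iota_lie ?dX //.
    have [p0|/m_nonneg/(_ u gu)->] := ltP p 0; last by rewrite !linear0; apply: grade0.
    by apply: gX => //; apply: iota_grade.
  by exists x => // u /iotaK <-; rewrite xE YE.
Qed.

End FromProlongation.

Definition adn (F : fieldType) (L : lieAlgType F) (x : L) k := iter k (lie_bracket x).

Section Adn.
Variables (F : fieldType) (L : lieAlgType F).
Implicit Types x y u w : L.

Lemma adnS x k u : adn x k.+1 u = [lie x, adn x k u]. Proof. by []. Qed.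
Lemma adnSr x k u : adn x k.+1 u = adn x k [lie x, u].
Proof. exact: iterSr. Qed.
Lemma adn_lin x k a u w : adn x k (a *: u + w) = a *: adn x k u + adn x k w.
Proof. by elim: k => //= k ->; rewrite !lieE. Qed.
Lemma adn0 x k : adn x k 0 = 0.
Proof. by elim: k => //= k ->; rewrite lie0r. Qed.
Lemma adnZ x k a u : adn x k (a *: u) = a *: adn x k u.
Proof. by rewrite -[a *: u]addr0 adn_lin adn0 addr0. Qed.
Lemma adnD x k u w : adn x k (u + w) = adn x k u + adn x k w.
Proof. by rewrite -[u]scale1r adn_lin !scale1r. Qed.
Lemma adnN x k u : adn x k (- u) = - adn x k u.
Proof. by rewrite -scaleN1r adnZ scaleN1r. Qed.
Definition adnE := (adnD, adnN, adnZ, adn0).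
Lemma adnxx x k : (0 < k)%N -> adn x k x = 0.
Proof. by case: k => // k _; rewrite adnSr lie_bracketxx adn0. Qed.
Lemma adn_der z x k u : [lie z, x] = 0 -> [lie z, adn x k u] = adn x k [lie z, u].
Proof. by move=> zx; elim: k => //= k IHk; rewrite lieJr zx lie0l add0r IHk. Qed.
End Adn.

Section GradedAdn.
Variables (F : fieldType) (g : glaType F) (mu : nat).

Lemma grade_neg p (x : g) : p < 0 -> grade p x -> negative_part x.
Proof.
move=> p0 gx; apply/negative_part_pr => q q0; rewrite (pr_grade _ gx).
by case: eqP => // e; move: q0; rewrite e leNgt p0.
Qed.

Lemma adn_grade x u p k : grade (- 1) x -> grade p u -> grade (p - k%:Z) (adn x k u : g).
Proof.
move=> gx gu; elim: k => [|k IHk]; first by rewrite subr0.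
by rewrite adnS; apply: (grade_lie_eq gx IHk); lia.
Qed.

Lemma phi_adn (phi : {linear g -> filiform F mu}) x u k :
  (forall x y, negative_part x -> negative_part y ->
          phi [lie x, y] = [lie phi x, phi y]) ->
  grade (- 1) x -> grade (- 1) u -> phi (adn x k u) = @adn F (filiform F mu) (phi x) k (phi u).
Proof.
move=> hphi gx gu; elim: k => // k IHk; rewrite !adnS -IHk hphi //.
  exact: grade_neg gx.
by apply: grade_neg (adn_grade k gx gu); lia.
Qed.

Lemma fil_adn k : (k < mu)%N -> @adn F (filiform F mu) (filX F mu) k (filY F mu 1) = filY F mu k.+1.
Proof.
elim: k => // k IHk kmu; rewrite adnS IHk; last by lia.
by rewrite filXY // ; lia.
Qed.

End GradedAdn.

Section FreeProlongation.
Variables (F : numFieldType) (g : glaType F) (n mu : nat) (v : 'I_n -> g).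
Hypothesis H : free_prolongation mu v.

Let mu1 := fp_mu H.
Let gv := fp_grade H.

Lemma v_neg i : negative_part (v i).
Proof. by apply: (@grade_neg F g (-1)). Qed.

Lemma trans_v (k : nat) (x : g) : grade k%:Z x -> (forall i, [lie x, v i] = 0) -> x = 0.
Proof.
move=> gx xv; apply: (fp_trans H _ gx) => // y.
apply: (fp_gen H (S := fun y => [lie x, y] = 0)) => //.
split=> [|u w xu xw]; last by rewrite lieJr xu xw lie0l lie0r addr0.
by split=> [|a u w xu xw]; rewrite !lieE // xu xw scaler0 addr0.
Qed.

Lemma trans_v_eq (k : nat) (x y : g) : grade k%:Z x -> grade k%:Z y ->
  (forall i, [lie x, v i] = [lie y, v i]) -> x = y.
Proof.
move=> gx gy xy; apply/eqP; rewrite -subr_eq0; apply/eqP.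
by apply: (@trans_v k) => [|i]; [apply: gradeB|rewrite !lieE xy subrr].
Qed.

Lemma below_zero p (x : g) : p < - mu%:Z -> grade p x -> x = 0.
Proof. by move/(fp_low H); apply. Qed.

(** Any independent family in V can play the role of part of a basis: its coordinate matrix M has a
    right inverse, whose columns k and l are forms dual to u_k and u_l. *)
Lemma fil_of_free r (u : 'I_r -> g) : (forall i, grade (- 1) (u i)) ->
  (forall c : 'I_r -> F, \sum_i c i *: u i = 0 -> forall i, c i = 0) ->
  forall k l, k != l -> exists phi : {linear g -> filiform F mu},
    [/\ forall x y, negative_part x -> negative_part y ->
          phi [lie x, y] = [lie phi x, phi y],
        forall p x, p < 0 -> grade p x -> grade p (phi x)
      & forall i, phi (u i) = (i == k)%:R *: filX F mu + (i == l)%:R *: filY F mu 1].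
Proof.
move=> gu fu k l kl.
have [A AP] := choice (fun i => fp_span H (gu i)).
pose M : 'M[F]_(r, n) := \matrix_(i, j) A i j.
have fM : row_free M.
  apply/inj_row_free => c cM; apply/rowP => i; rewrite mxE.
  apply: (fu (fun i => c 0 i)).
  transitivity (\sum_j (c *m M) 0 j *: v j); last first.
    by rewrite cM big1 // => j _; rewrite mxE scale0r.
  rewrite (eq_bigr (fun i => \sum_j (c 0 i * A i j) *: v j)); last first.
    by move=> j _; rewrite {1}AP scaler_sumr; apply: eq_bigr => q _; rewrite scalerA.
  rewrite exchange_big; apply: eq_bigr => j _ /=; rewrite mxE scaler_suml.
  by apply: eq_bigr => q _; rewrite mxE.
have MN : M *m pinvmx M = 1%:M by apply: mulmxVp.
have e i j : \sum_q A i q * pinvmx M q j = (i == j)%:R.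
  transitivity ((M *m pinvmx M) i j); last by rewrite MN mxE.
  by rewrite [RHS]mxE; apply: eq_bigr => q _; rewrite [M i q]mxE.
have lk : (l == k) = false by rewrite eq_sym (negPf kl).
have := fp_fil H (xi := fun q => pinvmx M q k) (eta := fun q => pinvmx M q l)
  (a := A k) (b := A l); rewrite !e !eqxx lk (negPf kl).
case=> // phi [h1 h2 h3]; exists phi; split=> // i.
rewrite AP linear_sum -!e !scaler_suml -big_split; apply: eq_bigr => q _ /=.
by rewrite linearZ /= h3 scalerDr !scalerA.
Qed.

Lemma fil_of_free2 x y : grade (- 1) x -> grade (- 1) y ->
  (forall a b : F, a *: x + b *: y = 0 -> a = 0 /\ b = 0) ->
  exists phi : {linear g -> filiform F mu},
    [/\ forall x y, negative_part x -> negative_part y ->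
          phi [lie x, y] = [lie phi x, phi y],
        forall p x, p < 0 -> grade p x -> grade p (phi x),
        phi x = filX F mu & phi y = filY F mu 1].
Proof.
move=> gx gy xy.
have [i|c|//|phi [h1 h2 h3]] :=
  @fil_of_free 2 (fun i => if i == 0 then x else y) _ _ 0 1.
- by case: ifP.
- rewrite big_ord_recl big_ord1 /= => /xy [c0 c1] i.
  by case: (unliftP 0 i) => [j|] ->; rewrite ?(ord1 j).
exists phi; split=> //.
  by rewrite (h3 0) scale1r scale0r addr0.
by rewrite (h3 1) scale1r scale0r add0r.
Qed.

Lemma fil_of_free3 x y z : grade (- 1) x -> grade (- 1) y -> grade (- 1) z ->
  (forall a b c : F, a *: x + b *: y + c *: z = 0 -> [/\ a = 0, b = 0 & c = 0]) ->
  exists phi : {linear g -> filiform F mu},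
    [/\ forall x y, negative_part x -> negative_part y ->
          phi [lie x, y] = [lie phi x, phi y],
        phi x = filX F mu, phi y = filY F mu 1 & phi z = 0].
Proof.
move=> gx gy gz xyz.
have [i|c|//|phi [h1 h2 h3]] :=
  @fil_of_free 3 (fun i => if i == 0 then x else if i == 1 then y else z) _ _ 0 1.
- by case: ifP => // _; case: ifP.
- rewrite !big_ord_recl big_ord0 addr0 addrA /= => /xyz [c0 c1 c2] i.
  case: (unliftP 0 i) => [j|] -> //; case: (unliftP 0 j) => [l|] -> //.
  by rewrite (ord1 l).
exists phi; split=> //.
- by rewrite (h3 0) scale1r scale0r addr0.
- by rewrite (h3 1) scale1r scale0r add0r.
- by rewrite (h3 2) !scale0r addr0.
Qed.

(** If x and w were independent, a homomorphism with x -> X and w -> Y_1 would send ad_x^(mu-1) w to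
    Y_mu, which is not 0. *)
Lemma adn_inj (x w : g) : grade (- 1) x -> grade (- 1) w -> x <> 0 ->
  adn x mu.-1 w = 0 -> exists s : F, w = s *: x.
Proof.
move=> gx gw x0 xw; apply: contrapT => nw.
have [|phi [hphi _ px pw]] := fil_of_free2 gx gw.
  move=> a b ab; have b0 : b = 0.
    apply: contrapT => /eqP b0; apply: nw; exists (- (b^-1 * a)).
    move/eqP: ab; rewrite addrC addr_eq0 => /eqP bw.
    by rewrite -[w](scalerK b0) bw scalerN scaleNr scalerA.
  split=> //; move: ab; rewrite b0 scale0r addr0 => /eqP.
  by rewrite scaler_eq0 => /orP[/eqP//|/eqP].
move: xw => /(congr1 phi); rewrite (phi_adn _ hphi) // px pw linear0 fil_adn; last by lia.
by rewrite prednK; [apply: filYmu_neq0|lia].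
Qed.

End FreeProlongation.

(** * Elements of degree one *)

Section DegreeOne.
Variables (F : numFieldType) (g : glaType F) (n mu : nat) (v : 'I_n -> g).
Hypothesis H : free_prolongation mu v.

Let mu1 := fp_mu H.
Let gv := fp_grade H.
Let neg1 (x : g) : grade (- 1) x -> negative_part x.
Proof. exact: grade_neg. Qed.

Lemma not_line_indep2 (x y : g) : x <> 0 -> ~ (exists s : F, y = s *: x) ->
  forall a b : F, a *: x + b *: y = 0 -> a = 0 /\ b = 0.
Proof.
move=> x0 yx a b ab; have b0 : b = 0.
  apply: contrapT => /eqP b0; apply: yx; exists (- (b^-1 * a)).
  move/eqP: ab; rewrite addrC addr_eq0 => /eqP bw.
  by rewrite -[y](scalerK b0) bw scalerN scaleNr scalerA.
split=> //; move: ab; rewrite b0 scale0r addr0 => /eqP.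
by rewrite scaler_eq0 => /orP[/eqP//|/eqP].
Qed.

Variable X : g.
Hypothesis gX : grade 1 X.
Let A0 (x : g) : grade (- 1) x -> grade 0 [lie X, x].
Proof. by move=> gx; apply: (grade_lie_eq gX gx). Qed.
Let A1 (x y : g) : grade (- 1) x -> grade (- 1) y -> grade (- 1) [lie [lie X, x], y].
Proof. by move=> gx gy; apply: (grade_lie_eq (A0 gx) gy). Qed.

(* For mu >= 3: if y = [[X,x],x] were independent of x, then mapping y to X and
   x to Y_1 would send [X, [x, [x, ad_y^(mu-2) x]]] = 0 to Y_mu. *)
Lemma diagonal_line_high (x : g) : (2 < mu)%N -> grade (- 1) x ->
  exists s : F, [lie [lie X, x], x] = s *: x.
Proof.
move=> mu2 gx; set y := [lie [lie X, x], x]; apply: contrapT => ny.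
have x0 : x <> 0.
  by move=> x0; apply: ny; exists 0; rewrite /y x0 !lie0r scaler0.
have gy : grade (- 1) y by apply: A1.
have [a b|phi [hphi gphi py px]] := fil_of_free2 H gy gx.
  by rewrite addrC => /(not_line_indep2 x0 ny)[].
set W := adn y (mu - 2)%N x.
have gW : grade (- (mu.-1)%:Z) W.
  by have := adn_grade (mu - 2)%N gy gx; congr grade; lia.
have gxW : grade (- mu%:Z) [lie x, W] by apply: (grade_lie_eq gx gW); lia.
have W0 : [lie x, [lie x, W]] = 0.
  by apply: (below_zero H _ (gradeL gx gxW)); lia.
have pW : phi W = filY F mu mu.-1.
  rewrite (phi_adn _ hphi) // px py fil_adn; last by lia.
  by congr filY; lia.
have nW : negative_part W by apply: grade_neg gW; lia.
have gAW : grade (- (mu.-1)%:Z) [lie [lie X, x], W].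
  by apply: (grade_lie_eq (A0 gx) gW); lia.
have nAW : negative_part [lie [lie X, x], W] by apply: grade_neg gAW; lia.
have gXW : grade (- (mu - 2)%N%:Z) [lie X, W] by apply: (grade_lie_eq gX gW); lia.
have nXW : negative_part [lie X, W] by apply: grade_neg gXW; lia.
have gxXW : grade (- (mu.-1)%:Z) [lie x, [lie X, W]].
  by apply: (grade_lie_eq gx gXW); lia.
have nxXW : negative_part [lie x, [lie X, W]] by apply: grade_neg gxXW; lia.
have e : [lie y, W] + 2 *: [lie x, [lie [lie X, x], W]] +
    [lie x, [lie x, [lie X, W]]] = 0.
  have := lie0r X; rewrite -W0 lieJr (lieJr [lie X, x] x W) (lieJr X x W) lieDr -/y.
  by move=> <-; lmod.
(* The last two terms of [e] are brackets with x -> Y_1 of elements of degree -(mu-1) <= -2; there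
   the X-coefficient vanishes, so Y_1 kills them. *)
have top u : grade (- (mu.-1)%:Z) u -> [lie filY F mu 1, phi u] = 0.
  move=> gu; rewrite filY1l //; have -> : phi u 0 0 = 0; last by rewrite oppr0 scale0r.
  apply: (@filYmu_ge F mu mu1 (mu - 2)%N); first by lia.
  have -> : (mu - 2).+1%N = mu.-1 by lia.
  by apply: gphi => //; lia.
move/(congr1 phi): e; rewrite !linearD linearZ /= (hphi y W) // ?(hphi x [lie [lie X, x], W]) // ?(hphi x [lie x, [lie X, W]]) //; try exact: neg1.
rewrite px py pW linear0 !top // scaler0 !addr0 filXY; try by lia.
by rewrite prednK; [apply: filYmu_neq0|lia].
Qed.

(* For mu = 2 and n >= 3, modulo x the same follows from [X, [x, [x, z]]] = 0. *)
Lemma diagonal_line_low (x : g) : mu = 2%N -> (2 < n)%N -> grade (- 1) x ->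
  exists s : F, [lie [lie X, x], x] = s *: x.
Proof.
move=> mu2 n2 gx; set y := [lie [lie X, x], x]; apply: contrapT => ny.
have x0 : x <> 0.
  by move=> x0; apply: ny; exists 0; rewrite /y x0 !lie0r scaler0.
have gy : grade (- 1) y by apply: A1.
have [z gz zxy] : exists2 z : g, grade (- 1) z &
    ~ exists a b : F, z = a *: x + b *: y.
  (* Otherwise the coordinates of the v_i in x and y form an n x 2 matrix with independent rows,
     against n > 2. *)
  apply: contrapT => nz.
  have hz i : exists ab : F * F, v i = ab.1 *: x + ab.2 *: y.
    apply: contrapT => hi; apply: nz; exists (v i) => // -[a [b ab]].
    by apply: hi; exists (a, b).
  have [c cP] := choice hz.
  pose M : 'M[F]_(n, 2) := \matrix_(i, j) if j == 0 then (c i).1 else (c i).2.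
  have : row_free M.
    apply/inj_row_free => d dM; apply/rowP => i; rewrite mxE.
    apply: (fp_free H (c := fun i => d 0 i)).
    have d0 : \sum_i d 0 i * (c i).1 = 0.
      transitivity ((d *m M) 0 0); last by rewrite dM mxE.
      by rewrite mxE; apply: eq_bigr => j _; rewrite [M j 0]mxE.
    have d1 : \sum_i d 0 i * (c i).2 = 0.
      transitivity ((d *m M) 0 1); last by rewrite dM mxE.
      by rewrite mxE; apply: eq_bigr => j _; rewrite [M j 1]mxE.
    rewrite (eq_bigr (fun i => (d 0 i * (c i).1) *: x + (d 0 i * (c i).2) *: y)).
      by rewrite big_split -!scaler_suml /= d0 d1 !scale0r addr0.
    by move=> j _; rewrite {1}cP scalerDr !scalerA.
  rewrite /row_free => /eqP rM; have := rank_leq_col M; rewrite rM; lia.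
have [a b c abc|phi [hphi py pz px]] := fil_of_free3 H gy gz gx.
  have b0 : b = 0.
    apply: contrapT => /eqP b0; apply: zxy; exists (- (b^-1 * c)), (- (b^-1 * a)).
    rewrite -[z](scalerK b0) (_ : b *: z = - (c *: x) - a *: y); last first.
      by apply/eqP; rewrite -subr_eq0 -abc; apply/eqP; lmod.
    by rewrite scalerBr scalerN !scaleNr !scalerA.
  move: abc; rewrite b0 scale0r addr0 addrC.
  by move=> /(not_line_indep2 x0 ny)[-> ->].
have W0 : [lie x, [lie x, z]] = 0.
  by apply: (below_zero H _ (gradeL gx (gradeL gx gz))); lia.
have e : [lie y, z] + 2 *: [lie x, [lie [lie X, x], z]] +
    [lie x, [lie x, [lie X, z]]] = 0.
  have := lie0r X; rewrite -W0 lieJr (lieJr [lie X, x] x z) (lieJr X x z) lieDr -/y.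
  by move=> <-; lmod.
(* As [phi] sends x to 0, it kills every term except [y, z], which goes to [X, Y_1] = Y_2. *)
move: e; rewrite [[lie x, [lie X, z]]]lieC => /(congr1 phi).
have gXzx : grade (- 1) [lie [lie X, z], x] by apply: A1.
have gXxz : grade (- 1) [lie [lie X, x], z] by apply: A1.
rewrite lieNr !linearD linearZ linearN /= (hphi y z) ?(hphi x [lie [lie X, x], z]) ?(hphi x [lie [lie X, z], x]) //; try by apply: neg1.
rewrite px py pz !lie0l oppr0 scaler0 !addr0 (filXY F mu1); last by lia.
by rewrite linear0; apply: filYmu_neq0.
Qed.

Hypothesis big : (2 < mu)%N \/ (2 < n)%N.

Lemma diagonal_line (x : g) : grade (- 1) x ->
  exists s : F, [lie [lie X, x], x] = s *: x.
Proof.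
have [mu2|mu2] := ltnP 2 mu; first exact: diagonal_line_high.
by apply: diagonal_line_low; first lia; case: big => //; lia.
Qed.

Lemma adn_degree_zero (A x y : g) (c : F) k : [lie A, x] = c *: x ->
  [lie A, adn x k y] = (k%:R * c) *: adn x k y + adn x k [lie A, y].
Proof.
move=> Ax; elim: k => [|k IHk]; first by rewrite mul0r scale0r add0r.
by rewrite !adnS lieJr IHk Ax !lieE -natr1; lmod.
Qed.

(** X turns each of the k + 1 factors x into A_x, which moves right past the factors behind it and
    collects c (0 + 1 + ... + k) in total. The leading 2 clears the denominator of this sum. *)
Lemma adn_degree_one (x y : g) (c : F) k : [lie [lie X, x], x] = c *: x ->
  2 *: [lie X, adn x k.+1 y] = (2 * k.+1%:R) *: adn x k [lie [lie X, x], y]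
    + (c * k.+1%:R * k%:R) *: adn x k y - 2 *: adn x k [lie [lie X, y], x].
Proof.
move=> Ax; elim: k => [|k IHk].
  by rewrite /= lieJr [[lie x, _]]lieC; lmod.
rewrite adnS lieJr (adn_degree_zero _ _ Ax) scalerDr -[2 *: [lie x, _]]lieZr IHk.
by rewrite !lieE -!adnS -![(k.+2)%:R]natr1 -![(k.+1)%:R]natr1; lmod.
Qed.

(** [adn_degree_one] for the zero word ad_x^mu y: all terms share the operator ad_x^(mu-1), which
    [adn_inj] cancels up to a multiple of x. *)
Lemma relation_line (x y : g) (c : F) : grade (- 1) x -> grade (- 1) y -> x <> 0 ->
  [lie [lie X, x], x] = c *: x -> exists s : F,
  (2 * mu%:R) *: [lie [lie X, x], y] + (c * mu%:R * (mu%:R - 1)) *: y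
    - 2 *: [lie [lie X, y], x] = s *: x.
Proof.
move=> gx gy x0 Ax; apply: (adn_inj H) => //.
  by apply: gradeB; [apply: gradeD|]; apply: gradeZ => //; apply: A1.
have := adn_degree_one y mu.-1 Ax; rewrite prednK; last by lia.
have -> : adn x mu y = 0.
  by apply: (below_zero H _ (adn_grade mu gx gy)); lia.
have -> : mu.-1%:R = mu%:R - 1 :> F.
  by rewrite -[X in _ = X%:R - 1](@prednK mu) -?natr1 ?addrK //; lia.
by rewrite lie0r scaler0 !adnE.
Qed.

Let indep (x y : g) := forall a b : F, a *: x + b *: y = 0 -> a = 0 /\ b = 0.

(** [diagonal_line] at x + y leaves its multiplier s unknown; x - y, with multiplier t, supplies a
    second expression. Comparing them gives s + t = 2 c and s - t = 2 c', so s = c + c'. *)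
Lemma polarization (x y : g) (c c' : F) : grade (- 1) x -> grade (- 1) y ->
  indep x y -> [lie [lie X, x], x] = c *: x -> [lie [lie X, y], y] = c' *: y ->
  [lie [lie X, x], y] + [lie [lie X, y], x] = c' *: x + c *: y.
Proof.
move=> gx gy xy Ax Ay; set S := (X in X = _).
have [s sE] := diagonal_line (gradeD gx gy).
have [t tE] := diagonal_line (gradeB gx gy).
have e1 : S = (s - c) *: x + (s - c') *: y.
  have -> : S = [lie [lie X, x + y], x + y] - c *: x - c' *: y.
    by rewrite -Ax -Ay !lieE /S; lmod.
  by rewrite sE; lmod.
have e2 : S = (c - t) *: x + (t + c') *: y.
  have -> : S = - [lie [lie X, x - y], x - y] + c *: x + c' *: y.
    by rewrite -Ax -Ay !lieE /S; lmod.
  by rewrite tE; lmod.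
have [] := xy (s - c - (c - t)) (s - c' - (t + c')).
  by rewrite -[RHS](subrr S) {1}e1 e2; lmod.
move=> st st'; rewrite e1.
have h2 : 2 != 0 :> F by rewrite pnatr_eq0.
have h : 2 * s = 2 * (c + c').
  apply/eqP; rewrite -subr_eq0; apply/eqP.
  transitivity ((s - c - (c - t)) + (s - c' - (t + c'))); first by ring.
  by rewrite st st' addr0.
by rewrite (mulfI h2 h); lmod.
Qed.

(** Adding twice the polarization to [relation_line] eliminates A_y x, and 2 - mu (mu - 1) = (mu +
    1) (2 - mu) gives the coefficient of y after division by mu + 1. Exchanging x and y and
    returning to the polarization then determines the coefficient of x. *)
Lemma degree_one_pair (x y : g) : grade (- 1) x -> grade (- 1) y ->
  indep x y -> exists c c' : F,
  [/\ [lie [lie X, x], x] = c *: x, [lie [lie X, y], y] = c' *: y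
    & 2 *: [lie [lie X, x], y] = ((2 - mu%:R) * c) *: y + (mu%:R * c') *: x].
Proof.
move=> gx gy xy; have [c Ax] := diagonal_line gx; have [c' Ay] := diagonal_line gy.
exists c, c'; split=> //.
have x0 : x <> 0.
  move=> x0; have [] := xy 1 0; first by rewrite x0 scaler0 scale0r addr0.
  by move/eqP; rewrite oner_eq0.
have y0 : y <> 0.
  move=> y0; have [] := xy 0 1; first by rewrite y0 scaler0 scale0r addr0.
  by move=> _ /eqP; rewrite oner_eq0.
have [s sE] := relation_line gx gy x0 Ax.
have [t tE] := relation_line gy gx y0 Ay.
have pol := polarization gx gy xy Ax Ay.
have h : mu.+1%:R != 0 :> F by rewrite pnatr_eq0.
set P := [lie [lie X, x], y] in sE tE pol *.
set Q := [lie [lie X, y], x] in sE tE pol *.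
have e1 : (mu.+1%:R * 2) *: P = (mu.+1%:R * ((2 - mu%:R) * c)) *: y
    + (s + 2 * c') *: x.
  transitivity (((2 * mu%:R) *: P + (c * mu%:R * (mu%:R - 1)) *: y - 2 *: Q)
      + 2 *: (P + Q) - (c * mu%:R * (mu%:R - 1)) *: y).
    by rewrite -natr1; lmod.
  by rewrite sE pol -natr1; lmod.
have e2 : (mu.+1%:R * 2) *: Q = (mu.+1%:R * ((2 - mu%:R) * c')) *: x
    + (t + 2 * c) *: y.
  transitivity (((2 * mu%:R) *: Q + (c' * mu%:R * (mu%:R - 1)) *: x - 2 *: P)
      + 2 *: (P + Q) - (c' * mu%:R * (mu%:R - 1)) *: x).
    by rewrite -natr1; lmod.
  by rewrite tE pol -natr1; lmod.
have e3 : (mu.+1%:R * 2) *: P + (mu.+1%:R * 2) *: Q =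
   (mu.+1%:R * 2) *: (c' *: x + c *: y) by rewrite -scalerDr pol.
have [] := xy (s + 2 * c' + mu.+1%:R * ((2 - mu%:R) * c') - mu.+1%:R * 2 * c')
  (t + 2 * c + mu.+1%:R * ((2 - mu%:R) * c) - mu.+1%:R * 2 * c).
  transitivity ((mu.+1%:R * 2) *: P + (mu.+1%:R * 2) *: Q -
    (mu.+1%:R * 2) *: (c' *: x + c *: y)); last by rewrite e3 subrr.
  by rewrite e1 e2; lmod.
move=> hs _; apply: (scalerI h); rewrite scalerA e1.
have -> : s + 2 * c' = mu.+1%:R * (mu%:R * c').
  by apply/eqP; rewrite -subr_eq0 -hs; apply/eqP; ring.
by lmod.
Qed.

End DegreeOne.

Section DegreeOneBasis.
Variables (F : numFieldType) (g : glaType F) (n mu : nat) (v : 'I_n -> g).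
Hypothesis H : free_prolongation mu v.
Hypothesis big : (2 < mu)%N \/ (2 < n)%N.

Lemma basis_indep i j : i != j ->
  forall a b : F, a *: v i + b *: v j = 0 -> a = 0 /\ b = 0.
Proof.
move=> ij a b ab.
have h : \sum_k (if k == i then a else if k == j then b else 0) *: v k = 0.
  rewrite (bigD1 i) // (bigD1 j) 1?eq_sym //= !eqxx eq_sym (negPf ij) addrA ab add0r.
  by apply: big1 => k /andP[/negPf-> /negPf->]; rewrite scale0r.
have := fp_free H h => {}h; have := h i; rewrite eqxx => ->.
by have := h j; rewrite eqxx eq_sym (negPf ij) => ->.
Qed.

(** The scalars of [degree_one_pair] are eigenvalues on nonzero vectors, hence independent of the
    pair: one family [gam] serves all i, j. *)
Lemma degree_one_basis X : grade 1 X -> exists gam : 'I_n -> F, forall i j,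
  2 *: [lie [lie X, v i], v j] =
    ((2 - mu%:R) * gam i) *: v j + (mu%:R * gam j) *: v i.
Proof.
move=> gX; have gv := fp_grade H.
have [gam gamE] := choice (fun i => diagonal_line H gX big (gv i)).
exists gam => i j; have [<-|ij] := eqVneq i j; first by rewrite gamE; lmod.
have vi0 k l : k != l -> v k <> 0.
  move=> kl v0; have [] := basis_indep kl (a := 1) (b := 0).
    by rewrite v0 scaler0 scale0r addr0.
  by move/eqP; rewrite oner_eq0.
have [c [c' [Ai Aj Aij]]] := degree_one_pair H gX big (gv i) (gv j) (basis_indep ij).
rewrite Aij.
have inj k l (a b : F) : k != l -> a *: v k = b *: v k -> a = b.
  move=> kl /eqP; rewrite -subr_eq0 -scalerBl scaler_eq0 => /orP[].
    by rewrite subr_eq0 => /eqP.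
  by move=> /eqP h; case: (vi0 _ _ kl h).
have -> : gam i = c by apply: (inj i j) => //; rewrite -Ai -gamE.
have -> // : gam j = c'.
by apply: (inj j i); [rewrite eq_sym|rewrite -Aj -gamE].
Qed.
End DegreeOneBasis.

Lemma ord_other n (i : 'I_n) : (1 < n)%N -> exists j, j != i.
Proof.
move=> n1; pose k := if (i == 0%N :> nat) then 1%N else 0%N.
have kn : (k < n)%N by rewrite /k; case: ifP; lia.
by exists (Ordinal kn); rewrite -val_eqE /= /k; case: ifP; lia.
Qed.

Lemma ord_other2 n (i j : 'I_n) : (2 < n)%N -> exists k, (k != i) && (k != j).
Proof.
move=> n2; pose k := if (i != 0%N :> nat) && (j != 0%N :> nat) then 0%N else
  if (i != 1%N :> nat) && (j != 1%N :> nat) then 1%N else 2%N.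
have kn : (k < n)%N by rewrite /k; do 2?case: ifP; lia.
by exists (Ordinal kn); rewrite -!val_eqE /= /k; do 2?case: ifP; lia.
Qed.

(** * Vanishing of g_1 *)

Section Vanishing.
Variables (F : numFieldType) (g : glaType F) (n mu : nat) (v : 'I_n -> g).
Hypothesis H : free_prolongation mu v.

(** With at most one generator V is abelian and generates only itself, so g_(-mu) would be 0
    although mu >= 2. *)
Lemma rank_gt1 : (1 < n)%N.
Proof.
rewrite ltnNge; apply/negP => n1.
have vv i j : [lie v i, v j] = 0.
  have -> : j = i by apply/val_inj; case: i j => i hi [j hj] /=; lia.
  exact: lie_bracketxx.
apply: (fp_kind H) => x gx.
have nx : negative_part x by apply: grade_neg gx; have := fp_mu H; lia.
have [c xc] : exists c : 'I_n -> F, x = \sum_i c i *: v i.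
  apply: (fp_gen H (S := fun x => exists c : 'I_n -> F, x = \sum_i c i *: v i)) nx.
    split=> [|y z [c ->] [d ->]].
      split=> [|a y z [c ->] [d ->]].
        by exists (fun=> 0); rewrite big1 // => i _; rewrite scale0r.
      exists (fun i => a * c i + d i).
      rewrite scaler_sumr -big_split; apply: eq_bigr => i _ /=.
      by rewrite scalerDl scalerA.
    exists (fun=> 0); rewrite [RHS]big1 => [|i _]; last by rewrite scale0r.
    rewrite lie_suml big1 // => i _; rewrite lie_sumr big1 // => j _.
    by rewrite !lieE vv !scaler0.
  move=> i; exists (fun j => (j == i)%:R).
  rewrite (bigD1 i) //= eqxx scale1r big1 ?addr0 // => j /negPf ->.
  by rewrite scale0r.
have gx1 : grade (- 1) x.
  by rewrite xc; apply: grade_sum => i _; apply: gradeZ; apply: fp_grade H i.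
by apply: grade_disjoint gx1 gx _; have := fp_mu H; lia.
Qed.

Lemma adn_fil_lin (a b : F) k : (k < mu)%N ->
  @adn F (filiform F mu) (a *: filX F mu + b *: filY F mu 1) k (filY F mu 1) =
  a ^+ k *: filY F mu k.+1.
Proof.
elim: k => [|k IHk] kmu; first by rewrite scale1r.
rewrite adnS IHk; last by lia.
rewrite !lieE filXY ?filYY; try lia.
by rewrite exprS; lmod.
Qed.

(* With gam the linear form of [degree_one_basis], gam x != 0 and gam y = gam z
   = 0, the map ad X is nonzero on the following elements of degree -(mu+1),
   which vanish: [[x, y], ad_y^(mu-2) x] if n = 2, and [z, ad_y^(mu-1) x] if
   n >= 3. *)
Lemma degree_one_zero (X : g) : (2 < mu)%N -> (2 < n)%N \/ (3 < mu)%N ->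
  grade 1 X -> X = 0.
Proof.
move=> mu2 nmu gX; have gv := fp_grade H; have mu1 := fp_mu H; have n1 := rank_gt1.
have [gam gamE] := degree_one_basis H (or_introl mu2) gX.
have h2 : 2 != 0 :> F by rewrite pnatr_eq0.
have hmu : mu%:R != 0 :> F by rewrite pnatr_eq0; lia.
have [gam0|/existsNP [i /eqP gi]] := pselect (forall i, gam i = 0).
  apply: (trans_v H gX) => i; apply: (trans_v H (k := 0)) => [|j].
    exact: (grade_lie_eq gX (gv i)).
  by apply: (scalerI h2); rewrite gamE !gam0 !mulr0 !scale0r addr0 scaler0.
exfalso.
have [j ji] := ord_other i n1.
pose x := v i; pose y := gam i *: v j - gam j *: v i.
pose B i j := [lie [lie X, v i], v j].
have gx : grade (- 1) x by exact: gv.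
have gy : grade (- 1) y by apply: gradeB; apply: gradeZ; apply: gv.
have Axy : 2 *: [lie [lie X, x], y] = ((2 - mu%:R) * gam i) *: y.
  rewrite /x /y !lieE; transitivity (gam i *: (2 *: B i j) - gam j *: (2 *: B i i)); first lmod.
  by rewrite /B !gamE; lmod.
have Ayx : 2 *: [lie [lie X, y], x] = (mu%:R * gam i) *: y.
  rewrite /x /y !lieE; transitivity (gam i *: (2 *: B j i) - gam j *: (2 *: B i i)); first lmod.
  by rewrite /B !gamE; lmod.
have Ayy : [lie [lie X, y], y] = 0.
  apply: (scalerI h2); rewrite scaler0.
  rewrite /x /y !lieE; transitivity (gam i *: (gam i *: (2 *: B j j) - gam j *: (2 *: B j i))
    - gam j *: (gam i *: (2 *: B i j) - gam j *: (2 *: B i i))); first lmod.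
  by rewrite /B !gamE; lmod.
(* A_y y = 0, while A_x y and A_y x are multiples of y; [adn_degree_one] leaves only ad_y^(k+1)
   applied to multiples of y. *)
have Xk k : [lie X, adn y k.+2 x] = 0.
  apply: (scalerI h2); rewrite (@adn_degree_one F g X y x 0) ?scale0r //.
  rewrite !mul0r scale0r addr0 scaler0 mulrC -scalerA -adnZ Ayx adnZ adnxx //.
  by rewrite -adnZ Axy adnZ adnxx // !scaler0 subrr.
have [n3|n3] := ltnP 2 n.
  have [l /andP[li lj]] := ord_other2 i j n3.
  pose z := gam i *: v l - gam l *: v i.
  have gz : grade (- 1) z by apply: gradeB; apply: gradeZ; apply: gv.
  have Azx : 2 *: [lie [lie X, z], x] = (mu%:R * gam i) *: z.
    rewrite /x /y /z !lieE; transitivity (gam i *: (2 *: B l i) - gam l *: (2 *: B i i)); first lmod.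
    by rewrite /B !gamE; lmod.
  have Azy : [lie [lie X, z], y] = 0.
    apply: (scalerI h2); rewrite scaler0.
    rewrite /x /y /z !lieE; transitivity (gam i *: (gam i *: (2 *: B l j) - gam j *: (2 *: B l i))
      - gam l *: (gam i *: (2 *: B i j) - gam j *: (2 *: B i i))); first lmod.
    by rewrite /B !gamE; lmod.
  have W0 : [lie z, adn y mu.-1 x] = 0.
    by apply: (below_zero H _ (gradeL gz (adn_grade _ gy gx))); lia.
  have : 2 *: [lie X, [lie z, adn y mu.-1 x]] = 0 by rewrite W0 lie0r scaler0.
  (* By [Xk] only [A_z, ad_y^(mu-1) x] survives. A_z commutes with y, so this is ad_y^(mu-1) applied
     to A_z x, a nonzero multiple of z. *)
  rewrite lieJr (_ : mu.-1 = (mu - 3).+2); last by lia.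
  rewrite Xk lie0r addr0 adn_der // -adnZ Azx adnZ => /eqP.
  rewrite scaler_eq0 mulf_eq0 (negPf hmu) (negPf gi) /= => /eqP.
  have [phi [hphi pj pl pi]] : exists phi : {linear g -> filiform F mu},
    [/\ forall x y, negative_part x -> negative_part y ->
          phi [lie x, y] = [lie phi x, phi y],
        phi (v j) = filX F mu, phi (v l) = filY F mu 1 & phi (v i) = 0].
    apply: (fil_of_free3 H) => // a b c abc.
    have h : \sum_k (if k == j then a else if k == l then b else
        if k == i then c else 0) *: v k = 0.
      rewrite (bigD1 j) // (bigD1 l) // (bigD1 i) /=; last by rewrite !(eq_sym i) ji li.
      rewrite !eqxx (negPf lj) !(eq_sym i) (negPf ji) (negPf li) !addrA abc add0r.
      by apply: big1 => k /andP[/andP[/negPf-> /negPf->] /negPf->]; rewrite scale0r.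
    have := fp_free H h => {}h; have := h j; rewrite eqxx => ->.
    have := h l; rewrite eqxx (negPf lj) => ->.
    by have := h i; rewrite eqxx !(eq_sym i) (negPf ji) (negPf li) => ->.
  rewrite -!adnS => /(congr1 phi); rewrite (phi_adn _ hphi) // linear0.
  have -> : phi y = gam i *: filX F mu + 0 *: filY F mu 1.
    by rewrite /y linearB !linearZ /= pj pi; lmod.
  have -> : phi z = gam i *: filY F mu 1.
    by rewrite /z linearB !linearZ /= pl pi; lmod.
  rewrite adnZ adn_fil_lin; last by lia.
  move/eqP; rewrite scalerA scaler_eq0 mulf_eq0 expf_eq0 (negPf gi) andbF /=.
  by move/eqP/filYmu_neq0.
have mu3 : (3 < mu)%N by case: nmu => //; lia.
have gxy : grade (- 2) [lie x, y] by apply: (grade_lie_eq gx gy).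
have W0 : [lie [lie x, y], adn y (mu - 2)%N x] = 0.
  by apply: (below_zero H _ (gradeL gxy (adn_grade _ gy gx))); lia.
have : 2 *: [lie X, [lie [lie x, y], adn y (mu - 2)%N x]] = 0.
  by rewrite W0 lie0r scaler0.
(* [Xk] requires mu - 2 >= 2 here: this is where (2, 3) escapes. What remains is [X, [x, y]], a
   nonzero multiple of y, bracketed with ad_y^(mu-2) x. *)
rewrite lieJr [in X in _ + X](_ : (mu - 2)%N = (mu - 4).+2); last by lia.
rewrite Xk lie0r addr0 -lieZl.
have -> : 2 *: [lie X, [lie x, y]] = (2 * (1 - mu%:R) * gam i) *: y.
  transitivity (2 *: [lie [lie X, x], y] - 2 *: [lie [lie X, y], x]).
    by rewrite lieJr [[lie x, _]]lieC; lmod.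
  by rewrite Axy Ayx; lmod.
rewrite lieZl -adnS (_ : (mu - 2).+1 = mu.-1); last by lia.
move/eqP; rewrite scaler_eq0 !mulf_eq0 (negPf gi) (negPf h2) /= orbF.
have -> : (1 - mu%:R == 0 :> F) = false.
  by rewrite subr_eq0 eq_sym pnatr_eq1; lia.
have [phi [hphi _ pj pi]] := fil_of_free2 H (gv j) (gv i) (basis_indep H ji).
move=> /eqP /(congr1 phi); rewrite (phi_adn _ hphi) // linear0 pi.
have -> : phi y = gam i *: filX F mu + (- gam j) *: filY F mu 1.
  by rewrite /y linearB !linearZ /= pj pi; lmod.
rewrite adn_fil_lin; last by lia.
move/eqP; rewrite scaler_eq0 expf_eq0 (negPf gi) andbF /=.
by move/eqP/filYmu_neq0.
Qed.

End Vanishing.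

(** * Extending derivations and the torus of g_0 *)

Section DeltaSums.
Variables (F : fieldType) (L : lmodType F) (I : finType).

Lemma sum_deltaZ (f : I -> L) i : \sum_j (j == i)%:R *: f j = f i.
Proof.
rewrite (bigD1 i) //= eqxx scale1r big1 ?addr0 // => j /negPf ->.
by rewrite scale0r.
Qed.
Lemma sum_delta (f : I -> F) i : \sum_j (j == i)%:R * f j = f i.
Proof.
rewrite (bigD1 i) //= eqxx mul1r big1 ?addr0 // => j /negPf ->.
by rewrite mul0r.
Qed.
End DeltaSums.

(** The span as the intersection of all subspaces containing the family: a membership proof is then
    itself an induction principle for linear properties. *)
Definition lspan (F : fieldType) (L : lmodType F) (I : Type) (b : I -> L) (x : L) :=
  forall P : L -> Prop, is_subspace P -> (forall i, P (b i)) -> P x.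

Section Span.
Variables (F : fieldType) (L : lmodType F) (I : Type) (b : I -> L).

Lemma lspan_subspace : is_subspace (lspan b).
Proof.
split=> [P sP _|a x y sx sy P sP bP]; first exact: subspace0.
by apply: subspaceD => //; [apply: subspaceZ => //; apply: sx|apply: sy].
Qed.
Lemma lspan_in i : lspan b (b i). Proof. by move=> P _; apply. Qed.
Lemma lspan0 : lspan b 0. Proof. exact: subspace0 lspan_subspace. Qed.

End Span.

Lemma lspan_trans (F : fieldType) (L : lmodType F) I J (b : I -> L) (d : J -> L) x :
  (forall i, lspan d (b i)) -> lspan b x -> lspan d x.
Proof. by move=> bd sx; apply: (sx _ (lspan_subspace d)). Qed.

Lemma lspan_fin (F : fieldType) (L : lmodType F) (I : finType) (b : I -> L) x :
  lspan b x -> exists c : I -> F, x = \sum_i c i *: b i.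
Proof.
move=> sx; apply: (sx (fun x => exists c : I -> F, x = \sum_i c i *: b i)) => [|i].
  2: by exists (fun j => (j == i)%:R); rewrite sum_deltaZ.
split=> [|a y z [c ->] [d ->]].
  by exists (fun=> 0); rewrite big1 // => i _; rewrite scale0r.
exists (fun i => a * c i + d i).
rewrite scaler_sumr -big_split; apply: eq_bigr => i _ /=.
by rewrite scalerDl scalerA.
Qed.

Lemma lspan_sum (F : fieldType) (L : lmodType F) (I : finType) (b : I -> L)
  (c : I -> F) : lspan b (\sum_i c i *: b i).
Proof.
apply: (subspace_sum (lspan_subspace b)) => i _.
by apply: (subspaceZ (lspan_subspace b)); apply: lspan_in.
Qed.

Section NegativePart.
Variables (F : fieldType) (g : glaType F).

Lemma neg_subspace : is_subspace (@negative_part F g).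
Proof.
split=> [|a x y /negative_part_pr nx /negative_part_pr ny]; apply/negative_part_pr.
  by move=> p _; rewrite linear0.
by move=> p p0; rewrite linearP /= nx // ny // scaler0 addr0.
Qed.

Lemma neg_lie (x y : g) : negative_part x -> negative_part y -> negative_part [lie x, y].
Proof.
move=> [s [c [hc ->]]] [t [d [hd ->]]].
rewrite lie_suml; apply: (subspace_sum_seq neg_subspace) => p /hc [p0 gp].
rewrite lie_sumr; apply: (subspace_sum_seq neg_subspace) => q /hd [q0 gq].
by apply: (grade_neg _ (gradeL gp gq)); lia.
Qed.

Lemma pr_lie p q (u x : g) : grade q u -> pr (q + p) [lie u, x] = [lie u, pr p x].
Proof.
move=> gu; move: x; apply: grade_ind.
  by split=> [|a x y ex ey]; rewrite ?linear0 ?lie0r ?linear0 // lie_bracketPr !linearP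
    /= lie_bracketPr ex ey.
move=> r x gx; rewrite (pr_grade _ gx) (pr_grade _ (gradeL gu gx)).
rewrite (inj_eq (addrI q)); by case: eqP => // _; rewrite lie0r.
Qed.
End NegativePart.

Section Extension.
Variables (F : numFieldType) (g : glaType F) (n mu : nat) (v : 'I_n -> g).
Hypothesis H : free_prolongation mu v.
Let gv := fp_grade H.

Lemma neg_lspan I (b : I -> g) : (forall i, lspan b (v i)) ->
  (forall i j, lspan b [lie b i, b j]) -> forall x, negative_part x -> lspan b x.
Proof.
move=> bv bb; apply: (fp_gen H) => //; split=> [|x y sx sy].
  exact: lspan_subspace.
have [s0 sD] := lspan_subspace b.
apply: (sx (fun x => lspan b [lie x, y])).
  by split=> [|a u w su sw]; rewrite ?lie0l // lie_bracketPl; apply: sD.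
move=> i; apply: (sy (fun y => lspan b [lie b i, y])).
  by split=> [|a u w su sw]; rewrite ?lie0r // lie_bracketPr; apply: sD.
by move=> j; apply: bb.
Qed.

Lemma phi_basis i j : i != j -> exists phi : {linear g -> filiform F mu},
    [/\ forall x y, negative_part x -> negative_part y ->
          phi [lie x, y] = [lie phi x, phi y],
        forall p x, p < 0 -> grade p x -> grade p (phi x)
      & forall k, phi (v k) = (k == i)%:R *: filX F mu + (k == j)%:R *: filY F mu 1].
Proof.
move=> ij; have ji : (j == i) = false by rewrite eq_sym (negPf ij).
apply: (fp_fil H (xi := fun k => (k == i)%:R) (eta := fun k => (k == j)%:R)
  (a := fun k => (k == i)%:R) (b := fun k => (k == j)%:R));
  by rewrite sum_delta ?eqxx // ?ji // (negPf ij).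
Qed.

(** The i-th coordinate is the X-coefficient of the degree -1 component under a homomorphism sending
    v_i to X; [rank_gt1] supplies an index j for Y_1. *)
Lemma coord_exists : exists xi : 'I_n -> g -> F,
  [/\ forall i a x y, xi i (a *: x + y) = a * xi i x + xi i y,
      forall i j, xi i (v j) = (j == i)%:R
    & forall i p x, p != - 1 -> grade p x -> xi i x = 0].
Proof.
have ex i : exists xi : g -> F,
  [/\ forall a x y, xi (a *: x + y) = a * xi x + xi y,
      forall j, xi (v j) = (j == i)%:R
    & forall p x, p != - 1 -> grade p x -> xi x = 0].
  have [j ji] := ord_other i (rank_gt1 H); have ij : i != j by rewrite eq_sym.
  have [phi [_ _ phiv]] := phi_basis ij.
  exists (fun x => phi (pr (- 1) x) 0 0); split=> [a x y|k|p x p1 gx].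
  - by rewrite !linearP !mxE.
  - rewrite (pr_id (gv k)) phiv mxE [X in X + _]mxE [X in _ + X]mxE filX0 (filY0 F (fp_mu H)).
      by rewrite mulr1 mulr0 addr0.
    by have := fp_mu H; lia.
  - by rewrite (pr_grade _ gx) eq_sym (negPf p1) linear0 mxE.
have [xi xiE] := choice ex; exists xi.
by split=> [i|i|i]; have [] := xiE i.
Qed.

(** The form dual to [v_i, v_j] is the Y_2-coefficient under v_i -> X, v_j -> Y_1, all other
    generators going to 0. So antisymmetry is the only linear relation between these brackets. *)
Lemma coord2_exists : exists om : 'I_n -> 'I_n -> g -> F,
  [/\ forall i j a x y, om i j (a *: x + y) = a * om i j x + om i j y,
      forall i j k l, om i j [lie v k, v l] =
        (k == i)%:R * (l == j)%:R - (k == j)%:R * (l == i)%:R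
    & forall i j p x, p != - 2 -> grade p x -> om i j x = 0].
Proof.
have ex (ij : 'I_n * 'I_n) : exists om : g -> F,
  [/\ forall a x y, om (a *: x + y) = a * om x + om y,
      forall k l, om [lie v k, v l] =
        (k == ij.1)%:R * (l == ij.2)%:R - (k == ij.2)%:R * (l == ij.1)%:R
    & forall p x, p != - 2 -> grade p x -> om x = 0].
  case: ij => i j /=; have [->|ij] := eqVneq i j.
    by exists (fun=> 0); split=> [a x y|k l|//]; rewrite ?mulr0 ?addr0 // subrr.
  have [phi [hphi _ phiv]] := phi_basis ij.
  exists (fun x => phi (pr (- 2) x) 0 (inord 2)); split=> [a x y|k l|p x p1 gx].
  - by rewrite !linearP !mxE.
  - have gkl : grade (- 2) [lie v k, v l] by apply: (grade_lie_eq (gv k) (gv l)).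
    rewrite (pr_id gkl) hphi; try exact: v_neg H _.
    rewrite !phiv !lieE !lie_bracketxx [[lie filY F mu 1, _]]lieC.
    rewrite (filXY F (fp_mu H)); last by have := fp_mu H; lia.
    by rewrite !mxE !eqxx /=; ring.
  - by rewrite (pr_grade _ gx) eq_sym (negPf p1) linear0 mxE.
have [om omE] := choice ex; exists (fun i j => om (i, j)).
by split=> [i j|i j|i j]; have [] := omE (i, j).
Qed.

(** The u that satisfy the Leibniz rule against every w form a subalgebra by the Jacobi identity, so
    the rule for the generators v_i is enough. *)
Lemma extend_derivation (k : nat) (X : {linear g -> g}) :
  (forall p u, p < 0 -> grade p u -> grade (p + k%:Z) (X u)) ->
  (forall i u, negative_part u -> X [lie v i, u] = [lie X (v i), u] + [lie v i, X u]) ->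
  exists2 x, grade k%:Z x & forall u, negative_part u -> [lie x, u] = X u.
Proof.
move=> gX dX; apply: (fp_prol H) => // u w nu; move: w.
have := fp_gen H (S := fun u => negative_part u /\ forall w, negative_part w ->
  X [lie u, w] = [lie X u, w] + [lie u, X w]).
move=> /(_ _ _ u nu)[]; first 2 last => //.
- split=> [|x y [nx hx] [ny hy]]; last first.
    split=> [|w nw]; first exact: neg_lie.
    have nyw := neg_lie ny nw; have nxw := neg_lie nx nw.
    rewrite lieJl linearB /= (hx _ nyw) (hy _ nxw) (hy _ nw) (hx _ nw) (hx _ ny).
    by rewrite !lieE (lieJl (X x)) (lieJl x (X y)) (lieJl x y); lmod.
  split=> [|a x y [nx hx] [ny hy]].
    by split=> [|w _]; rewrite ?linear0 ?lie0l ?linear0 ?addr0 //; apply: subspace0 (neg_subspace g).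
  split=> [|w nw]; first by case: (neg_subspace g) => _; apply.
  by rewrite lie_bracketPl !linearP /= hx // hy // !lieE; lmod.
- by move=> i; split=> [|w nw]; [apply: v_neg H _|apply: dX].
Qed.

End Extension.

Section LinearPart.
Variables (F : numFieldType) (g : glaType F) (n mu : nat) (v : 'I_n -> g).
Hypothesis H : free_prolongation mu v.
Let gv := fp_grade H.
Variable xi : 'I_n -> g -> F.
Hypothesis xi_lin : forall i a x y, xi i (a *: x + y) = a * xi i x + xi i y.
Hypothesis xiv : forall i j, xi i (v j) = (j == i)%:R.
Variable E : 'I_n -> 'I_n -> g.
Hypothesis gE : forall i j, grade 0 (E i j).
Hypothesis Ev : forall i j k, [lie E i j, v k] = (k == j)%:R *: v i.

Lemma dual0 i : xi i 0 = 0.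
Proof.
have := xi_lin i 1 0 0; rewrite scaler0 addr0 mul1r.
by move/(congr1 (fun t => t - xi i 0)); rewrite addrK subrr => <-.
Qed.
Lemma dualD i x y : xi i (x + y) = xi i x + xi i y.
Proof. by have := xi_lin i 1 x y; rewrite scale1r mul1r. Qed.
Lemma dualZ i a x : xi i (a *: x) = a * xi i x.
Proof. by have := xi_lin i a x 0; rewrite !addr0 dual0 addr0. Qed.
Lemma dualN i x : xi i (- x) = - xi i x.
Proof. by rewrite -scaleN1r dualZ mulN1r. Qed.
Definition dualE := (dualD, dualZ, dualN, dual0, xiv).
Lemma dual_sum I (r : seq I) P (f : I -> g) i :
  xi i (\sum_(j <- r | P j) f j) = \sum_(j <- r | P j) xi i (f j).
Proof. exact: (big_morph _ (dualD i) (dual0 i)). Qed.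

Lemma V_coord x : grade (- 1) x -> x = \sum_i xi i x *: v i.
Proof.
move=> /(fp_span H) [c ->]; apply: eq_bigr => i _; rewrite dual_sum.
rewrite (eq_bigr (fun j => (j == i)%:R * c j)) ?sum_delta // => j _.
by rewrite !dualE mulrC.
Qed.

Lemma V_ind (P : g -> Prop) : is_subspace P -> (forall i, P (v i)) ->
  forall x, grade (- 1) x -> P x.
Proof.
move=> sP Pv x /V_coord ->; apply: subspace_sum => // i _.
by apply: subspaceZ.
Qed.

Lemma V_eq0 x : grade (- 1) x -> (forall i, xi i x = 0) -> x = 0.
Proof. by move=> /V_coord {2}-> x0; apply: big1 => i _; rewrite x0 scale0r. Qed.

Lemma gl_coord x : grade 0 x -> x = \sum_j \sum_i xi i [lie x, v j] *: E i j.
Proof.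
move=> gx; apply: (trans_v_eq H gx) => [|k].
  by do 2![apply: grade_sum => ? _]; apply: gradeZ.
rewrite lie_suml (eq_bigr (fun j => (j == k)%:R *: [lie x, v j])).
  by rewrite sum_deltaZ.
move=> j _; rewrite lie_suml.
have gxv : grade (- 1) [lie x, v j] by apply: (grade_lie_eq gx (gv j)).
rewrite [in RHS](V_coord gxv) scaler_sumr; apply: eq_bigr => i _.
by rewrite lieZl Ev !scalerA mulrC eq_sym.
Qed.

Definition scalar_elt : g := \sum_i E i i.
Definition grading_elt : g := - scalar_elt.

Lemma scalar_elt_v k : [lie scalar_elt, v k] = v k.
Proof.
rewrite lie_suml (eq_bigr (fun j => (j == k)%:R *: v j)) ?sum_deltaZ // => j _.
by rewrite Ev eq_sym.
Qed.

Lemma grading_elt_grade : grade 0 grading_elt.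
Proof. by apply: gradeN; apply: grade_sum => i _; apply: gE. Qed.

(** Negative degrees: homogeneous eigenvectors contain the v_i and are closed under brackets, hence
    span. Degree k >= 0: transitivity reduces x to the elements [x, v_i] of degree k - 1. *)
Lemma grading_eltP p x : grade p x -> [lie grading_elt, x] = p%:~R *: x.
Proof.
have Edv i : [lie grading_elt, v i] = - v i by rewrite lieNl scalar_elt_v.
have [p0|p0] := ltP p 0.
  move=> gx; pose T := {u : g | exists2 q, grade q u & [lie grading_elt, u] = q%:~R *: u}.
  have : lspan (fun u : T => sval u) x.
    apply: (neg_lspan H) (grade_neg p0 gx) => [i|[u [q gu eu]] [w [r gw ew]] /=].
      have Tv : exists2 q, grade q (v i) & [lie grading_elt, v i] = q%:~R *: v i.
        by exists (-1) => //; rewrite Edv mulrN1z scaleN1r.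
      exact: (lspan_in (exist _ (v i) Tv : T)).
    have Tw : exists2 q', grade q' [lie u, w] &
        [lie grading_elt, [lie u, w]] = q'%:~R *: [lie u, w].
      by exists (q + r); [apply: gradeL|rewrite lieJr eu ew !lieE intrD; lmod].
    exact: (lspan_in (exist _ [lie u, w] Tw : T)).
  move=> /(_ (fun u => forall q, [lie grading_elt, pr q u] = q%:~R *: pr q u)) h.
  rewrite -(pr_id gx); apply: h.
    split=> [q|a u w hu hw q]; first by rewrite linear0 lie0r scaler0.
    by rewrite linearP /= lie_bracketPr hu hw; lmod.
  move=> [u [q gu eu]] r /=; rewrite (pr_grade _ gu); case: eqP => [->//|_].
  by rewrite lie0r scaler0.
case: p p0 => // k _; elim: k x => [|k IHk] x gx.
  rewrite mulr0z scale0r; apply: (trans_v_eq H (k := 0)) => [||i].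
  - exact: (grade_lie_eq grading_elt_grade gx).
  - exact: grade0.
  have gxv : grade (- 1) [lie x, v i] by apply: (grade_lie_eq gx (gv i)).
  rewrite lieJl Edv lieNr lie0l; apply: (V_ind _ _ gxv (P := fun u => [lie grading_elt, u] - - u = 0)).
    split=> [|a u w hu hw]; first by rewrite lie0r oppr0 subr0.
    transitivity (a *: ([lie grading_elt, u] - - u) + ([lie grading_elt, w] - - w)).
      by rewrite !lieE; lmod.
    by rewrite hu hw scaler0 addr0.
  by move=> j; rewrite Edv subrr.
apply: (trans_v_eq H (k := k.+1)) => [||i].
- by apply: (grade_lie_eq grading_elt_grade gx); rewrite add0r.
- exact: gradeZ.
have gxv : grade k%:Z [lie x, v i] by apply: (grade_lie_eq gx (gv i)); lia.
rewrite lieJl Edv lieNr (IHk _ gxv) lieZl -[k.+1]addn1 PoszD intrD; lmod.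
Qed.

Definition torus (y : g) := grade 0 y /\ exists d : 'I_n -> F, forall i, [lie y, v i] = d i *: v i.
Definition eps i (y : g) : F := xi i [lie y, v i].

Lemma torus_eps y i : torus y -> [lie y, v i] = eps i y *: v i.
Proof.
by case=> _ [d dE]; rewrite /eps dE dualE xiv eqxx mulr1.
Qed.

Lemma eps_lin i a x y : eps i (a *: x + y) = a * eps i x + eps i y.
Proof. by rewrite /eps lie_bracketPl !dualE. Qed.

Lemma torus_subspace : is_subspace torus.
Proof.
split=> [|a x y [gx [d dE]] [gy [f fE]]].
  by split; [apply: grade0|exists (fun=> 0) => i; rewrite lie0l scale0r].
split; first by apply: gradeD => //; apply: gradeZ.
by exists (fun i => a * d i + f i) => i; rewrite lie_bracketPl dE fE; lmod.
Qed.

Lemma torus_E i : torus (E i i).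
Proof.
split=> //; exists (fun k => (k == i)%:R) => k; rewrite Ev.
by case: eqP => [->//|]; rewrite !scale0r.
Qed.

Lemma eps_E i k : eps k (E i i) = (k == i)%:R.
Proof.
by rewrite /eps Ev dualE xiv; case: eqP => [->|]; rewrite ?mul0r // eqxx mulr1.
Qed.

Lemma torus_exists (d : 'I_n -> F) : exists2 y, torus y & forall i, eps i y = d i.
Proof.
exists (\sum_i d i *: E i i).
  apply: subspace_sum; first exact: torus_subspace.
  by move=> i _; apply: (subspaceZ torus_subspace); apply: torus_E.
move=> i; rewrite /eps lie_suml dual_sum.
rewrite (eq_bigr (fun j => (j == i)%:R * d j)) ?sum_delta // => j _.
by rewrite lieZl dualZ -[xi i _]/(eps i (E j j)) eps_E mulrC eq_sym.
Qed.

Lemma torus_lie x y : torus x -> torus y -> [lie x, y] = 0.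
Proof.
move=> tx ty; apply: (trans_v H (k := 0)) => [|i].
  exact: (grade_lie_eq tx.1 ty.1).
rewrite lieJl (torus_eps i tx) (torus_eps i ty) !lieZr (torus_eps i tx) (torus_eps i ty).
lmod.
Qed.

Lemma eps_grading_elt i : eps i grading_elt = -1.
Proof. by rewrite /eps lieNl scalar_elt_v dualN xiv eqxx. Qed.

(** If x normalizes the torus, [x, E_ii] is diagonal. At v_i this says that [x, v_i] minus its
    v_i-component is a multiple of v_i, so x is diagonal. *)
Lemma torus_cartan : is_cartan_subalgebra (grade 0) torus.
Proof.
split=> [|x [] //||x gx hx].
- split; first exact: torus_subspace.
  by move=> x y tx ty; rewrite (torus_lie tx ty); case: torus_subspace.
- exists 1%N => -[|x [|z s]] y //= _ ts ty; apply: torus_lie => //.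
  by apply: ts; rewrite mem_head.
split=> //; exists (fun i => xi i [lie x, v i]) => i.
have [_ [d dE]] := hx _ (torus_E i).
have gxv : grade (- 1) [lie x, v i] by apply: (grade_lie_eq gx (gv i)).
have Eu u : grade (- 1) u -> [lie E i i, u] = xi i u *: v i.
  move: u; apply: (V_ind (P := fun u => [lie E i i, u] = xi i u *: v i)) => [|j].
  2: by rewrite Ev xiv.
  split=> [|a u w hu hw]; first by rewrite lie0r dual0 scale0r.
  by rewrite lie_bracketPr hu hw !dualE; lmod.
have := dE i; rewrite lieJl Ev eqxx scale1r Eu // => e.
have xe : [lie x, v i] = (d i + xi i [lie x, v i]) *: v i.
  by rewrite scalerDl -e subrK.
have et : xi i [lie x, v i] = d i + xi i [lie x, v i].
  by rewrite {1}xe dualZ xiv eqxx mulr1.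
by rewrite {1}xe -et.
Qed.

Lemma weight_lie y (a b : F) (x z : g) : [lie y, x] = a *: x -> [lie y, z] = b *: z ->
  [lie y, [lie x, z]] = (a + b) *: [lie x, z].
Proof. by move=> hx hz; rewrite lieJr hx hz !lieE; lmod. Qed.

Lemma torus_E_weight y i j : torus y -> [lie y, E i j] = (eps i y - eps j y) *: E i j.
Proof.
move=> ty; apply: (trans_v_eq H (k := 0)) => [||k].
- exact: (grade_lie_eq ty.1 (gE i j)).
- exact: gradeZ.
rewrite lieZl lieJl Ev (torus_eps k ty) !lieZr Ev (torus_eps i ty).
by case: (k =P j) => [->|_]; rewrite ?scale0r /=; lmod.
Qed.

(** The shape imposed by [degree_one_basis], with b half of [gam] so that no factor 2 remains. It
    identifies X in g_1 with the linear form b on V. *)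
Definition Gam (X : g) (b : 'I_n -> F) := forall i j,
  [lie [lie X, v i], v j] = ((2 - mu%:R) * b i) *: v j + (mu%:R * b j) *: v i.

Lemma Gam_lin a X Y b d : Gam X b -> Gam Y d -> Gam (a *: X + Y) (fun i => a * b i + d i).
Proof. by move=> hX hY i j; rewrite !lie_bracketPl hX hY; lmod. Qed.
Lemma Gam0 : Gam 0 (fun=> 0).
Proof. by move=> i j; rewrite !lie0l; lmod. Qed.
Lemma Gam_eq X b d : b =1 d -> Gam X b -> Gam X d.
Proof. by move=> bd hX i j; rewrite hX !bd. Qed.
Lemma GamB X Y b d : Gam X b -> Gam Y d -> Gam (X - Y) (fun i => b i - d i).
Proof. by move=> hX hY i j; rewrite !lieE hX hY; lmod. Qed.
Lemma GamN X b : Gam X b -> Gam (- X) (fun i => - b i).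
Proof. by move=> hX i j; rewrite !lieE hX; lmod. Qed.
Lemma GamZ a X b : Gam X b -> Gam (a *: X) (fun i => a * b i).
Proof. by move=> hX i j; rewrite !lieE hX; lmod. Qed.
Lemma Gam_sum I (r : seq I) (X : I -> g) b : (forall k, Gam (X k) (b k)) ->
  Gam (\sum_(k <- r) X k) (fun i => \sum_(k <- r) b k i).
Proof.
move=> hX; elim: r => [|k r IHr].
  by rewrite big_nil; apply: Gam_eq Gam0 => i; rewrite big_nil.
rewrite big_cons -[X k]scale1r; apply: Gam_eq (Gam_lin 1 (hX k) IHr) => i.
by rewrite big_cons mul1r.
Qed.

Lemma Gam_uniq X Y b : grade 1 X -> grade 1 Y -> Gam X b -> Gam Y b -> X = Y.
Proof.
move=> gX gY hX hY; apply: (trans_v_eq H gX gY) => i.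
apply: (trans_v_eq H (k := 0)) => [||j]; last by rewrite hX hY.
  exact: (grade_lie_eq gX (gv i)).
exact: (grade_lie_eq gY (gv i)).
Qed.

Lemma Gam_inj X b d : Gam X b -> Gam X d -> b =1 d.
Proof.
move=> hb hd i; have h2 : 2 != 0 :> F by rewrite pnatr_eq0.
apply: (mulfI h2); have /(congr1 (xi i)) := esym (hb i i).
by rewrite hd !dualE eqxx !mulr1 -!mulrDl !subrK.
Qed.

Lemma Gam_bil X b u w : Gam X b -> grade (- 1) u -> grade (- 1) w ->
  [lie [lie X, u], w] = ((2 - mu%:R) * \sum_i b i * xi i u) *: w
    + (mu%:R * \sum_i b i * xi i w) *: u.
Proof.
move=> hX gu; have bL a x y : \sum_i b i * xi i (a *: x + y) =
    a * (\sum_i b i * xi i x) + \sum_i b i * xi i y.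
  rewrite mulr_sumr -big_split; apply: eq_bigr => i _ /=; rewrite xi_lin; ring.
have b0 : \sum_i b i * xi i 0 = 0 by apply: big1 => i _; rewrite dual0 mulr0.
have bv j : \sum_i b i * xi i (v j) = b j.
  rewrite (eq_bigr (fun i => (i == j)%:R * b i)) ?sum_delta // => i _.
  by rewrite xiv mulrC eq_sym.
move: w; apply: (V_ind (P := fun w => [lie [lie X, u], w] =
  ((2 - mu%:R) * \sum_i b i * xi i u) *: w + (mu%:R * \sum_i b i * xi i w) *: u)).
  split=> [|a x y hx hy]; first by rewrite b0 lie0r; lmod.
  by rewrite lie_bracketPr hx hy bL; lmod.
move=> j; move: u gu; apply: (V_ind (P := fun u => [lie [lie X, u], v j] =
  ((2 - mu%:R) * \sum_i b i * xi i u) *: v j + (mu%:R * \sum_i b i * xi i (v j)) *: u)).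
  split=> [|a x y hx hy]; first by rewrite b0 !lieE; lmod.
  by rewrite lie_bracketPr lie_bracketPl hx hy !bL; lmod.
by move=> i; rewrite !bv; apply: hX.
Qed.

(** The sum is the composite form b o e evaluated at v_a: g_1 transforms under g_0 like linear forms
    on V. *)
Lemma Gam_lie0 X e b : grade 0 e -> Gam X b ->
  Gam [lie X, e] (fun a => \sum_i b i * xi i [lie e, v a]).
Proof.
move=> ge hX i j.
have gev k : grade (- 1) [lie e, v k] by apply: (grade_lie_eq ge (gv k)).
have -> : [lie [lie [lie X, e], v i], v j] = [lie [lie X, [lie e, v i]], v j]
    - [lie e, [lie [lie X, v i], v j]] + [lie [lie X, v i], [lie e, v j]].
  by rewrite (lieJl X e) lieDl lieNl (lieJl e [lie X, v i]) ; lmod.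
rewrite !(Gam_bil hX) // !lieE.
have bv k : \sum_i b i * xi i (v k) = b k.
  rewrite (eq_bigr (fun i => (i == k)%:R * b i)) ?sum_delta // => l _.
  by rewrite xiv mulrC eq_sym.
rewrite !bv; lmod.
Qed.

Hypothesis big : (2 < mu)%N \/ (2 < n)%N.
Lemma Gam_exists X : grade 1 X -> exists b, Gam X b.
Proof.
move=> gX; have [gam gamE] := degree_one_basis H big gX.
have h2 : 2 != 0 :> F by rewrite pnatr_eq0.
exists (fun i => 2^-1 * gam i) => i j; apply: (scalerI h2).
by rewrite gamE scalerDr !scalerA; congr (_ *: _ + _ *: _); field.
Qed.

Variable c : 'I_n -> g.
Hypothesis gc : forall k, grade 1 (c k).
Hypothesis cGam : forall k, Gam (c k) (fun i => (i == k)%:R).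

Lemma g1_coord X b : grade 1 X -> Gam X b -> X = \sum_i b i *: c i.
Proof.
move=> gX hX; apply: (Gam_uniq gX _ hX).
  by apply: grade_sum => i _; apply: gradeZ.
apply: Gam_eq (Gam_sum _ (fun k => GamZ (b k) (cGam k))) => i /=.
rewrite (eq_bigr (fun j => (j == i)%:R * b j)) ?sum_delta // => j _.
by rewrite mulrC eq_sym.
Qed.

Lemma torus_c_weight y k : torus y -> [lie y, c k] = - eps k y *: c k.
Proof.
move=> ty; apply: (Gam_uniq (b := fun i => - eps k y * (i == k)%:R)).
- exact: (grade_lie_eq ty.1 (gc k)).
- exact: gradeZ.
- rewrite lieC; have := GamN (Gam_lie0 ty.1 (cGam k)); apply: Gam_eq => i.
  rewrite sum_delta (torus_eps i ty) dualZ xiv mulNr; congr (- _).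
  by case: eqP => [->//|]; rewrite !mulr0.
- exact: GamZ.
Qed.

Lemma Gam_cc i j k : Gam [lie [lie c i, c j], v k] (fun a =>
  (2 * mu%:R - 2) * ((k == i)%:R * (a == j)%:R - (k == j)%:R * (a == i)%:R)).
Proof.
have gcv l m : grade 0 [lie c l, v m] by apply: (grade_lie_eq (gc l) (gv m)).
rewrite lieJl.
apply: Gam_eq (GamB (Gam_lie0 (gcv j k) (cGam i)) (Gam_lie0 (gcv i k) (cGam j))) => a /=.
rewrite !sum_delta !cGam !dualE; ring.
Qed.

Lemma g1_w X b k l : Gam X b ->
  [lie X, [lie v k, v l]] = ((2 * mu%:R - 2) * b l) *: v k - ((2 * mu%:R - 2) * b k) *: v l.
Proof.
move=> hX; rewrite lieJr [[lie v k, _]]lieC !hX; lmod.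
Qed.

End LinearPart.

(** * Roots and ideals *)

Section Roots.
Variables (F : fieldType) (L : lieAlgType F) (h : L -> Prop).
Variables (I : finType) (b : I -> L) (w : I -> L -> F).
Hypothesis bw : forall i y, h y -> [lie y, b i] = w i y *: b i.
Hypothesis spb : forall x, lspan b x.

(* If f differs from every weight w i at some y i in h, then the product of the
   operators ad (y i) - w i (y i) kills every b j but not a root vector of f. *)
Lemma root_is_weight f : is_root h f -> exists i, forall y, h y -> f y = w i y.
Proof.
case=> _ _ [x fx x0]; apply: contrapT => nf.
have hy i : exists y, h y /\ f y <> w i y.
  apply: contrapT => ny; apply: nf; exists i => y hy; apply: contrapT => fy.
  by apply: ny; exists y.
have [y yP] := choice hy.
pose T s (z : L) := foldr (fun i z => [lie y i, z] - w i (y i) *: z) z s.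
have T_lin s a u z : T s (a *: u + z) = a *: T s u + T s z.
  by elim: s => //= i s ->; rewrite lie_bracketPr; lmod.
have Tb s j : j \in s -> T s (b j) = 0.
  have Tc s' : exists k, T s' (b j) = k *: b j.
    elim: s' => [|i s' [k ks]]; first by exists 1; rewrite scale1r.
    exists (k * (w j (y i) - w i (y i))); rewrite /= ks lieZr bw; last by case: (yP i).
    by lmod.
  elim: s => //= i s IHs; rewrite inE => /orP[/eqP <-|/IHs ->]; last first.
    by rewrite lie0r scaler0 subrr.
  have [k ->] := Tc s; rewrite lieZr bw; last by case: (yP j).
  by lmod.
have Tx s : exists2 k, k != 0 & T s x = k *: x.
  elim: s => [|i s [k k0 ks]]; first by exists 1; rewrite ?oner_neq0 // scale1r.
  have [hyi fyi] := yP i.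
  exists (k * (f (y i) - w i (y i))); last by rewrite /= ks lieZr fx //; lmod.
  by rewrite mulf_neq0 // subr_eq0; apply/eqP.
have [k k0 kx] := Tx (enum I).
have T0 : T (enum I) 0 = 0.
  have := T_lin (enum I) 1 0 0; rewrite scaler0 addr0 scale1r.
  by move/(congr1 (fun t => t - T (enum I) 0)); rewrite addrK subrr => <-.
have sT : is_subspace (fun z => T (enum I) z = 0).
  by split=> [//|a u z hu hz]; rewrite T_lin hu hz scaler0 addr0.
have tb i : T (enum I) (b i) = 0 by rewrite Tb ?mem_enum.
have := @spb x _ sT tb.
by rewrite kx => /eqP; rewrite scaler_eq0 (negPf k0) => /eqP.
Qed.
End Roots.

Section Ideals.
Variables (F : numFieldType) (g : glaType F) (n mu : nat) (v : 'I_n -> g).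
Hypothesis H : free_prolongation mu v.
Let gv := fp_grade H.

Lemma grade_above_zero k : is_zero (@grade F g k%:Z) ->
  forall p : int, k%:Z <= p -> is_zero (@grade F g p).
Proof.
move=> zk p kp; have [q ->] : exists q, p = (k + q)%N%:Z.
  by exists `|p - k%:Z|%N; lia.
elim: q => [|q IHq] x gx; first by apply: zk; rewrite addn0 in gx.
apply: (trans_v H gx) => i; apply: IHq.
by apply: (grade_lie_eq gx (gv i)); lia.
Qed.

Hypothesis center : forall (p : int) x, - mu%:Z < p < 0 -> grade p x ->
  (forall i, [lie v i, x] = 0) -> x = 0.

(** Induction on the height k above -mu of the degrees occurring in x. Unless the top component
    already lies in degree -mu, some [v_i, x] has a nonzero component one degree lower: by [center]
    in negative degrees, by transitivity in the others. *)
Lemma ideal_bottom (I : g -> Prop) : is_ideal I -> ~ is_zero I ->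
  exists z, [/\ I z, z <> 0 & grade (- mu%:Z) z].
Proof.
move=> [sI lI] /existsNP [x /not_implyP [Ix x0]].
have [k xk] : exists k : nat, forall p, k%:Z - mu%:Z < p -> pr p x = 0.
  have [_ [s [_ s0 _]]] := pr_decomposition x.
  exists (\max_(q <- s) `|q|%N + mu)%N => p hp; apply: s0; apply/negP => ps.
  have : (`|p| <= \max_(q <- s) `|q|)%N by apply: leq_bigmax_seq.
  lia.
elim: k x Ix x0 xk => [|k IHk] x Ix x0 xk.
  have xE : x = pr (- mu%:Z) x.
    apply: pr_eq => p; rewrite (pr_grade _ (grade_pr _ _)).
    case: eqP => [->//|/eqP pmu]; have [pm|pm] := ltP p (- mu%:Z).
      exact: (fp_low H pm (grade_pr _ _)).
    by apply: xk; move: pmu pm; lia.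
  by exists x; split=> //; rewrite xE; apply: grade_pr.
pose p := k.+1%:Z - mu%:Z.
have [px0|px0] := pselect (pr p x = 0).
  apply: (IHk x) => // q qk; have [->//|qp] := eqVneq q p.
  by apply: xk; move: qp; rewrite /p; lia.
have [i vi] : exists i, [lie v i, pr p x] <> 0.
  apply: contrapT => ni.
  have n0 i : [lie v i, pr p x] = 0.
    by apply: contrapT => vi; apply: ni; exists i.
  apply: px0; have [p0|p0] := ltP p 0.
    by apply: (center _ (grade_pr p x) n0); rewrite p0 andbT /p; lia.
  have [q pq] : exists q : nat, p = q by exists `|p|%N; lia.
  have gq := grade_pr p x; rewrite pq in gq n0 *.
  by apply: (trans_v H gq) => i; rewrite lieC n0 oppr0.
apply: (IHk [lie v i, x]) => [||q qk]; first exact: lI.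
  move=> vx; apply: vi; rewrite -(pr_lie p x (gv i)) vx linear0; reflexivity.
have -> : q = -1 + (q + 1) by lia.
by rewrite (pr_lie _ _ (gv i)) xk ?lie0r //; lia.
Qed.
End Ideals.

(** * Two steps: type B *)

Section TwoStep.
Variables (F : numFieldType) (g : glaType F) (n : nat) (v : 'I_n -> g).
Hypothesis H : free_prolongation 2 v.
Let gv := fp_grade H.

Lemma triple_bracket0 i j k : [lie v i, [lie v j, v k]] = 0.
Proof. by apply: (below_zero H _ (gradeL (gv i) (gradeL (gv j) (gv k)))). Qed.

Lemma grade_vv i j : grade (- 2) [lie v i, v j].
Proof. exact: (grade_lie_eq (gv i) (gv j)). Qed.

Lemma two_step_span x : negative_part x ->
  lspan (fun s : 'I_n + 'I_n * 'I_n =>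
    match s with inl i => v i | inr ij => [lie v ij.1, v ij.2] end) x.
Proof.
set b := (b in lspan b).
apply: (neg_lspan H) => [i|[i|[i j]] [k|[k l]]].
- exact: (lspan_in (b := b) (inl i)).
- exact: (lspan_in (b := b) (inr (i, k))).
- rewrite /= triple_bracket0; exact: lspan0.
- rewrite /= lieC triple_bracket0 oppr0; exact: lspan0.
- rewrite (_ : [lie _, _] = 0); first exact: lspan0.
  by apply: (below_zero H _ (gradeL (grade_vv i j) (grade_vv k l))).
Qed.

Lemma degree2_ind (P : g -> Prop) : is_subspace P ->
  (forall i j, P [lie v i, v j]) -> forall x, grade (- 2) x -> P x.
Proof.
move=> sP Pv x gx; rewrite -(pr_id gx).
apply: (@two_step_span x (grade_neg _ gx) (fun x => P (pr (- 2) x))) => //.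
  split=> [|a u w hu hw]; first by rewrite linear0; apply: subspace0.
  by rewrite linearP; case: sP => _; apply.
case=> [i|[i j]] /=; first by rewrite (pr_grade _ (gv i)); apply: subspace0.
by rewrite (pr_id (grade_vv i j)).
Qed.

(** The hypothesis is the Leibniz rule on the zero words [v_i, [v_j, v_l]]. Nothing else can
    obstruct, because the brackets [v_i, v_j] are independent up to antisymmetry. *)
Lemma two_step_extension (k : nat) (A : 'I_n -> g) :
  (forall i, grade (k%:Z - 1) (A i)) ->
  (forall i j l, [lie A i, [lie v j, v l]] +
     [lie v i, [lie A j, v l] + [lie v j, A l]] = 0) ->
  exists2 x, grade k%:Z x & forall i, [lie x, v i] = A i.
Proof.
move=> gA hA.
have [xi [xi_lin xiv xi0]] := coord_exists H.
have [om [om_lin omv om0]] := coord2_exists H.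
pose T i j := [lie A i, v j] + [lie v i, A j].
(* The factor 2^-1 compensates for the double sum meeting each pair i, j in both orders. *)
have [a x y|X XE] := @linearize F g g (fun u => \sum_i xi i u *: A i +
    \sum_i \sum_j (2^-1 * om i j u) *: T i j).
  have -> : \sum_i xi i (a *: x + y) *: A i =
      a *: (\sum_i xi i x *: A i) + \sum_i xi i y *: A i.
    rewrite scaler_sumr -big_split; apply: eq_bigr => i _ /=.
    by rewrite xi_lin; lmod.
  have e i : \sum_j (2^-1 * om i j (a *: x + y)) *: T i j =
      a *: (\sum_j (2^-1 * om i j x) *: T i j) + \sum_j (2^-1 * om i j y) *: T i j.
    rewrite scaler_sumr -big_split; apply: eq_bigr => j _ /=.
    by rewrite om_lin; lmod.
  rewrite (eq_bigr _ (fun i _ => e i)) big_split -scaler_sumr /=; lmod.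
have Xv i : X (v i) = A i.
  rewrite XE [X in _ + X]big1 => [|j _]; last first.
    by apply: big1 => l _; rewrite (om0 _ _ (-1)) ?gv // mulr0 scale0r.
  rewrite addr0 (eq_bigr (fun j => (j == i)%:R *: A j)) ?sum_deltaZ // => j _.
  by rewrite xiv eq_sym.
have TC i j : T j i = - T i j by rewrite /T lieC [[lie v j, _]]lieC; lmod.
have Xvv i j : X [lie v i, v j] = T i j.
  rewrite XE big1 ?add0r => [|l _]; last first.
    by rewrite (xi0 _ (-2) _ _ (grade_vv i j)) ?scale0r.
  have h2 : 2 != 0 :> F by rewrite pnatr_eq0.
  apply: (scalerI h2); rewrite scaler_sumr.
  transitivity (\sum_k0 ((k0 == i)%:R *: T k0 j - (k0 == j)%:R *: T k0 i)).
    apply: eq_bigr => p _; rewrite scaler_sumr.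
    transitivity (\sum_q ((q == j)%:R *: ((p == i)%:R *: T p q)
       - (q == i)%:R *: ((p == j)%:R *: T p q))).
      apply: eq_bigr => q _; rewrite omv !scalerA mulrA mulfV // mul1r.
      by rewrite ![_ == p]eq_sym ![_ == q]eq_sym; lmod.
    by rewrite sumrB !sum_deltaZ.
  by rewrite sumrB !sum_deltaZ (TC i j); lmod.
have [p u p0 gu|i u nu|x gx xE] := extend_derivation H (k := k) (X := X).
- have [p1|p1] := eqVneq p (-1).
    rewrite p1 in gu *; move: u gu.
    apply: (V_ind H xi_lin xiv (P := fun u => grade (-1 + k%:Z) (X u))).
      by split=> [|a u w hu hw]; rewrite ?linear0 ?linearP; [apply: grade0|apply: gradeD => //; apply: gradeZ].
    by move=> i; rewrite Xv addrC.
  have [p2|p2] := eqVneq p (-2).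
    rewrite p2 in gu *; move: u gu.
    apply: (degree2_ind (P := fun u => grade (-2 + k%:Z) (X u))).
      by split=> [|a u w hu hw]; rewrite ?linear0 ?linearP; [apply: grade0|apply: gradeD => //; apply: gradeZ].
    move=> i j; rewrite Xvv; apply: gradeD.
      by apply: (grade_lie_eq (gA i) (gv j)); lia.
    by apply: (grade_lie_eq (gv i) (gA j)); lia.
  rewrite (fp_low H _ gu) ?linear0; first exact: grade0.
  by move: p0 p1 p2; lia.
- apply: (two_step_span nu (P := fun u => X [lie v i, u] = [lie X (v i), u] + [lie v i, X u])).
    split=> [|a x y hx hy]; first by rewrite lie0r !linear0 !lie0r addr0.
    by rewrite lie_bracketPr !linearP /= hx hy !lieE; lmod.
  move=> [j|[j l]] /=; first by rewrite Xvv !Xv.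
  by rewrite triple_bracket0 linear0 Xv Xvv hA.
- by exists x => // i; rewrite xE ?Xv //; apply: v_neg H _.
Qed.

(** In degree 0 the Leibniz condition lies in degree -3, where g vanishes; so g_0 is all of
    gl(V). *)
Lemma two_step_gl (A : 'I_n -> g) : (forall i, grade (- 1) (A i)) ->
  exists2 x, grade 0 x & forall i, [lie x, v i] = A i.
Proof.
move=> gA; apply: (@two_step_extension 0) => // i j l.
have gAvv : grade (- 3) [lie A i, [lie v j, v l]].
  by apply: (grade_lie_eq (gA i) (grade_vv j l)).
have gvAv : grade (- 3) [lie v i, [lie A j, v l] + [lie v j, A l]].
  apply: (grade_lie_eq (gv i) (q := -2)) => //; apply: gradeD.
    exact: (grade_lie_eq (gA j) (gv l)).
  exact: (grade_lie_eq (gv j) (gA l)).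
by rewrite (below_zero H _ gAvv) // (below_zero H _ gvAv) // addr0.
Qed.

End TwoStep.

Section Fundamental.
Variables (F : numFieldType) (g : glaType F) (n mu : nat) (v : 'I_n -> g).
Hypothesis H : free_prolongation mu v.

Lemma v_neq0 i : v i <> 0.
Proof.
move=> vi0; have := fp_free H (c := fun j => (j == i)%:R).
rewrite sum_deltaZ => /(_ vi0 i)/eqP; by rewrite eqxx oner_eq0.
Qed.

Lemma prolongation_fundamental (I : finType) (b : I -> g) :
  (forall x, lspan b x) -> negative_part_fundamental g.
Proof.
move=> spb; split=> [|z|x].
(* Projection onto degrees -mu to -1; it is the identity on the negative part, so it carries a
   spanning family of g to one of the negative part. *)
- pose f x : g := \sum_(k < mu) pr (- k.+1%:Z) x.
  have f_lin a x y : f (a *: x + y) = a *: f x + f y.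
    rewrite /f (eq_bigr (fun k : 'I_mu => a *: pr (- k.+1%:Z) x + pr (- k.+1%:Z) y)).
      by rewrite big_split -scaler_sumr.
    by move=> k _; exact: linearP.
  have [phi phiE] := linearize f_lin.
  apply: (finite_dim_span_fin (b := f \o b)) => [i|x [s [c [hc ->]]]].
    apply: (subspace_sum (neg_subspace g)) => k _.
    by apply: grade_neg (grade_pr _ _); lia.
  have [d dE] := lspan_fin (spb (\sum_(p <- s) c p)); exists d.
  transitivity (phi (\sum_(p <- s) c p)); last first.
    by rewrite dE linear_sum; apply: eq_bigr => i _; rewrite linearZ /= phiE.
  rewrite linear_sum big_seq [RHS]big_seq; apply: eq_bigr => p /hc [p0 gp].
  rewrite phiE /f; have [pmu|pmu] := ltP p (- mu%:Z).
    by rewrite (fp_low H pmu gp) big1 // => k _; rewrite linear0.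
  have [k kp] : exists k : 'I_mu, p = - k.+1%:Z.
    have lk : (`|p|.-1 < mu)%N by lia.
    by exists (Ordinal lk) => /=; lia.
  rewrite (bigD1 k) //= -kp (pr_id gp) big1 ?addr0 // => l lk.
  rewrite (pr_grade _ gp); case: eqP => // e; case/eqP: lk; apply/val_inj => /=.
  by move: e; rewrite kp; lia.
- pose i0 := Ordinal (ltnW (rank_gt1 H)).
  exact: v_neq0 (z _ (fp_grade H i0)).
- split=> [nx S sS Sv|]; first by apply: (fp_gen H) => // i; apply: Sv; apply: fp_grade H i.
  apply; last by move=> y; apply: grade_neg.
  by split; [apply: neg_subspace|apply: neg_lie].
Qed.
End Fundamental.

Section TypeB.
Variables (F : numFieldType) (g : glaType F) (n : nat) (v : 'I_n -> g).
Hypothesis H : free_prolongation 2 v.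
Hypothesis n3 : (2 < n)%N.
Let gv := fp_grade H.
Let big : (2 < 2)%N \/ (2 < n)%N := or_intror n3.
Variable xi : 'I_n -> g -> F.
Hypothesis xi_lin : forall i a x y, xi i (a *: x + y) = a * xi i x + xi i y.
Hypothesis xiv : forall i j, xi i (v j) = (j == i)%:R.
Local Notation Gam := (Gam 2 v).

(** For mu = 2 the matrix A_i is v_j -> 2 b_j v_i, and in the Leibniz condition the terms cancel in
    pairs. *)
Lemma two_step_degree1 (b : 'I_n -> F) : exists2 X, grade 1 X & Gam X b.
Proof.
have hA i : exists A, grade 0 A /\ forall j,
    [lie A, v j] = ((2 - 2%:R) * b i) *: v j + (2%:R * b j) *: v i.
  have [j|A gA AE] := two_step_gl H (A := fun j =>
    ((2 - 2%:R) * b i) *: v j + (2%:R * b j) *: v i); last by exists A.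
  by apply: gradeD; apply: gradeZ.
have [A AP] := choice hA.
have [i|i j l|X gX XE] := @two_step_extension F g n v H 1 A.
- by case: (AP i).
- have E k m : [lie A k, v m] = (2%:R * b m) *: v k.
    by have [_ ->] := AP k; lmod.
  rewrite lieJr [[lie v j, A l]]lieC !E !lieE [[lie v j, v i]]lieC.
  by lmod.
- by exists X => // i j; rewrite XE; case: (AP i) => _ ->.
Qed.

(** X applied to the zero word [v_k, [v_a, v_b]] gives [rel]; for independent v_a and v_b it kills
    the symmetric part of B. *)
Lemma two_step_degree2_anti X (B : 'I_n -> 'I_n -> F) : grade 2 X ->
  (forall k, Gam [lie X, v k] (B k)) -> forall k l, B k l = - B l k.
Proof.
move=> gX hB.
have rel k a b : (B k b + B b k) *: v a = (B k a + B a k) *: v b.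
  have h2 : 2 != 0 :> F by rewrite pnatr_eq0.
  apply: (scalerI h2); apply/eqP; rewrite -subr_eq0; apply/eqP.
  transitivity [lie X, [lie v k, [lie v a, v b]]]; last first.
    by rewrite (triple_bracket0 H) lie0r.
  rewrite lieJr (g1_w a b (hB k)) (lieJr X (v a)).
  rewrite [[lie v a, [lie X, v b]]]lieC lieDr lieNr.
  by rewrite ![[lie v k, _]]lieC (hB a) (hB b); lmod.
move=> k l; have [a al] := ord_other l (ltnW n3).
have [|h _] := basis_indep H al (a := B k l + B l k) (b := - (B k a + B a k)).
  by rewrite rel; lmod.
by apply/eqP; rewrite -addr_eq0 h.
Qed.

Variable c : 'I_n -> g.
Hypothesis gc : forall k, grade 1 (c k).
Hypothesis cGam : forall k, Gam (c k) (fun i => (i == k)%:R).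

Lemma grade_cc i j : grade 2 [lie c i, c j].
Proof. exact: (grade_lie_eq (gc i) (gc j)). Qed.

Lemma two_step_degree2_span X : grade 2 X ->
  lspan (fun ij : 'I_n * 'I_n => [lie c ij.1, c ij.2]) X.
Proof.
move=> gX; have gXv k : grade 1 [lie X, v k] by apply: (grade_lie_eq gX (gv k)).
have [B hB] := choice (fun k => Gam_exists H big (gXv k)).
have Banti := two_step_degree2_anti gX hB.
(* 4 is the constant 2 mu - 2 = 2 of [Gam_cc] times 2, since each unordered pair is met twice. *)
have -> : X = \sum_(ij : 'I_n * 'I_n) (4^-1 * B ij.1 ij.2) *: [lie c ij.1, c ij.2].
  apply: (trans_v_eq H gX) => [|k].
    by apply: grade_sum => ij _; apply: gradeZ; apply: grade_cc.
  apply: (Gam_uniq H (gXv k) _ (hB k)).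
    apply: (@grade_lie_eq _ _ 2 (-1) 1) => //.
    by apply: grade_sum => ij _; apply: gradeZ; apply: grade_cc.
  rewrite lie_suml -(pair_bigA _ (fun i j => [lie (4^-1 * B i j) *: [lie c i, c j], v k])) /=.
  have h i j : Gam [lie (4^-1 * B i j) *: [lie c i, c j], v k] (fun a => (4^-1 * B i j) *
      ((2 * 2%:R - 2) * ((k == i)%:R * (a == j)%:R - (k == j)%:R * (a == i)%:R))).
    by rewrite lieZl; apply: GamZ; apply: (Gam_cc H xi_lin xiv gc cGam).
  apply: Gam_eq (Gam_sum _ (fun i => Gam_sum _ (fun j => h i j))) => a /=.
  have h4 : 4 != 0 :> F by rewrite pnatr_eq0.
  transitivity (\sum_i ((i == k)%:R * (2^-1 * B i a) - (i == a)%:R * (2^-1 * B i k))).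
    apply: eq_bigr => i _.
    transitivity (\sum_j ((j == a)%:R * ((i == k)%:R * (2^-1 * B i j))
        - (j == k)%:R * ((i == a)%:R * (2^-1 * B i j)))).
      apply: eq_bigr => j _; rewrite ![k == _]eq_sym ![a == _]eq_sym; by field.
    by rewrite sumrB !sum_delta.
  by rewrite sumrB !sum_delta (Banti a k); field.
exact: (lspan_sum (fun ij => 4^-1 * B ij.1 ij.2)).
Qed.

(** Bracketing the zero word [v_z, [v_x, v_y]] with X and then v_u gives [rel]. For y different from
    z and x its v_y-coefficient is T z x u alone, so T vanishes for z <> x; antisymmetry in the last
    two indices handles z = x. *)
Lemma two_step_degree3 : is_zero (@grade F g 3).
Proof.
move=> X gX; have gXv k : grade 2 [lie X, v k] by apply: (grade_lie_eq gX (gv k)).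
have gXvv k l : grade 1 [lie [lie X, v k], v l] by apply: (grade_lie_eq (gXv k) (gv l)).
have [T0 hT0] := choice (fun kl : 'I_n * 'I_n => Gam_exists H big (gXvv kl.1 kl.2)).
pose T k l := T0 (k, l).
have hT k l : Gam [lie [lie X, v k], v l] (T k l) by apply: (hT0 (k, l)).
have Tanti k := two_step_degree2_anti (gXv k) (hT k).
have rel z x y u : (T z x u) *: v y - T z y u *: v x - (T x y u - T y x u) *: v z = 0.
  have h2 : 2 != 0 :> F by rewrite pnatr_eq0.
  apply: (scalerI h2); rewrite scaler0.
  transitivity [lie [lie X, [lie v z, [lie v x, v y]]], v u]; last first.
    by rewrite (triple_bracket0 H) lie0r lie0l.
  rewrite (lieJr X (v z)) (lieJr [lie X, v z] (v x)) (lieJr X (v x)).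
  rewrite [[lie v x, [lie [lie X, v z], v y]]]lieC [[lie v x, [lie X, v y]]]lieC.
  rewrite !lieE ![[lie v z, [lie _, _]]]lieC !lieE.
  by rewrite (hT z x) (hT z y) (hT x y) (hT y x); lmod.
have T_off z x u : z != x -> T z x u = 0.
  move=> zx; have [y /andP[yz yx]] := ord_other2 z x n3.
  have /(congr1 (xi y)) := rel z x y u.
  rewrite !(dualE xi_lin xiv) eqxx ![_ == y]eq_sym (negPf yz) (negPf yx).
  by rewrite !mulr0 mulr1 !subr0.
have T_all z x u : T z x u = 0.
  have [<-|] := eqVneq z x; last exact: T_off.
  have [<-|zu] := eqVneq z u; last by rewrite Tanti T_off // oppr0.
  apply/eqP; have /eqP := Tanti z z z; rewrite -addr_eq0 -mulr2n -mulr_natl.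
  by rewrite mulf_eq0 pnatr_eq0.
apply: (trans_v H gX) => k; apply: (trans_v H (gXv k)) => l.
apply: (Gam_uniq H (gXvv k l) _ (hT k l)); first exact: grade0.
by apply: Gam_eq (Gam0 _ _) => i; rewrite T_all.
Qed.

End TypeB.

Section IdealFull.
Variables (F : numFieldType) (g : glaType F) (n mu : nat) (v : 'I_n -> g).
Hypothesis H : free_prolongation mu v.
Let gv := fp_grade H.
Variable xi : 'I_n -> g -> F.
Hypothesis xi_lin : forall i a x y, xi i (a *: x + y) = a * xi i x + xi i y.
Hypothesis xiv : forall i j, xi i (v j) = (j == i)%:R.
Variable E : 'I_n -> 'I_n -> g.
Hypothesis gE : forall i j, grade 0 (E i j).
Hypothesis Ev : forall i j k, [lie E i j, v k] = (k == j)%:R *: v i.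
Variable c : 'I_n -> g.
Hypothesis gc : forall k, grade 1 (c k).
Hypothesis cGam : forall k, Gam mu v (c k) (fun i => (i == k)%:R).
Hypothesis trace_neq0 : (2 - mu%:R) * n%:R + mu%:R != 0 :> F.

(** The matrices E_jl move y to every v_j, so I contains V. The sum of the [c_i, v_i] acts on V by
    the scalar (2 - mu) n + mu, which is not 0: the grading element lies in I, and with it every
    nonzero degree. In degree 0, E_ij is recovered from [c_j, v_i] and the grading element. *)
Lemma ideal_full (I : g -> Prop) y : is_ideal I -> I y -> y <> 0 ->
  grade (- 1) y -> forall x, I x.
Proof.
move=> [sI lI] Iy y0 gy.
have lI' x z : I x -> I [lie x, z] by move=> Ix; rewrite lieC; apply: subspaceN => //; apply: lI.
have IV j : I (v j).
  have [l yl] : exists l, xi l y != 0.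
    apply: contrapT => nl; apply: y0; apply: (V_eq0 H xi_lin xiv gy) => l.
    by apply: contrapT => /eqP h; apply: nl; exists l.
  have : [lie E j l, y] = xi l y *: v j.
    move: gy; move: (y); apply: (V_ind H xi_lin xiv
      (P := fun y => [lie E j l, y] = xi l y *: v j)) => [|i]; last by rewrite Ev xiv.
    split=> [|a x w hx hw]; first by rewrite lie0r (dual0 xi_lin) scale0r.
    by rewrite lie_bracketPr hx hw xi_lin; lmod.
  by move=> e; rewrite -[v j](scalerK yl) -e; apply: (subspaceZ sI); apply: lI.
have IE : I (grading_elt E).
  have -> : grading_elt E = - ((2 - mu%:R) * n%:R + mu%:R)^-1 *: \sum_i [lie c i, v i].
    have gS : grade 0 (\sum_i [lie c i, v i]).
      by apply: grade_sum => i _; apply: (grade_lie_eq (gc i) (gv i)).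
    apply: (trans_v_eq H (grading_elt_grade gE) (gradeZ _ gS)) => k.
    rewrite lieNl (scalar_elt_v Ev) lieZl lie_suml.
    rewrite (eq_bigr (fun i => (2 - mu%:R) *: v k + mu%:R *: ((i == k)%:R *: v i))).
      rewrite big_split /= -!scaler_sumr sum_deltaZ sumr_const card_ord.
      transitivity ((- (((2 - mu%:R) * n%:R + mu%:R)^-1 *
        ((2 - mu%:R) * n%:R + mu%:R))) *: v k); last by lmod.
      by rewrite mulVf // scaleN1r.
    by move=> i _; rewrite cGam eqxx [k == i]eq_sym /=; lmod.
  by apply: (subspaceZ sI); apply: (subspace_sum sI) => i _; apply: lI.
have hmu : mu%:R != 0 :> F by rewrite pnatr_eq0; have := fp_mu H; lia.
apply: grade_ind => // p x gx; have [p0|p0] := eqVneq p 0.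
  rewrite p0 in gx; rewrite (gl_coord H xi_lin xiv gE Ev gx).
  apply: (subspace_sum sI) => j _; apply: (subspace_sum sI) => i _.
  apply: (subspaceZ sI).
  have -> : E i j = mu%:R^-1 *:
      ([lie c j, v i] + ((2 - mu%:R) * (i == j)%:R) *: grading_elt E).
    apply: (trans_v_eq H (gE i j)) => [|k].
      apply: gradeZ; apply: gradeD; last by apply: gradeZ; apply: grading_elt_grade.
      exact: (grade_lie_eq (gc j) (gv i)).
    apply: (scalerI hmu); rewrite lieZl scalerA mulfV // scale1r.
    by rewrite lieDl lieZl lieNl (scalar_elt_v Ev) cGam Ev; lmod.
  apply: (subspaceZ sI); apply: (subspaceD sI); first exact: lI.
  exact: (subspaceZ sI).
have px : p%:~R != 0 :> F by rewrite intr_eq0.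
have := lI' _ x IE; rewrite (grading_eltP H xi_lin xiv gE Ev gx) => h.
by rewrite -[x](scalerK px); apply: (subspaceZ sI).
Qed.

End IdealFull.

(** * Simplicity and the root system of type B *)

Section TypeBRoots.
Variables (F : numFieldType) (g : glaType F) (n : nat) (v : 'I_n -> g).
Hypothesis H : free_prolongation 2 v.
Hypothesis n3 : (2 < n)%N.
Let gv := fp_grade H.
Let big : (2 < 2)%N \/ (2 < n)%N := or_intror n3.
Variable xi : 'I_n -> g -> F.
Hypothesis xi_lin : forall i a x y, xi i (a *: x + y) = a * xi i x + xi i y.
Hypothesis xiv : forall i j, xi i (v j) = (j == i)%:R.
Variable E : 'I_n -> 'I_n -> g.
Hypothesis gE : forall i j, grade 0 (E i j).
Hypothesis Ev : forall i j k, [lie E i j, v k] = (k == j)%:R *: v i.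
Variable c : 'I_n -> g.
Hypothesis gc : forall k, grade 1 (c k).
Hypothesis cGam : forall k, Gam 2 v (c k) (fun i => (i == k)%:R).
Local Notation Gam := (Gam 2 v).
Local Notation torus := (torus v).
Local Notation eps := (eps v xi).

(** A spanning family with repetitions, not a basis: k selects the degree among -1, -2, 0, 1, 2, and
    j is ignored in degrees -1 and 1. *)
Definition typeB_basis (s : 'I_5 * ('I_n * 'I_n)) : g :=
  let: (k, (i, j)) := s in
  nth 0 [:: v i; [lie v i, v j]; E i j; c i; [lie c i, c j]] k.
Definition typeB_weight (s : 'I_5 * ('I_n * 'I_n)) (y : g) : F :=
  let: (k, (i, j)) := s in
  nth 0 [:: eps i y; eps i y + eps j y; eps i y - eps j y; - eps i y;
    - eps i y - eps j y] k.

Lemma typeB_weightP s y : torus y ->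
  [lie y, typeB_basis s] = typeB_weight s y *: typeB_basis s.
Proof.
move=> ty; have hv i := torus_eps xi_lin xiv i ty.
have hc i := torus_c_weight H xi_lin xiv gc cGam i ty.
case: s => [[[|[|[|[|[|k]]]]] hk] [i j]] //=.
- exact: weight_lie.
- exact: (torus_E_weight H xi_lin xiv gE Ev i j ty).
- exact: weight_lie.
Qed.

Let wt (k : 'I_5) i j := lspan_in (b := typeB_basis) (k, (i, j)).

Lemma typeB_span x : lspan typeB_basis x.
Proof.
move: x; apply: grade_ind => [|p x gx]; first exact: lspan_subspace.
have [p0|p0] := ltP p 0.
  apply: lspan_trans (two_step_span H (grade_neg p0 gx)) => -[i|[i j]].
    exact: (wt (@Ordinal 5 0 isT) i i).
  exact: (wt (@Ordinal 5 1 isT) i j).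
have [p3|p3] := lerP 3 p.
  rewrite (grade_above_zero H (two_step_degree3 H n3 xi_lin xiv) p3 gx).
  exact: lspan0.
have : [\/ p = 0, p = 1 | p = 2].
  have [->|p0'] := eqVneq p 0; first by constructor 1.
  have [->|p1] := eqVneq p 1; first by constructor 2.
  by constructor 3; lia.
case=> e; rewrite e in gx.
- rewrite (gl_coord H xi_lin xiv gE Ev gx).
  do 2![apply: (subspace_sum (lspan_subspace _)) => ? _].
  by apply: (subspaceZ (lspan_subspace _)); apply: (wt (@Ordinal 5 2 isT)).
- have [b hb] := Gam_exists H big gx.
  rewrite (g1_coord H gc cGam gx hb).
  apply: (subspace_sum (lspan_subspace _)) => i _.
  by apply: (subspaceZ (lspan_subspace _)); apply: (wt (@Ordinal 5 3 isT) i i).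
- apply: lspan_trans (two_step_degree2_span H n3 xi_lin xiv gc cGam gx) => -[i j].
  exact: (wt (@Ordinal 5 4 isT) i j).
Qed.

Lemma typeB_simple : simple_lie g.
Proof.
pose i0 := Ordinal (ltnW (ltnW n3)).
split.
  by exists (E i0 i0), (v i0); rewrite Ev eqxx scale1r; apply: v_neq0 H _.
(* The coordinates of x in V can be read off from its brackets with V; this supplies [center] for
   [ideal_bottom]. *)
have cvx k i x : k != i -> grade (- 1) x -> [lie c k, [lie v i, x]] = (2 * xi k x) *: v i.
  move=> ki; move: x; apply: (V_ind H xi_lin xiv
    (P := fun x => [lie c k, [lie v i, x]] = (2 * xi k x) *: v i)) => [|j].
    split=> [|a x y hx hy]; first by rewrite !lie0r (dual0 xi_lin); lmod.
    by rewrite !lie_bracketPr hx hy xi_lin; lmod.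
  by rewrite (g1_w _ _ (cGam k)) xiv [i == k]eq_sym (negPf ki) mulr0 scale0r subr0; congr (_ *: _); ring.
have h2 : 2 != 0 :> F by rewrite pnatr_eq0.
move=> I idI; have [|nz] := pselect (is_zero I); [by left|right].
have [sI lI] := idI.
have [p x pmu gx vx|z [Iz z0 gz]] := ideal_bottom H _ idI nz.
  have p1 : p = -1 by move: pmu; lia.
  rewrite p1 in gx; apply: (V_eq0 H xi_lin xiv gx) => k.
  have [i ik] := ord_other k (ltnW n3); have ki : k != i by rewrite eq_sym.
  have := cvx k i x ki gx; rewrite vx lie0r => /esym/eqP.
  rewrite scaler_eq0 mulf_eq0 (negPf h2) /= => /orP[/eqP//|/eqP].
  by move/(v_neq0 H).
have [y [Iy y0 gy]] : exists y, [/\ I y, y <> 0 & grade (- 1) y].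
  have [k ck] : exists k, [lie c k, z] <> 0.
    apply: contrapT => nk.
    have {nk}cz k : [lie c k, z] = 0 by apply: contrapT => h; apply: nk; exists k.
    (* On [v_i, v_j] exactly k = i and k = j contribute, each twice the bracket. So z is recovered
       from the [c_k, z], and these cannot all vanish. *)
    have e : 4 *: z = \sum_k [lie [lie c k, z], v k].
      move: gz; rewrite -/(- 2); move: (z); apply: (degree2_ind H
        (P := fun z => 4 *: z = \sum_k [lie [lie c k, z], v k])).
        split=> [|a x y hx hy].
          by rewrite scaler0 big1 // => k _; rewrite lie0r lie0l.
        rewrite scalerDr !scalerA mulrC -scalerA hx hy scaler_sumr -big_split /=.
        by apply: eq_bigr => k _; rewrite lie_bracketPr lie_bracketPl.
      move=> i j; transitivity (\sum_k ((k == j)%:R *: (2 *: [lie v i, v k])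
          - (k == i)%:R *: (2 *: [lie v j, v k]))).
        by rewrite sumrB !sum_deltaZ [[lie v j, _]]lieC; lmod.
      apply: eq_bigr => k _; rewrite (g1_w _ _ (cGam k)) !lieE.
      by rewrite ![k == _]eq_sym; lmod.
    apply: z0; apply: (@scalerI _ _ 4); first by rewrite pnatr_eq0.
    by rewrite e scaler0 big1 // => k _; rewrite cz lie0l.
  exists [lie c k, z]; split=> //; first exact: lI.
  exact: (grade_lie_eq (gc k) gz).
apply: (ideal_full H xi_lin xiv gE Ev gc cGam _ idI Iy y0 gy).
by rewrite subrr mul0r add0r.
Qed.

(** Indexed by natural numbers, with value 0 from n on: the last simple root -eps_(n-1) then has the
    same formula as the others. *)
Definition eps_nat (k : nat) (y : g) : F := \sum_(j < n | j == k :> nat) eps j y.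
(** The signs are opposite to the usual ones because the grading element takes the value -1 on every
    eps_i, and simple roots must be nonnegative on it. *)
Definition typeB_root (i : 'I_n) (y : g) : F := eps_nat i.+1 y - eps_nat i y.

Lemma eps_nat_ord (i : 'I_n) y : eps_nat i y = eps i y.
Proof. by rewrite /eps_nat (big_pred1 i) // => j; rewrite val_eqE. Qed.
Lemma eps_nat_lt k y (kn : (k < n)%N) : eps_nat k y = eps (Ordinal kn) y.
Proof. by rewrite -eps_nat_ord. Qed.
Lemma eps_nat_ge k y : (n <= k)%N -> eps_nat k y = 0.
Proof. by move=> nk; apply: big_pred0 => j; have := ltn_ord j; lia. Qed.

Lemma eps_nat_lin k a x y : eps_nat k (a *: x + y) = a * eps_nat k x + eps_nat k y.
Proof.
rewrite mulr_sumr -big_split; apply: eq_bigr => j _; exact: eps_lin.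
Qed.

Lemma typeB_root_lin i a x y :
  typeB_root i (a *: x + y) = a * typeB_root i x + typeB_root i y.
Proof. rewrite /typeB_root !eps_nat_lin; ring. Qed.

Lemma typeB_tail (i : 'I_n) y :
  \sum_(t < n) ((i <= t)%N)%:R * typeB_root t y = - eps i y.
Proof.
(* Frozen up to i, G has the increments selected by the condition i <= t. *)
pose G t := if (t <= i)%N then eps_nat i y else eps_nat t y.
have tel := telescope_sumr G (leq0n n).
transitivity (\sum_(0 <= t < n) (G t.+1 - G t)); last first.
  rewrite tel /G leq0n eps_nat_ord; case: leqP => [|_]; first by have := ltn_ord i; lia.
  by rewrite eps_nat_ge // sub0r.
rewrite big_mkord; apply: eq_bigr => t _; rewrite /G /typeB_root.
case: (ltngtP i t) => it.
- by rewrite mul1r.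
- by rewrite mul0r subrr.
- by rewrite mul1r it.
Qed.

Lemma typeB_dual (l : 'I_n) : exists2 y, torus y &
  forall k : 'I_n, typeB_root k y = (k == l)%:R.
Proof.
(* Values -1 up to l and 0 beyond: the only jump is at l. *)
have [y ty yE] := torus_exists xi_lin xiv gE Ev (fun k : 'I_n => - ((k <= l)%N)%:R).
exists y => // k; rewrite /typeB_root eps_nat_ord yE.
have lk := ltn_ord k; have ll := ltn_ord l.
have -> : eps_nat k.+1 y = - ((k.+1 <= l)%N)%:R.
  have [kn|kn] := ltnP k.+1 n; first by rewrite (eps_nat_lt _ kn) yE.
  rewrite eps_nat_ge // (_ : (k < l)%N = false) ?oppr0 //; lia.
by rewrite -val_eqE /=; case: ltngtP => _ /=; ring.
Qed.

(** Root vectors for a simple root and its negative: -c_i and v_i for the last root, E_(i+1,i) and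
    E_(i,i+1) for the others. The sign in -c_i makes the root take the value 2 on their bracket. *)
Lemma typeB_root_exists (i : 'I_n) : exists x x' z : g,
  [/\ root_space torus (typeB_root i) x, x <> 0,
      root_space torus (fun y => - typeB_root i y) x',
      z = [lie x, x'] & torus z /\ forall k, eps k z =
        if (i.+1 == n)%N then - 2 * (k == i)%:R
        else (k == i.+1 :> nat)%:R - (k == i)%:R].
Proof.
have [iN|iN] := eqVneq i.+1 n.
  have hr y : typeB_root i y = - eps i y.
    by rewrite /typeB_root eps_nat_ge ?iN // eps_nat_ord sub0r.
  have wz k : [lie [lie - c i, v i], v k] = (- 2 * (k == i)%:R) *: v k.
    rewrite !lieNl cGam eqxx; case: eqP => [->|_]; rewrite ?mulr1 ?mulr0; lmod.
  exists (- c i), (v i), [lie - c i, v i]; split=> //.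
  - by move=> y ty; rewrite hr lieNr (torus_c_weight H xi_lin xiv gc cGam i ty) scalerN.
  - move=> /eqP; rewrite oppr_eq0 => /eqP c0; have := cGam i; rewrite c0 => h.
    have := Gam_inj xi_lin xiv h (Gam0 2 v) i; rewrite /= eqxx => /eqP.
    by rewrite oner_eq0.
  - by move=> y ty; rewrite hr opprK; apply: torus_eps.
  - split=> [|k]; last by rewrite /eps wz !(dualE xi_lin xiv) eqxx mulr1.
    split; last by exists (fun k => - 2 * (k == i)%:R).
    by apply: (grade_lie_eq (gradeN (gc i)) (gv i)).
have iN' : (i.+1 < n)%N by have := ltn_ord i; lia.
pose j := Ordinal iN'; have ij : (i == j) = false by rewrite -val_eqE /=; lia.
have hr y : typeB_root i y = eps j y - eps i y.
  by rewrite /typeB_root eps_nat_ord (eps_nat_lt _ iN').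
have wE k l y : torus y -> [lie y, E k l] = (eps k y - eps l y) *: E k l.
  by move=> ty; exact: (torus_E_weight H xi_lin xiv gE Ev k l ty).
have wz k : [lie [lie E j i, E i j], v k] = ((k == j)%:R - (k == i)%:R) *: v k.
  rewrite lieJl !(Ev, lieE) !eqxx.
  by case: (k =P j) => [->|_]; [rewrite (eq_sym j) ij|case: (k =P i) => [->|_]] => /=; lmod.
exists (E j i), (E i j), [lie E j i, E i j]; split=> //.
- by move=> y ty; rewrite hr; apply: wE.
- move=> E0; have := Ev j i i; rewrite E0 lie0l eqxx scale1r => /esym.
  exact: v_neq0 H _.
- by move=> y ty; rewrite hr opprB; apply: wE.
- split=> [|k]; last by rewrite /eps wz !(dualE xi_lin xiv) eqxx mulr1 -val_eqE.
  split; last by exists (fun k => (k == j)%:R - (k == i)%:R).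
  exact: (grade_lie_eq (gE j i) (gE i j)).
Qed.

Lemma typeB_simple_system : is_simple_root_system torus typeB_root.
Proof.
split=> [i|d hd l|f rf].
- split=> [a x y _ _||]; first exact: typeB_root_lin.
    have [y ty yE] := typeB_dual i; exists y => //; rewrite yE eqxx.
    by apply/eqP; apply: oner_neq0.
  by have [x [_ [_ [rx x0 _ _ _]]]] := typeB_root_exists i; exists x.
- have [y ty yE] := typeB_dual l; have := hd y ty.
  rewrite (eq_bigr (fun k => (k == l)%:R * d k)) ?sum_delta // => k _.
  by rewrite yE mulrC.
have [s sE] := root_is_weight typeB_weightP typeB_span rf.
have [_ [y0 ty0 fy0] _] := rf.
(* By telescoping, -eps_i is the sum of the simple roots with index at least i, so [K i] is its
   coefficient vector; all weights are signed sums or differences of these. *)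
pose K (i t : 'I_n) : nat := (i <= t)%N.
have tail i y : \sum_t (K i t)%:R * typeB_root t y = - eps i y by apply: typeB_tail.
have tail2 i j y : \sum_t (K i t + K j t)%N%:R * typeB_root t y = - (eps i y + eps j y).
  rewrite (eq_bigr (fun t => (K i t)%:R * typeB_root t y + (K j t)%:R * typeB_root t y)).
    by rewrite big_split /= !tail opprD.
  by move=> t _; rewrite natrD mulrDl.
have tailB (i j : 'I_n) y : (i <= j)%N ->
    \sum_t (K i t - K j t)%N%:R * typeB_root t y = eps j y - eps i y.
  move=> ij; rewrite (eq_bigr (fun t => (K i t)%:R * typeB_root t y - (K j t)%:R * typeB_root t y)).
    by rewrite sumrB /= !tail opprK addrC.
  by move=> t _; rewrite natrB ?mulrBl // /K; case: (leqP j t) => // jt; rewrite (leq_trans ij jt).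
case: s sE => [[[|[|[|[|[|k]]]]] hk] [i j]] //= sE.
- by exists (K i); right=> y ty; rewrite tail opprK; apply: sE.
- by exists (fun t => K i t + K j t)%N; right=> y ty; rewrite tail2 opprK; apply: sE.
- have [ij|ij] := leqP i j.
    exists (fun t => K i t - K j t)%N; right=> y ty.
    by rewrite tailB // opprB; apply: sE.
  exists (fun t => K j t - K i t)%N; left=> y ty.
  by rewrite tailB ?(ltnW ij) //; apply: sE.
- by exists (K i); left=> y ty; rewrite tail; apply: sE.
- by exists (fun t => K i t + K j t)%N; left=> y ty; rewrite tail2 opprD; apply: sE.
Qed.

Lemma typeB_cartan : has_cartan_matrix torus typeB_root (cartanB n).
Proof.
have [x xP] := choice typeB_root_exists; have [x' x'P] := choice xP.
have [z zP] := choice x'P.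
have ev i j : typeB_root i (z j) = (cartanB n i j)%:~R.
  have [_ _ _ _ [tz zE]] := zP j.
  have li := ltn_ord i; have lj := ltn_ord j.
  rewrite /typeB_root eps_nat_ord zE mxE.
  have -> : eps_nat i.+1 (z j) = if (i.+1 == n)%N then 0 else
      if (j.+1 == n)%N then - 2 * (i.+1 == j)%:R
      else (i.+1 == j.+1)%:R - (i.+1 == j)%:R.
    case: ifP => iN; first by rewrite eps_nat_ge //; lia.
    have iN' : (i.+1 < n)%N by lia.
    by rewrite (eps_nat_lt _ iN') zE -!val_eqE.
  rewrite -!val_eqE /= eqSS.
  case: (ltngtP (i : nat) j) => ij.
  - have -> : (i == j.+1 :> nat) = false by lia.
    rewrite [j == i.+1 :> nat]eq_sym; have [e|e] := eqVneq i.+1 (j : nat).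
      have -> : (i.+1 == n) = false by lia.
      by case: ifP => _; rewrite /= ?intrN; ring.
    by do ?case: ifP => _; rewrite /=; ring.
  - have -> : (j == i.+1 :> nat) = false by lia.
    have -> : (i.+1 == j :> nat) = false by lia.
    have -> : (j.+1 == n) = false by lia.
    by case: ((i : nat) =P j.+1) => e; case: ifP => _; rewrite /= ?intrN; ring.
  - have -> : (i.+1 == j :> nat) = false by lia.
    have -> : (i == j.+1 :> nat) = false by lia.
    by rewrite ij; case: (j.+1 == n) => /=; ring.
exists z => // i; have [rx _ rx' zx [tz zE]] := zP i.
split=> //; last by exists (x i), (x' i).
by rewrite ev mxE eqxx.
Qed.

Lemma typeB_type :
  simple_gla_of_type g (cartanB n) [set i : 'I_n | i.+1 == n].
Proof.
split.
- apply: (finite_dim_span_fin (b := typeB_basis)) => // x _.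
  exact: lspan_fin (typeB_span x).
- exact: typeB_simple.
- exact: prolongation_fundamental H _ _ typeB_span.
(* All eps are -1 on the grading element, so differences vanish and only the last root, a single
   -eps, gives 1. *)
have aE i : typeB_root i (grading_elt E) = (i.+1 == n)%:R.
  have li := ltn_ord i; have eE := eps_grading_elt xi_lin xiv Ev.
  rewrite /typeB_root eps_nat_ord eE; case: (i.+1 =P n) => iN.
    by rewrite eps_nat_ge ?iN // sub0r opprK.
  have iN' : (i.+1 < n)%N by lia.
  by rewrite (eps_nat_lt _ iN') eE subrr.
exists (grading_elt E), torus, typeB_root; split.
- split; first exact: grading_elt_grade.
  exact: (grading_eltP H xi_lin xiv gE Ev).
- exact: (torus_cartan H xi_lin xiv gE Ev).
- by split; [exact: typeB_simple_system|exact: typeB_cartan].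
- by move=> i; rewrite aE ler0n.
- apply/setP => i; rewrite !inE aE; case: eqP => _; first by rewrite eqxx.
  by rewrite eq_sym oner_eq0.
Qed.

End TypeBRoots.

(** * Rank two, three steps: type G *)

Lemma ord2_ind (P : 'I_2 -> Prop) : P 0 -> P 1 -> forall i, P i.
Proof.
move=> P0 P1 i; case: (unliftP 0 i) => [j|] -> //.
by have -> : lift 0 j = 1 :> 'I_2 by rewrite (ord1 j); apply/val_inj.
Qed.

(** A multirule: one [rewrite] evaluates every Kronecker delta on two indices. *)
Lemma ord2_delta (F : pzSemiRingType) :
  (((0 == 0 :> 'I_2)%:R = 1 :> F) * ((1 == 0 :> 'I_2)%:R = 0 :> F)) *
  (((0 == 1 :> 'I_2)%:R = 0 :> F) * ((1 == 1 :> 'I_2)%:R = 1 :> F)).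
Proof. by []. Qed.

Section ThreeStep.
Variables (F : numFieldType) (g : glaType F) (v : 'I_2 -> g).
Hypothesis H : free_prolongation 3 v.
Let gv := fp_grade H.
Local Notation w := [lie v 0, v 1].

Lemma grade_w : grade (- 2) w.
Proof. exact: (grade_lie_eq (gv 0) (gv 1)). Qed.
Lemma grade_vw i : grade (- 3) [lie v i, w].
Proof. exact: (grade_lie_eq (gv i) grade_w). Qed.
Lemma vvw0 i j : [lie v i, [lie v j, w]] = 0.
Proof. by apply: (below_zero H _ (gradeL (gv i) (grade_vw j))). Qed.

Lemma three_step_span x : negative_part x ->
  lspan (fun s : 'I_2 + option 'I_2 => match s with
    inl i => v i | inr None => w | inr (Some i) => [lie v i, w] end) x.
Proof.
set b := (b in lspan b).
have bw : lspan b w := lspan_in (b := b) (inr None).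
have bvw i : lspan b [lie v i, w] := lspan_in (b := b) (inr (Some i)).
have sN := subspaceN (lspan_subspace b).
have b0 y : y = 0 -> lspan b y by move->; apply: lspan0.
apply: (neg_lspan H) => [i|[i|[i|]] [k|[k|]]] /=.
- exact: (lspan_in (b := b) (inl i)).
- move: i k; apply: ord2_ind; apply: ord2_ind => //.
  + by apply: b0; apply: lie_bracketxx.
  + by rewrite lieC; apply: sN.
  + by apply: b0; apply: lie_bracketxx.
- by apply: b0; apply: vvw0.
- exact: bvw.
- by rewrite lieC; apply: sN; apply: b0; apply: vvw0.
- by apply: b0; apply: (below_zero H _ (gradeL (grade_vw i) (grade_vw k))).
- by apply: b0; apply: (below_zero H _ (gradeL (grade_vw i) grade_w)).
- by rewrite lieC; apply: sN; apply: bvw.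
- by apply: b0; apply: (below_zero H _ (gradeL grade_w (grade_vw k))).
- by apply: b0; apply: lie_bracketxx.
Qed.

(** Y_3-coefficients under the two homomorphisms v_0 -> X, v_1 -> Y_1 and v_1 -> X, v_0 -> Y_1. The
    second sends w to -Y_2, whence the sign. *)
Lemma coord3_exists : exists th : 'I_2 -> g -> F,
  [/\ forall i a x y, th i (a *: x + y) = a * th i x + th i y,
      forall i j, th i [lie v j, w] = (j == i)%:R
    & forall i p x, p != - 3 -> grade p x -> th i x = 0].
Proof.
have nw : negative_part w by apply: grade_neg grade_w.
have nv := v_neg H.
have coef (phi : {linear g -> filiform F 3}) : exists th : g -> F,
  [/\ forall a x y, th (a *: x + y) = a * th x + th y,
      forall j, th [lie v j, w] = phi [lie v j, w] 0 (inord 3)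
    & forall p x, p != - 3 -> grade p x -> th x = 0].
  exists (fun x => phi (pr (- 3) x) 0 (inord 3)); split=> [a x y|j|p x p1 gx].
  - by rewrite !linearP !mxE.
  - by rewrite (pr_id (grade_vw j)).
  - by rewrite (pr_grade _ gx) eq_sym (negPf p1) linear0 mxE.
have y3 : filY F 3 3 0 (inord 3) = 1 by rewrite mxE !eqxx.
have [phi0 [h0 _ p0]] := phi_basis H (i := 0) (j := 1) isT.
have [phi1 [h1 _ p1]] := phi_basis H (i := 1) (j := 0) isT.
have [t0 [l0 e0 z0]] := coef phi0; have [t1 [l1 e1 z1]] := coef phi1.
have X0 : phi0 (v 0) = filX F 3 by rewrite p0 /=; lmod.
have Y0 : phi0 (v 1) = filY F 3 1 by rewrite p0 /=; lmod.
have X1 : phi1 (v 1) = filX F 3 by rewrite p1 /=; lmod.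
have Y1 : phi1 (v 0) = filY F 3 1 by rewrite p1 /=; lmod.
have coefN (x : filiform F 3) k : (- x) 0 k = - x 0 k by rewrite mxE.
have coef0 k : (0 : filiform F 3) 0 k = 0 by rewrite mxE.
have w0 : phi0 w = filY F 3 2 by rewrite h0 // X0 Y0 filXY.
have w1 : phi1 w = - filY F 3 2 by rewrite h1 // X1 Y1 lieC filXY.
exists (fun i x => if i == 0 then t0 x else - t1 x); split.
- by move=> i a x y; case: ifP => _; rewrite ?l0 ?l1; ring.
- have n10 : (1 == 0 :> 'I_2) = false by [].
  apply: ord2_ind; apply: ord2_ind; rewrite ?n10 ?eqxx.
  + by rewrite e0 h0 // X0 w0 filXY.
  + by rewrite e0 h0 // Y0 w0 filYY.
  + by rewrite e1 h1 // Y1 w1 lieNr filYY // oppr0 coef0 oppr0.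
  + by rewrite e1 h1 // X1 w1 lieNr filXY // coefN y3 opprK.
- by move=> i p x p3 gx; case: ifP => _; rewrite ?(z0 p) ?(z1 p) ?oppr0.
Qed.

(** W and U i are the images of w and [v_i, w] forced by the Leibniz rule; the hypothesis is that
    rule on the zero words [v_i, [v_j, w]]. *)
Lemma three_step_extension (k : nat) (A : 'I_2 -> g) :
  (forall i, grade (k%:Z - 1) (A i)) ->
  (forall i j, [lie A i, [lie v j, w]] + [lie v i, [lie A j, w] +
     [lie v j, [lie A 0, v 1] + [lie v 0, A 1]]] = 0) ->
  exists2 x, grade k%:Z x & forall i, [lie x, v i] = A i.
Proof.
move=> gA; set W := _ + _ => hA.
have [xi [xi_lin xiv xi0]] := coord_exists H.
have [om [om_lin omv om0]] := coord2_exists H.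
have [th [th_lin thv th0]] := coord3_exists.
pose U i := [lie A i, w] + [lie v i, W].
have [a x y|X XE] := @linearize F g g (fun u => xi 0 u *: A 0 + xi 1 u *: A 1 +
    om 0 1 u *: W + (th 0 u *: U 0 + th 1 u *: U 1)).
  by rewrite !xi_lin om_lin !th_lin; lmod.
have om_v i : om 0 1 (v i) = 0 by rewrite (om0 _ _ (- 1)).
have th_v j i : th j (v i) = 0 by rewrite (th0 _ (- 1)).
have Xv i : X (v i) = A i.
  by move: i; apply: ord2_ind; rewrite XE om_v !th_v !xiv !ord2_delta; lmod.
have Xw : X w = W.
  by rewrite XE !(xi0 _ (-2) _ _ grade_w) // !(th0 _ (-2) _ _ grade_w) // omv !ord2_delta; lmod.
have Xvw i : X [lie v i, w] = U i.
  rewrite XE !(xi0 _ (-3) _ _ (grade_vw i)) // (om0 _ _ (-3) _ _ (grade_vw i)) // !thv.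
  by move: i; apply: ord2_ind; rewrite !ord2_delta; lmod.
have gW : grade (k%:Z - 2) W.
  apply: gradeD; first by apply: (grade_lie_eq (gA 0) (gv 1)); lia.
  by apply: (grade_lie_eq (gv 0) (gA 1)); lia.
have gU i : grade (k%:Z - 3) (U i).
  apply: gradeD; first by apply: (grade_lie_eq (gA i) grade_w); lia.
  by apply: (grade_lie_eq (gv i) gW); lia.
have [p u p0 gu|i u nu|x gx xE] := extend_derivation H (k := k) (X := X).
(* Homogeneity of the image, restated as an equation linear in u, so that it can be checked on the
   spanning family. *)
- have h : pr (p + k%:Z) (X (pr p u)) = X (pr p u).
    apply: (three_step_span (grade_neg p0 gu)
      (P := fun u => pr (p + k%:Z) (X (pr p u)) = X (pr p u))).
      by split=> [|a x y hx hy]; rewrite ?linear0 // !linearP /= hx hy.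
    have hp q x : grade q x -> grade (q + k%:Z) (X x) ->
        pr (p + k%:Z) (X (pr p x)) = X (pr p x).
      move=> gx gX; rewrite (pr_grade _ gx); case: eqP => [->|_]; first exact: pr_id.
      by rewrite !linear0.
    move=> [i|[i|]] /=.
    + by apply: (hp _ _ (gv i)); rewrite Xv addrC.
    + by apply: (hp _ _ (grade_vw i)); rewrite Xvw addrC.
    + by apply: (hp _ _ grade_w); rewrite Xw addrC.
  by rewrite -(pr_id gu) -h; apply: grade_pr.
- apply: (three_step_span nu (P := fun u => X [lie v i, u] = [lie X (v i), u] + [lie v i, X u])).
    split=> [|a x y hx hy]; first by rewrite lie0r !linear0 !lie0r addr0.
    by rewrite lie_bracketPr !linearP /= hx hy !lieE; lmod.
  move=> [j|[j|]] /=.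
  + rewrite !Xv; move: i j; apply: ord2_ind; apply: ord2_ind.
    * by rewrite lie_bracketxx linear0 [[lie A 0, _]]lieC addNr.
    * by rewrite Xw.
    * by rewrite lieC linearN /= Xw [[lie A 1, _]]lieC [[lie v 1, _]]lieC /W; lmod.
    * by rewrite lie_bracketxx linear0 [[lie A 1, _]]lieC addNr.
  + by rewrite vvw0 linear0 Xv Xvw hA.
  + by rewrite Xvw Xv Xw.
- by exists x => // i; rewrite xE ?Xv //; apply: v_neg H _.
Qed.

Lemma three_step_gl (A : 'I_2 -> g) : (forall i, grade (- 1) (A i)) ->
  exists2 x, grade 0 x & forall i, [lie x, v i] = A i.
Proof.
move=> gA; apply: (@three_step_extension 0) => // i j.
have h1 : grade (- 4) [lie A i, [lie v j, w]].
  exact: (grade_lie_eq (gA i) (grade_vw j)).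
have gW : grade (- 2) ([lie A 0, v 1] + [lie v 0, A 1]).
  by apply: gradeD; [apply: (grade_lie_eq (gA 0) (gv 1))|apply: (grade_lie_eq (gv 0) (gA 1))].
have h2 : grade (- 4) [lie v i, [lie A j, w] +
     [lie v j, [lie A 0, v 1] + [lie v 0, A 1]]].
  apply: (grade_lie_eq (gv i) (q := -3)) => //; apply: gradeD.
    exact: (grade_lie_eq (gA j) grade_w).
  exact: (grade_lie_eq (gv j) gW).
by rewrite (below_zero H _ h1) // (below_zero H _ h2) // addr0.
Qed.

End ThreeStep.

Section TypeG.
Variables (F : numFieldType) (g : glaType F) (v : 'I_2 -> g).
Hypothesis H : free_prolongation 3 v.
Let gv := fp_grade H.
Local Notation w := [lie v 0, v 1].
Local Notation Gam := (Gam 3 v).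
Let big : (2 < 3)%N \/ (2 < 2)%N := or_introl isT.
Let gw : grade (- 2) w := grade_w H.

Lemma w_neq0 : w <> 0.
Proof.
have [om [_ omv om0]] := coord2_exists H => w0.
have := omv 0 1 0 1; rewrite w0 !ord2_delta (om0 _ _ 0 _ _ (grade0 _ _)) //.
by rewrite mulr0 subr0 mulr1 => /esym/eqP; rewrite oner_eq0.
Qed.

Lemma vvE : ([lie v 0, v 0] = 0) * ([lie v 1, v 1] = 0) * ([lie v 1, v 0] = - w).
Proof. by rewrite !lie_bracketxx [[lie v 1, v 0]]lieC. Qed.

Lemma g1_w3 U b : Gam U b -> [lie U, w] = (4 * b 1) *: v 0 - (4 * b 0) *: v 1.
Proof. by move=> hU; rewrite (g1_w _ _ hU); lmod. Qed.

Lemma g1_vw U b j : Gam U b -> [lie U, [lie v j, w]] = (- 3 * b j) *: w.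
Proof.
move=> hU; rewrite (lieJr U (v j)) (g1_w3 hU) (lieJr [lie U, v j]) !hU !lieE.
by move: j; apply: ord2_ind; rewrite ?vvE; lmod.
Qed.

Lemma three_step_degree1 (b : 'I_2 -> F) : exists2 X, grade 1 X & Gam X b.
Proof.
have hA i : exists A, grade 0 A /\ forall j,
    [lie A, v j] = ((2 - 3%:R) * b i) *: v j + (3%:R * b j) *: v i.
  have [j|A gA AE] := three_step_gl H (A := fun j =>
    ((2 - 3%:R) * b i) *: v j + (3%:R * b j) *: v i); last by exists A.
  by apply: gradeD; apply: gradeZ.
have [A AP] := choice hA.
have [i|i j|X gX XE] := @three_step_extension F g v H 1 A.
- by case: (AP i).
- have E k m : [lie A k, v m] = ((2 - 3%:R) * b k) *: v m + (3%:R * b m) *: v k.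
    by have [_ ->] := AP k.
  (* The scalar is the trace of A_k on V: 2 (2 - 3) b_k + 3 b_k. *)
  have Aw k : [lie A k, w] = b k *: w.
    by rewrite lieJr !E !lieE; move: k; apply: ord2_ind; rewrite !vvE; lmod.
  rewrite [[lie v 0, A 1]]lieC !E (lieJr (A i)) Aw !E !lieE Aw.
  by move: i j; apply: ord2_ind; apply: ord2_ind; rewrite !vvE ?lieE; lmod.
- by exists X => // i j; rewrite XE; case: (AP i) => _ ->.
Qed.

Let gX0 k (X : g) i : grade k.+1%:Z X -> grade k%:Z [lie X, v i].
Proof. by move=> gX; apply: (grade_lie_eq gX (gv i)); lia. Qed.

(** X applied to [v_i, [v_j, w]] = 0: the words with i = j give 10 times a diagonal entry, the word
    (1, 0) gives 5 times B 0 1 + B 1 0. *)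
Lemma three_step_degree2_anti X (B : 'I_2 -> 'I_2 -> F) : grade 2 X ->
  (forall k, Gam [lie X, v k] (B k)) ->
  [/\ B 0 0 = 0, B 1 1 = 0 & B 1 0 = - B 0 1].
Proof.
move=> gX hB.
have Xw : [lie X, w] = [lie [lie X, v 0], v 1] - [lie [lie X, v 1], v 0].
  by rewrite lieJr [[lie v 0, _]]lieC; lmod.
have rel i j : [lie [lie X, v i], [lie v j, w]] +
    [lie v i, [lie [lie X, v j], w] - [lie [lie X, w], v j]] = 0.
  rewrite -[[lie [lie X, w], v j]]opprK -[- [lie [lie X, w], v j]]lieC opprK -lieJr -lieJr.
  by rewrite (vvw0 H) lie0r.
have rel' i j : (- 3 * B i j) *: w + [lie v i, (4 * B j 1) *: v 0 - (4 * B j 0) *: v 1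
   - (((2 - 3%:R) * B 0 1) *: v j + (3%:R * B 0 j) *: v 1
     - (((2 - 3%:R) * B 1 0) *: v j + (3%:R * B 1 j) *: v 0))] = 0.
  by rewrite -(rel i j) (g1_vw j (hB i)) (g1_w3 (hB j)) Xw lieDl lieNl !hB.
have w_inj (a : F) : a *: w = 0 -> a = 0.
  by move=> /eqP; rewrite scaler_eq0 => /orP[/eqP//|/eqP/w_neq0].
have h10 : 10 != 0 :> F by rewrite pnatr_eq0.
have h5 : 5 != 0 :> F by rewrite pnatr_eq0.
split.
- apply: (mulfI h10); rewrite mulr0; apply: w_inj; rewrite -[RHS]oppr0 -(rel' 0 0) !lieE !vvE; lmod.
- apply: (mulfI h10); rewrite mulr0; apply: w_inj; rewrite -[RHS]oppr0 -(rel' 1 1) !lieE !vvE; lmod.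
- apply/eqP; rewrite -addr_eq0; apply/eqP.
  apply: (mulfI h5); rewrite mulr0; apply: w_inj.
  by rewrite -[RHS]oppr0 -(rel' 1 0) !lieE !vvE; lmod.
Qed.

Variable xi : 'I_2 -> g -> F.
Hypothesis xi_lin : forall i a x y, xi i (a *: x + y) = a * xi i x + xi i y.
Hypothesis xiv : forall i j, xi i (v j) = (j == i)%:R.
Variable c : 'I_2 -> g.
Hypothesis gc : forall k, grade 1 (c k).
Hypothesis cGam : forall k, Gam (c k) (fun i => (i == k)%:R).
Local Notation d := [lie c 0, c 1].

Lemma grade_d : grade 2 d.
Proof. exact: (grade_lie_eq (gc 0) (gc 1)). Qed.

Lemma grade_cd i : grade 3 [lie c i, d].
Proof. exact: (grade_lie_eq (gc i) grade_d). Qed.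

Lemma d_v0 : [lie d, v 0] = 4 *: c 1.
Proof.
apply: (Gam_uniq H (gX0 0 grade_d) (gradeZ 4 (gc 1)) _ (GamZ 4 (cGam 1))).
apply: Gam_eq (Gam_cc H xi_lin xiv gc cGam 0 1 0) => a.
by rewrite !ord2_delta; ring.
Qed.

Lemma d_v1 : [lie d, v 1] = (- 4) *: c 0.
Proof.
apply: (Gam_uniq H (gX0 1 grade_d) (gradeZ (- 4) (gc 0)) _ (GamZ (- 4) (cGam 0))).
apply: Gam_eq (Gam_cc H xi_lin xiv gc cGam 0 1 1) => a.
by rewrite !ord2_delta; ring.
Qed.

Lemma three_step_degree2 X : grade 2 X -> exists s, X = s *: d.
Proof.
move=> gX; have [B hB] := choice (fun k => Gam_exists H big (gX0 k gX)).
have [B00 B11 B10] := three_step_degree2_anti gX hB.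
exists (4^-1 * B 0 1); apply: (trans_v_eq H gX (gradeZ _ grade_d)) => k.
have h4 : 4 != 0 :> F by rewrite pnatr_eq0.
have e (b : 'I_2 -> F) : Gam (b 0 *: c 0 + b 1 *: c 1) b.
  apply: Gam_eq (Gam_lin (b 0) (cGam 0) (GamZ (b 1) (cGam 1))).
  by apply: ord2_ind; rewrite !ord2_delta; ring.
have ge a b : grade 1 (a *: c 0 + b *: c 1) by apply: gradeD; apply: gradeZ.
rewrite (Gam_uniq H (gX0 k gX) (ge _ _) (hB k) (e (B k))) lieZl.
move: k; apply: ord2_ind; rewrite ?d_v0 ?d_v1 scalerA ?B00 ?B11 ?B10.
  by rewrite scale0r add0r; congr (_ *: _); field.
by rewrite scale0r addr0; congr (_ *: _); field.
Qed.

Lemma torus_bracket_c e i : grade 0 e ->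
  [lie e, c i] = - (xi i [lie e, v 0] *: c 0 + xi i [lie e, v 1] *: c 1).
Proof.
move=> ge; apply: (Gam_uniq H (b := fun a => - xi i [lie e, v a])).
- exact: (grade_lie_eq ge (gc i)).
- by apply: gradeN; apply: gradeD; apply: gradeZ.
- rewrite lieC; apply: Gam_eq (GamN (Gam_lie0 H xi_lin xiv ge (cGam i))) => a /=.
  by rewrite sum_delta.
- apply: Gam_eq (GamN (Gam_lin (xi i [lie e, v 0]) (cGam 0) (GamZ (xi i [lie e, v 1]) (cGam 1)))).
  by apply: ord2_ind; rewrite !ord2_delta; ring.
Qed.

(** d spans the exterior square of the linear forms on V, where e acts by minus its trace. *)
Lemma degree0_d e : grade 0 e ->
  [lie e, d] = - (xi 0 [lie e, v 0] + xi 1 [lie e, v 1]) *: d.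
Proof.
move=> ge; have gev k : grade (- 1) [lie e, v k] by apply: (grade_lie_eq ge (gv k)).
have ev k : [lie e, v k] = xi 0 [lie e, v k] *: v 0 + xi 1 [lie e, v k] *: v 1.
  by rewrite {1}(V_coord H xi_lin xiv (gev k)) big_ord_recl big_ord1; congr (_ + _ *: v _); 
     try congr (xi _ _); apply/val_inj.
apply: (trans_v_eq H (grade_lie_eq ge grade_d _) (gradeZ _ grade_d)) => // k.
rewrite lieJl lieZl (ev k); move: k; apply: ord2_ind;
  by rewrite !lieE ?d_v0 ?d_v1 !lieE !torus_bracket_c //; lmod.
Qed.

Lemma cd_v i k : [lie [lie c i, d], v k] = (3 * (i == k)%:R) *: d.
Proof.
have gcv : grade 0 [lie c i, v k] by apply: (grade_lie_eq (gc i) (gv k)).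
rewrite lieJl -[[lie d, _]]opprK -lieC opprK (degree0_d gcv) !cGam.
rewrite !(dualE xi_lin xiv).
by move: i k gcv; apply: ord2_ind; apply: ord2_ind => _;
  rewrite ?d_v0 ?d_v1 !ord2_delta !lieE ?lie_bracketxx ?[[lie c 1, c 0]]lieC; lmod.
Qed.

Lemma three_step_degree3 X : grade 3 X -> exists s t,
  X = s *: [lie c 0, d] + t *: [lie c 1, d].
Proof.
move=> gX; have [t tE] := choice (fun k => three_step_degree2 (gX0 k gX)).
exists (3^-1 * t 0), (3^-1 * t 1).
apply: (trans_v_eq H gX) => [|k].
  by apply: gradeD; apply: gradeZ; apply: grade_cd.
have h3 : 3 != 0 :> F by rewrite pnatr_eq0.
apply: (scalerI h3); rewrite tE !lieE !cd_v !scalerDr !scalerA -scalerDl; congr (_ *: _).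
by move: k; apply: ord2_ind; rewrite !ord2_delta; field.
Qed.

(** X applied to the zero words [v_i, [v_i, w]] lands in g_0. Evaluating on v_l with l <> i and
    taking coordinates gives four equations for the four unknowns t k l. *)
Lemma three_step_degree4 : is_zero (@grade F g 4).
Proof.
move=> X gX; have gY k := gX0 k gX.
have [t0 t0E] := choice (fun kl : 'I_2 * 'I_2 => three_step_degree2 (gX0 kl.2 (gY kl.1))).
pose t k l := t0 (k, l).
have tE k l : [lie [lie X, v k], v l] = t k l *: d by apply: (t0E (k, l)).
have Yw k : [lie [lie X, v k], w] = (- 4 * t k 0) *: c 0 + (- 4 * t k 1) *: c 1.
  rewrite (lieJr [lie X, v k]) tE [[lie v 0, _]]lieC tE !lieE d_v0 d_v1; lmod.
have Xw : [lie X, w] = (t 0 1 - t 1 0) *: d.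
  by rewrite lieJr tE [[lie v 0, _]]lieC tE; lmod.
have dw : [lie d, w] = 4 *: [lie c 1, v 1] + 4 *: [lie c 0, v 0].
  rewrite (lieJr d) d_v0 [[lie v 0, _]]lieC d_v1; rewrite !lieE; lmod.
have rel i l : [lie t i i *: [lie d, w] - [lie [lie [lie X, v i], w], v i]
    - [lie [lie [lie X, v i], w] - (t 0 1 - t 1 0) *: [lie d, v i], v i], v l] = 0.
  transitivity [lie [lie X, [lie v i, [lie v i, w]]], v l]; last first.
    by rewrite (vvw0 H) lie0r lie0l.
  rewrite (lieJr X (v i) [lie v i, w]) (lieJr [lie X, v i] (v i) w).
  rewrite (lieJr X (v i) w) Xw tE lieZl.
  rewrite (lieC (v i) ((t 0 1 - t 1 0) *: d)) (lieC (v i) (_ - _)).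
  by rewrite (lieC (v i) [lie [lie X, v i], w]) lieZl.
have /(congr1 (xi 1)) := rel 0 1; have /(congr1 (xi 0)) := rel 0 1.
have /(congr1 (xi 1)) := rel 1 0; have /(congr1 (xi 0)) := rel 1 0.
rewrite dw !Yw d_v0 d_v1 !lieE !cGam !(dualD xi_lin, dualN xi_lin, dualZ xi_lin, dual0 xi_lin, xiv).
rewrite !ord2_delta => e1 e2 e3 e4.
have h4 : - 4 != 0 :> F by rewrite oppr_eq0 pnatr_eq0.
have t00 : t 0 0 = 0 by apply: (mulfI h4); rewrite mulr0 -e4; ring.
have t11 : t 1 1 = 0 by apply: (mulfI h4); rewrite mulr0 -e1; ring.
(* The two equations left are 36 t01 - 12 t10 = 0 and 36 t10 - 12 t01 = 0; three times one plus the
   other isolates an unknown with coefficient 96. *)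
have h96 : 96 != 0 :> F by rewrite pnatr_eq0.
rewrite t00 in e3; rewrite t11 in e2.
have t01 : t 0 1 = 0.
  apply: (mulfI h96); have := congr2 (fun p q => 3 * p + q) e3 e2.
  by rewrite /= !mulr0 addr0 => <-; ring.
have t10 : t 1 0 = 0.
  apply: (mulfI h96); have := congr2 (fun p q => 3 * p + q) e2 e3.
  by rewrite /= !mulr0 addr0 => <-; ring.
apply: (trans_v H gX); apply: ord2_ind; apply: (trans_v H (gY _));
  by apply: ord2_ind; rewrite tE ?t00 ?t01 ?t10 ?t11 scale0r.
Qed.

End TypeG.

(** * Simplicity and the root system of type G *)

Section TypeGRoots.
Variables (F : numFieldType) (g : glaType F) (v : 'I_2 -> g).
Hypothesis H : free_prolongation 3 v.
Let gv := fp_grade H.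
Local Notation w := [lie v 0, v 1].
Let big : (2 < 3)%N \/ (2 < 2)%N := or_introl isT.
Variable xi : 'I_2 -> g -> F.
Hypothesis xi_lin : forall i a x y, xi i (a *: x + y) = a * xi i x + xi i y.
Hypothesis xiv : forall i j, xi i (v j) = (j == i)%:R.
Variable E : 'I_2 -> 'I_2 -> g.
Hypothesis gE : forall i j, grade 0 (E i j).
Hypothesis Ev : forall i j k, [lie E i j, v k] = (k == j)%:R *: v i.
Variable c : 'I_2 -> g.
Hypothesis gc : forall k, grade 1 (c k).
Hypothesis cGam : forall k, Gam 3 v (c k) (fun i => (i == k)%:R).
Local Notation d := [lie c 0, c 1].
Local Notation torus := (torus v).
Local Notation eps := (eps v xi).

Definition typeG_basis (k : 'I_14) : g :=
  nth 0 [:: v 0; v 1; w; [lie v 0, w]; [lie v 1, w];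
    E 0 0; E 0 1; E 1 0; E 1 1;
    c 0; c 1; d; [lie c 0, d]; [lie c 1, d]] k.
(** Left unsimplified so that each entry is literally what [weight_lie] or [torus_E_weight]
    produces. *)
Definition typeG_weight (k : 'I_14) (y : g) : F :=
  let a := eps 0 y in let b := eps 1 y in
  nth 0 [:: a; b; a + b; a + (a + b); b + (a + b);
    a - a; a - b; b - a; b - b;
    - a; - b; - a - b; - a + (- a - b); - b + (- a - b)] k.

Lemma typeG_weightP k y : torus y ->
  [lie y, typeG_basis k] = typeG_weight k y *: typeG_basis k.
Proof.
move=> ty; have hv i := torus_eps xi_lin xiv i ty.
have hc i := torus_c_weight H xi_lin xiv gc cGam i ty.
have hE i j := torus_E_weight H xi_lin xiv gE Ev i j ty.
have hw := weight_lie (hv 0) (hv 1); have hd := weight_lie (hc 0) (hc 1).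
case: k => [k hk]; rewrite /typeG_basis /typeG_weight /=.
do 14?[case: k hk => [|k] hk //=]; try exact: weight_lie.
Qed.

Let bs k (hk : (k < 14)%N) := lspan_in (b := typeG_basis) (Ordinal hk).

Lemma typeG_span x : lspan typeG_basis x.
Proof.
have sZ := subspaceZ (lspan_subspace typeG_basis).
have sD := subspaceD (lspan_subspace typeG_basis).
move: x; apply: grade_ind => [|p x gx]; first exact: lspan_subspace.
have [p0|p0] := ltP p 0.
  apply: lspan_trans (three_step_span H (grade_neg p0 gx)) => -[|[|]].
  - by apply: ord2_ind; [exact: (@bs 0 isT)|exact: (@bs 1 isT)].
  - by apply: ord2_ind; [exact: (@bs 3 isT)|exact: (@bs 4 isT)].
  - exact: (@bs 2 isT).
have [p4|p4] := lerP 4 p.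
  rewrite (grade_above_zero H (three_step_degree4 H xi_lin xiv gc cGam) p4 gx).
  exact: lspan0.
have : [\/ p = 0, p = 1, p = 2 | p = 3].
  have [->|p0'] := eqVneq p 0; first by constructor 1.
  have [->|p1] := eqVneq p 1; first by constructor 2.
  have [->|p2] := eqVneq p 2; first by constructor 3.
  by constructor 4; lia.
case=> e; rewrite e in gx.
- rewrite (gl_coord H xi_lin xiv gE Ev gx).
  apply: (subspace_sum (lspan_subspace _)) => j _.
  apply: (subspace_sum (lspan_subspace _)) => i _; apply: sZ.
  move: i j; apply: ord2_ind; apply: ord2_ind.
  + exact: (@bs 5 isT).
  + exact: (@bs 6 isT).
  + exact: (@bs 7 isT).
  + exact: (@bs 8 isT).
- have [b hb] := Gam_exists H big gx; rewrite (g1_coord H gc cGam gx hb).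
  apply: (subspace_sum (lspan_subspace _)) => i _; apply: sZ.
  by move: i; apply: ord2_ind; [exact: (@bs 9 isT)|exact: (@bs 10 isT)].
- have [s ->] := three_step_degree2 H xi_lin xiv gc cGam gx.
  by apply: sZ; exact: (@bs 11 isT).
- have [s [t ->]] := three_step_degree3 H xi_lin xiv gc cGam gx.
  by apply: sD; apply: sZ; [exact: (@bs 12 isT)|exact: (@bs 13 isT)].
Qed.

Lemma typeG_simple : simple_lie g.
Proof.
split.
  by exists (E 0 0), (v 0); rewrite Ev eqxx scale1r; apply: v_neq0 H _.
move=> I idI; have [|nz] := pselect (is_zero I); [by left|right].
have [sI lI] := idI.
have w0 := w_neq0 H.
have [p x pmu gx vx|z [Iz z0 gz]] := ideal_bottom H _ idI nz.
  have [p1|p2] : p = -1 \/ p = -2 by lia.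
    rewrite p1 in gx; apply: (V_eq0 H xi_lin xiv gx).
    have xE : x = xi 0 x *: v 0 + xi 1 x *: v 1.
      rewrite {1}(V_coord H xi_lin xiv gx) big_ord_recl big_ord1.
      by congr (_ + _ *: v _); try congr (xi _ _); apply/val_inj.
    have := vx 0; have := vx 1; rewrite [X in [lie v 1, X]]xE [X in [lie v 0, X]]xE.
    rewrite !lieE !(vvE v).
    rewrite !scaler0 add0r addr0 scalerN => /eqP.
    rewrite oppr_eq0 scaler_eq0 => /orP[/eqP h|/eqP//] /eqP.
    rewrite scaler_eq0 => /orP[/eqP h'|/eqP//].
    exact: ord2_ind.
  rewrite p2 in gx.
  have [s xs] : exists s : F, x = s *: w.
    rewrite -(pr_id gx); apply: (three_step_span H (grade_neg _ gx)
      (P := fun x => exists s : F, pr (- 2) x = s *: w)) => //.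
      split=> [|a y z [s hs] [t ht]]; first by exists 0; rewrite linear0 scale0r.
      by exists (a * s + t); rewrite linearP /= hs ht; lmod.
    move=> [i|[i|]].
    - by exists 0; rewrite (pr_grade _ (gv i)) scale0r.
    - by exists 0; rewrite (pr_grade _ (grade_vw H i)) scale0r.
    - by exists 1; rewrite (pr_id (grade_w H)) scale1r.
  (* [c_0, [v_0, w]] = -3 w, so [v_0, s w] = 0 forces s w = 0. *)
  have := congr1 (fun u => [lie c 0, u]) (vx 0).
  rewrite xs lie0r !lieZr (g1_vw 0 (cGam 0)) eqxx scalerA => /eqP.
  rewrite scaler_eq0 !mulf_eq0 oppr_eq0 pnatr_eq0 oner_eq0 /= orbF.
  by move=> /orP[/eqP->|/eqP//]; rewrite scale0r.
have [s [t zE]] : exists s t : F, z = s *: [lie v 0, w] + t *: [lie v 1, w].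
  rewrite -(pr_id gz); apply: (three_step_span H (grade_neg _ gz)
    (P := fun x => exists s t : F, pr (- 3%:Z) x = s *: [lie v 0, w] + t *: [lie v 1, w])) => //.
    split=> [|a x y [s [t h]] [s' [t' h']]].
      by exists 0, 0; rewrite linear0; lmod.
    by exists (a * s + s'), (a * t + t'); rewrite linearP /= h h'; lmod.
  move=> [i|[i|]].
  - by exists 0, 0; rewrite (pr_grade _ (gv i)); lmod.
  - rewrite (pr_id (grade_vw H i)); move: i; apply: ord2_ind.
      by exists 1, 0; lmod.
    by exists 0, 1; lmod.
  - by exists 0, 0; rewrite (pr_grade _ (grade_w H)); lmod.
(* The ideal climbs: some c_k carries z to a nonzero multiple of w, and [c_1, w] = 4 v_0 then
   reaches V. *)
have cz (k : 'I_2) : [lie c k, z] = (- 3 * ((0 == k)%:R * s + (1 == k)%:R * t)) *: w.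
  by rewrite zE lieDr !lieZr !(g1_vw _ (cGam k)); lmod.
have Iw : I w.
  have [k ck] : exists k : 'I_2, (- 3 * ((0 == k)%:R * s + (1 == k)%:R * t)) != 0.
    have h3 : - 3 != 0 :> F by rewrite oppr_eq0 pnatr_eq0.
    have [s0|s0] := eqVneq s 0; last first.
      by exists 0; rewrite !ord2_delta mul1r mul0r addr0 mulf_neq0.
    exists 1; rewrite !ord2_delta mul1r mul0r add0r mulf_neq0 //.
    by apply/eqP => t0; apply: z0; rewrite zE s0 t0; lmod.
  by rewrite -[w](scalerK ck) -cz; apply: (subspaceZ sI); apply: lI.
have h4 : 4 != 0 :> F by rewrite pnatr_eq0.
apply: (ideal_full H xi_lin xiv gE Ev gc cGam _ idI (y := v 0)) => //.
- by rewrite (_ : _ + _ = 1) ?oner_eq0 //; ring.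
- rewrite -[v 0](scalerK h4); apply: (subspaceZ sI).
  suff <- : [lie c 1, w] = 4 *: v 0 by apply: lI.
  by rewrite (g1_w3 (cGam 1)) !ord2_delta; lmod.
- exact: v_neq0 H _.
Qed.

(** -eps_1 is the short simple root and eps_1 - eps_0 the long one; the signs make both nonnegative
    on the grading element. *)
Definition typeG_root (i : 'I_2) (y : g) : F := (i == 1)%:R * (eps 1 y - eps 0 y)
  - (i == 0)%:R * eps 1 y.

Lemma typeG_root0 y : typeG_root 0 y = - eps 1 y.
Proof. by rewrite /typeG_root !ord2_delta; ring. Qed.
Lemma typeG_root1 y : typeG_root 1 y = eps 1 y - eps 0 y.
Proof. by rewrite /typeG_root !ord2_delta; ring. Qed.

Lemma typeG_root_lin i a x y :
  typeG_root i (a *: x + y) = a * typeG_root i x + typeG_root i y.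
Proof. rewrite /typeG_root !(eps_lin v xi_lin); ring. Qed.

Lemma sum_ord2 (f : 'I_2 -> F) : \sum_i f i = f 0 + f 1.
Proof. by rewrite big_ord_recl big_ord1; congr (f _ + f _); apply/val_inj. Qed.

Lemma typeG_dual (l : 'I_2) : exists2 y, torus y &
  forall k : 'I_2, typeG_root k y = (k == l)%:R.
Proof.
have [y ty yE] := torus_exists xi_lin xiv gE Ev
  (fun k : 'I_2 => - (l == 0)%:R - ((k == 0)%:R * (l == 1)%:R)).
exists y => // k; rewrite /typeG_root !yE; move: k l {ty yE}.
by apply: ord2_ind; apply: ord2_ind; rewrite !ord2_delta; ring.
Qed.

Lemma typeG_root_exists (i : 'I_2) : exists x x' z : g,
  [/\ root_space torus (typeG_root i) x, x <> 0,
      root_space torus (fun y => - typeG_root i y) x',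
      z = [lie x, x'] & torus z /\ eps 0 z = (i == 0)%:R - (i == 1)%:R /\
        eps 1 z = (i == 1)%:R - 2 * (i == 0)%:R].
Proof.
have wt (z : g) (a : 'I_2 -> F) : (forall k, [lie z, v k] = a k *: v k) ->
    forall k, eps k z = a k.
  by move=> za k; rewrite /eps za !(dualE xi_lin xiv) eqxx mulr1.
move: i; apply: ord2_ind.
  have wz k : [lie [lie - c 1, v 1], v k] = ((k == 0)%:R - 2 * (k == 1)%:R) *: v k.
    rewrite !lieNl cGam; move: k; apply: ord2_ind; rewrite !ord2_delta; lmod.
  exists (- c 1), (v 1), [lie - c 1, v 1]; split=> //.
  - by move=> y ty; rewrite typeG_root0 lieNr (torus_c_weight H xi_lin xiv gc cGam 1 ty) scalerN.
  - move=> /eqP; rewrite oppr_eq0 => /eqP c0; have := cGam 1; rewrite c0 => h.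
    have := Gam_inj xi_lin xiv h (Gam0 3 v) 1; rewrite ord2_delta => /eqP.
    by rewrite oner_eq0.
  - by move=> y ty; rewrite typeG_root0 opprK; apply: torus_eps.
  - split; last by rewrite !(wt _ _ wz) !ord2_delta; split; ring.
    split; last by exists (fun k => (k == 0)%:R - 2 * (k == 1)%:R).
    exact: (grade_lie_eq (gradeN (gc 1)) (gv 1)).
have wE k l y : torus y -> [lie y, E k l] = (eps k y - eps l y) *: E k l.
  by move=> ty; exact: (torus_E_weight H xi_lin xiv gE Ev k l ty).
have wz k : [lie [lie E 1 0, E 0 1], v k] = ((k == 1)%:R - (k == 0)%:R) *: v k.
  by rewrite lieJl !(Ev, lieE); move: k; apply: ord2_ind; rewrite !ord2_delta; lmod.
exists (E 1 0), (E 0 1), [lie E 1 0, E 0 1]; split=> //.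
- by move=> y ty; rewrite typeG_root1; apply: wE.
- move=> E0; have := Ev 1 0 0; rewrite E0 lie0l eqxx scale1r => /esym.
  exact: v_neq0 H _.
- by move=> y ty; rewrite typeG_root1 opprB; apply: wE.
- split; last by rewrite !(wt _ _ wz) !ord2_delta; split; ring.
  split; last by exists (fun k => (k == 1)%:R - (k == 0)%:R).
  exact: (grade_lie_eq (gE 1 0) (gE 0 1)).
Qed.

Lemma typeG_simple_system : is_simple_root_system torus typeG_root.
Proof.
split=> [i|k hk l|f rf].
- split=> [a x y _ _||]; first exact: typeG_root_lin.
    have [y ty yE] := typeG_dual i; exists y => //; rewrite yE eqxx.
    by apply/eqP; apply: oner_neq0.
  by have [x [_ [_ [rx x0 _ _ _]]]] := typeG_root_exists i; exists x.
- have [y ty yE] := typeG_dual l; have := hk y ty.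
  rewrite (eq_bigr (fun i => (i == l)%:R * k i)) ?sum_delta // => i _.
  by rewrite yE mulrC.
have [s sE] := root_is_weight typeG_weightP typeG_span rf.
have [_ [y0 ty0 fy0] _] := rf.
pose R := exists k : 'I_2 -> nat,
  (forall y, torus y -> f y = \sum_i (k i)%:R * typeG_root i y) \/
  (forall y, torus y -> f y = - \sum_i (k i)%:R * typeG_root i y).
(* p times the short simple root plus q times the long one. *)
pose comb p q y := p%:R * - eps 1 y + q%:R * (eps 1 y - eps 0 y).
have combE p q y : \sum_i (if i == 0 then p else q)%:R * typeG_root i y = comb p q y.
  by rewrite sum_ord2 typeG_root0 typeG_root1.
have pos p q : (forall y, torus y -> f y = comb p q y) -> R.
  move=> h; exists (fun i => if i == 0 then p else q); left=> y ty.
  by rewrite combE; apply: h.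
have neg p q : (forall y, torus y -> f y = - comb p q y) -> R.
  move=> h; exists (fun i => if i == 0 then p else q); right=> y ty.
  by rewrite combE; apply: h.
case: s sE => [k hk]; rewrite /typeG_weight /= => sE.
do 14?[case: k hk sE => [|k] hk /= sE] => //.
- by apply: (neg 1%N 1%N) => y ty; rewrite (sE y ty) /comb; ring.
- by apply: (neg 1%N 0%N) => y ty; rewrite (sE y ty) /comb; ring.
- by apply: (neg 2%N 1%N) => y ty; rewrite (sE y ty) /comb; ring.
- by apply: (neg 3%N 2%N) => y ty; rewrite (sE y ty) /comb; ring.
- by apply: (neg 3%N 1%N) => y ty; rewrite (sE y ty) /comb; ring.
- by apply: (pos 0%N 0%N) => y ty; rewrite (sE y ty) /comb; ring.
- by apply: (neg 0%N 1%N) => y ty; rewrite (sE y ty) /comb; ring.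
- by apply: (pos 0%N 1%N) => y ty; rewrite (sE y ty) /comb; ring.
- by apply: (pos 0%N 0%N) => y ty; rewrite (sE y ty) /comb; ring.
- by apply: (pos 1%N 1%N) => y ty; rewrite (sE y ty) /comb; ring.
- by apply: (pos 1%N 0%N) => y ty; rewrite (sE y ty) /comb; ring.
- by apply: (pos 2%N 1%N) => y ty; rewrite (sE y ty) /comb; ring.
- by apply: (pos 3%N 2%N) => y ty; rewrite (sE y ty) /comb; ring.
- by apply: (pos 3%N 1%N) => y ty; rewrite (sE y ty) /comb; ring.
Qed.

Lemma typeG_cartan : has_cartan_matrix torus typeG_root cartanG2.
Proof.
have [x xP] := choice typeG_root_exists; have [x' x'P] := choice xP.
have [z zP] := choice x'P.
have ev i j : typeG_root i (z j) = (cartanG2 i j)%:~R.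
  have [_ _ _ _ [tz [e0 e1]]] := zP j.
  rewrite /typeG_root e0 e1 mxE; move: i j {tz e0 e1}.
  by apply: ord2_ind; apply: ord2_ind; rewrite !ord2_delta /=; ring.
exists z => // i; have [rx _ rx' zx [tz zE]] := zP i.
split=> //; last by exists (x i), (x' i).
by rewrite ev mxE eqxx.
Qed.

Lemma typeG_type : simple_gla_of_type g cartanG2 [set 0 : 'I_2].
Proof.
split.
- apply: (finite_dim_span_fin (b := typeG_basis)) => // x _.
  exact: lspan_fin (typeG_span x).
- exact: typeG_simple.
- exact: prolongation_fundamental H _ _ typeG_span.
have aE i : typeG_root i (grading_elt E) = (i == 0)%:R.
  have eE := eps_grading_elt xi_lin xiv Ev.
  by rewrite /typeG_root !eE; move: i; apply: ord2_ind; rewrite !ord2_delta; ring.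
exists (grading_elt E), torus, typeG_root; split.
- split; first exact: grading_elt_grade.
  exact: (grading_eltP H xi_lin xiv gE Ev).
- exact: (torus_cartan H xi_lin xiv gE Ev).
- by split; [exact: typeG_simple_system|exact: typeG_cartan].
- by move=> i; rewrite aE ler0n.
- apply/setP => i; rewrite !inE aE; case: eqP => _; first by rewrite eqxx.
  by rewrite eq_sym oner_eq0.
Qed.

End TypeGRoots.

(** * The contact algebra *)

Lemma ord3_ind (P : 'I_3 -> Prop) : P 0 -> P 1 -> P 2 -> forall i, P i.
Proof.
move=> P0 P1 P2 i; case: (unliftP 0 i) => [j|] -> //.
case: (unliftP 0 j) => [k|] ->; last first.
  by have -> : lift 0 0 = 1 :> 'I_3 by apply/val_inj.
by have -> : lift 0 (lift 0 k) = 2 :> 'I_3 by rewrite (ord1 k); apply/val_inj.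
Qed.

Lemma sum_ord3 (V : nmodType) (f : 'I_3 -> V) : \sum_i f i = f 0 + f 1 + f 2.
Proof.
rewrite !big_ord_recl big_ord0 addr0 addrA.
by congr (f _ + f _ + f _); apply/val_inj.
Qed.

Section ContactPolynomials.
Variable F : numFieldType.
Local Notation poly3 := {mpoly F[3]}.
Implicit Types p q f h : poly3.

Lemma mderivXU i j : mderiv i ('X_j : poly3) = (i == j)%:R.
Proof.
rewrite mderivX mnm1E eq_sym; case: eqP => [->|_]; last by rewrite scale0r.
have -> : (U_(j) - U_(j))%MM = 0%MM :> 'X_{1..3}.
  by apply/mnmP => k; rewrite mnmBE mnm0E subnn.
by rewrite mpolyX0 scale1r.
Qed.

Lemma mcoeff_mulX i p (m : 'X_{1..3}) :
  ('X_i * p)@_m = if m i == 0%N then 0 else p@_(m - U_(i)).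
Proof.
case: eqP => [mi|/eqP mi].
  rewrite [p]mpolyE mulr_sumr raddf_sum big1 // => k _ /=.
  rewrite -scalerAr mcoeffZ -mpolyXD mcoeffX; case: eqP => [e|]; last by rewrite mulr0.
  by move/(congr1 (fun m : 'X_{1..3} => m i)): e; rewrite mnmDE mnm1E eqxx mi.
rewrite -[in LHS](@submK _ U_(i) m) ?lep1mP // addmC mulrC.
by rewrite mcoeffMX.
Qed.

(* The contact brackets with - x_2 and x_1, which generate the negative part. *)
Definition contact_op (i : 'I_2) p : poly3 :=
  if i == 0 then mderiv 0 p else mderiv 1 p + 'X_0 * mderiv 2 p.

Fixpoint contact_word (s : seq 'I_2) p : poly3 :=
  if s is i :: s' then contact_word s' (contact_op i p) else p.

Lemma contact_op_lin i a p q :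
  contact_op i (a *: p + q) = a *: contact_op i p + contact_op i q.
Proof.
rewrite /contact_op; case: ifP => _; rewrite !mderivD !mderivZ //.
by rewrite mulrDr -scalerAr scalerDr addrACA.
Qed.
Lemma contact_op0 i : contact_op i 0 = 0.
Proof. by rewrite /contact_op !mderiv0 mulr0 addr0 if_same. Qed.
Lemma contact_opB i p q : contact_op i (p - q) = contact_op i p - contact_op i q.
Proof. by rewrite addrC -scaleN1r contact_op_lin scaleN1r addrC. Qed.
Lemma contact_word_lin s a p q :
  contact_word s (a *: p + q) = a *: contact_word s p + contact_word s q.
Proof. by elim: s p q => //= i s IHs p q; rewrite contact_op_lin IHs. Qed.

Lemma contact_opC p :
  contact_op 0 (contact_op 1 p) - contact_op 1 (contact_op 0 p) = mderiv 2 p.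
Proof.
rewrite /contact_op /= !mderivD !mderivM !mderivXU /=.
by rewrite (mderiv_comm 1 0) (mderiv_comm 2 0); ring.
Qed.

Lemma contact_op_mderiv2 i p : contact_op i (mderiv 2 p) = mderiv 2 (contact_op i p).
Proof.
rewrite /contact_op; case: ifP => _; first exact: mderiv_comm.
rewrite !mderivD !mderivM !mderivXU /= (mderiv_comm 2 1); ring.
Qed.

(** Induction on the degree of a monomial m. If x_1 occurs, use d/dx_1. If not, the term x_1 d/dx_3
    of [contact_op 1] contributes nothing to the coefficient and that operator acts as d/dx_2. If
    only x_3 occurs, the commutator of the two operators is d/dx_3. *)
Lemma contact_word_eq0 p : (forall s, (contact_word s p)@_0%MM = 0) -> p = 0.
Proof.
move=> hp; apply/mpolyP => m; rewrite mcoeff0; move: {2}(mdeg m) (erefl (mdeg m)) => k.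
elim: k m p hp => [|k IHk] m p hp mk.
  by move/eqP: mk; rewrite mdeg_eq0 => /eqP ->; apply: (hp [::]).
have hc i s : (contact_word s (contact_op i p))@_0%MM = 0 by apply: (hp (i :: s)).
have hB f h : (forall s, (contact_word s f)@_0%MM = 0) ->
    (forall s, (contact_word s h)@_0%MM = 0) ->
    forall s, (contact_word s (f - h))@_0%MM = 0.
  move=> hf hh s; rewrite addrC -scaleN1r contact_word_lin mcoeffD mcoeffZ.
  by rewrite hf hh mulr0 addr0.
have step i : m i != 0%N -> (mderiv i p)@_(m - U_(i)) = 0 -> p@_m = 0.
  move=> mi; rewrite mcoeff_deriv submK ?lep1mP // => /eqP.
  by rewrite -mulr_natr mulf_eq0 pnatr_eq0 orbF => /eqP.
have md i : m i != 0%N -> mdeg (m - U_(i)) = k.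
  move=> mi; have := mdegD (m - U_(i)) U_(i); rewrite submK ?lep1mP // mk mdeg1 addn1.
  by case.
have [m0|m0] := eqVneq (m 0) 0%N; last first.
  by apply: (step 0 m0); apply: IHk (md _ m0); apply: hc 0.
have [m1|m1] := eqVneq (m 1) 0%N; last first.
  apply: (step 1 m1); have := IHk _ _ (hc 1) (md _ m1).
  by rewrite mcoeffD mcoeff_mulX mnmBE m0 /= addr0.
have [m2|m2] := eqVneq (m 2) 0%N; last first.
  apply: (step 2 m2); rewrite -contact_opC; apply: IHk (md _ m2).
  by apply: hB => s; [apply: (hp [:: 1, 0 & s])|apply: (hp [:: 0, 1 & s])].
have : mdeg m = 0%N by rewrite mdegE sum_ord3 m0 m1 m2.
by rewrite mk.
Qed.

Lemma mcoeff_exists (N : nat) (phi : 'X_{1..3} -> F) :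
  (forall m, (N <= mdeg m)%N -> phi m = 0) -> exists p, forall m, p@_m = phi m.
Proof.
move=> hphi; exists (\sum_(m : 'X_{1..3 < N}) (phi m *: 'X_[m])) => m.
have [mN|mN] := ltnP (mdeg m) N; first exact: mcoeff_mpoly.
rewrite hphi // raddf_sum big1 // => -[k kN] _ /=.
rewrite mcoeffZ mcoeffX; case: eqP => [e|]; last by rewrite mulr0.
by move: kN; rewrite e ltnNge mN.
Qed.

Lemma mcoeff0M p q : (p * q)@_0%MM = p@_0%MM * q@_0%MM.
Proof. by have [->] := @mcoeff0_is_multiplicative 3 F. Qed.

(** The Lagrange bracket: the contact field of f applied to h, minus the product of df/dx_3 and
    h. *)
Definition contact_bracket f h : poly3 :=
  - mderiv 1 f * mderiv 0 h + (mderiv 0 f + 'X_1 * mderiv 2 f) * mderiv 1 h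
  + (f - 'X_1 * mderiv 1 f) * mderiv 2 h - mderiv 2 f * h.

Lemma contact_op_bracket i f h : contact_op i (contact_bracket f h) =
  contact_bracket (contact_op i f) h + contact_bracket f (contact_op i h).
Proof.
rewrite /contact_op /contact_bracket; case: ifP => _;
  rewrite !(mderivD, mderivN, mderivM, mderivXU) /=
   ?(mderiv_comm 1 0) ?(mderiv_comm 2 0) ?(mderiv_comm 2 1); ring.
Qed.

(** The contact field D with Hamiltonian omega_K(D) = f. *)
Definition contact_vf f : vector_field F 3 :=
  [ffun i : 'I_3 => if i == 0 then - mderiv 1 f
    else if i == 1 then mderiv 0 f + 'X_1 * mderiv 2 f else f - 'X_1 * mderiv 1 f].

Lemma contact_vf_lin a f h : contact_vf (a *: f + h) = a *: contact_vf f + contact_vf h.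
Proof.
apply/ffunP; apply: ord3_ind; rewrite !ffunE /= !mderivD !mderivZ.
- by rewrite opprD scalerN.
- by rewrite mulrDr -scalerAr scalerDr addrACA.
- by rewrite mulrDr -scalerAr opprD scalerBr addrACA.
Qed.

Lemma contact_vf_bracket f h :
  contact_vf (contact_bracket f h) = vf_bracket (contact_vf f) (contact_vf h).
Proof.
apply/ffunP; apply: ord3_ind; rewrite !ffunE /vf_apply !sum_ord3 !ffunE /contact_bracket /=;
  rewrite !(mderivD, mderivN, mderivM, mderivXU) /=
   ?(mderiv_comm 1 0) ?(mderiv_comm 2 0) ?(mderiv_comm 2 1); ring.
Qed.

Lemma contact_vfK f : contact_vf f 2 - 'X_1 * contact_vf f 0 = f.
Proof. by rewrite !ffunE /=; ring. Qed.

Lemma contact_vf_contact f : contact_field (contact_vf f).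
Proof.
exists (mderiv 2 f); apply: ord3_ind;
  rewrite !ffunE /vf_apply !sum_ord3 !ffunE /=;
  rewrite !(mderivD, mderivN, mderivM, mderivXU) ?mderiv0 /= -?[1]/(1%:MP) ?mderivC;
  rewrite ?(mderiv_comm 1 0) ?(mderiv_comm 2 0) ?(mderiv_comm 2 1); ring.
Qed.

(** The dx_3-component of the contact condition gives the multiplier q, the dx_2-component expresses
    the x_2-derivative of D_3 by that of D_1, and the dx_1-component then gives D_2. *)
Lemma contact_fieldE (D : vector_field F 3) : contact_field D ->
  D = contact_vf (D 2 - 'X_1 * D 0).
Proof.
have d1 i : mderiv i (1 : poly3) = 0 by rewrite -[1]/(1%:MP) mderivC.
case=> q hq; have := hq 0; have := hq 1; have := hq 2.
rewrite !ffunE /vf_apply !sum_ord3 !ffunE /=.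
rewrite !(mderivN, mderivXU, d1, mderiv0) /= => e2 e1 e0.
apply/ffunP; apply: ord3_ind; rewrite !ffunE /=;
  rewrite !(mderivB, mderivM, mderivXU) /=.
- have -> : mderiv 1 (D 2) = 'X_1 * mderiv 1 (D 0).
    apply/eqP; rewrite -subr_eq0 -(mulr0 q) -e1; apply/eqP; ring.
  ring.
- have q2 : q = mderiv 2 (D 2) - 'X_1 * mderiv 2 (D 0).
    by rewrite -[q]mulr1 -e2; ring.
  move/eqP: e0; rewrite -subr_eq0 q2 => /eqP e0.
  apply/eqP; rewrite -subr_eq0 -oppr_eq0 -e0; apply/eqP; ring.
- have -> : mderiv 1 (D 2) = 'X_1 * mderiv 1 (D 0).
    apply/eqP; rewrite -subr_eq0 -(mulr0 q) -e1; apply/eqP; ring.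
  ring.
Qed.

End ContactPolynomials.

Section Weights.
Variable F : numFieldType.
Local Notation poly3 := {mpoly F[3]}.
Local Notation whomog := (@weighted_homogeneous F 3 K1_weight).
Implicit Types p q f h : poly3.

Definition mnm_weight (m : 'X_{1..3}) : nat := (m 0%R + m 1%R + 2 * m 2%R)%N.

Lemma whomogP d p :
  whomog d p <-> forall m, p@_m != 0 -> (mnm_weight m)%:Z = d.
Proof.
have e (m : 'X_{1..3}) : (\sum_i m i * K1_weight i)%N = mnm_weight m.
  by rewrite sum_ord3 /K1_weight /mnm_weight /= !muln1 mulnC.
split=> h m; first by rewrite -mcoeff_msupp => /h; rewrite e.
by rewrite mcoeff_msupp => /h; rewrite e.
Qed.

Lemma mnm_weightU m i : mnm_weight (m + U_(i)) = (mnm_weight m + K1_weight i)%N.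
Proof.
rewrite /mnm_weight /K1_weight !mnmDE !mnm1E; move: i.
apply: ord3_ind => /=; lia.
Qed.

Lemma whomog_lin d a p q : whomog d p -> whomog d q -> whomog d (a *: p + q).
Proof.
move=> /whomogP hp /whomogP hq; apply/whomogP => m; rewrite mcoeffD mcoeffZ.
have [p0|/hp //] := eqVneq p@_m 0; rewrite p0 mulr0 add0r; exact: hq.
Qed.
Lemma whomog0 d : whomog d 0.
Proof. by apply/whomogP => m; rewrite mcoeff0 eqxx. Qed.
Lemma whomogD d p q : whomog d p -> whomog d q -> whomog d (p + q).
Proof. by rewrite -[p in X in _ -> _ -> X]scale1r; apply: whomog_lin. Qed.
Lemma whomogN d p : whomog d p -> whomog d (- p).
Proof.
by move=> hp; rewrite -scaleN1r -[_ *: _]addr0; apply: whomog_lin => //; apply: whomog0.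
Qed.

Lemma whomog_mderiv d i p : whomog d p -> whomog (d - (K1_weight i)%:Z) (mderiv i p).
Proof.
move=> /whomogP hp; apply/whomogP => m; rewrite mcoeff_deriv => pm.
have /hp : p@_(m + U_(i)) != 0 by apply: contraNneq pm => ->; rewrite mul0rn.
by rewrite mnm_weightU; lia.
Qed.

Lemma whomog_mulX d i p : whomog d p -> whomog (d + (K1_weight i)%:Z) ('X_i * p).
Proof.
move=> /whomogP hp; apply/whomogP => m; rewrite mcoeff_mulX.
case: (m i =P 0%N) => [_|/eqP mi]; first by rewrite eqxx.
move/hp => <-; rewrite -{1}(@submK _ U_(i) m) ?lep1mP // mnm_weightU; lia.
Qed.

Lemma whomog_op d i p : whomog d p -> whomog (d - 1) (contact_op i p).
Proof.
move=> hp; rewrite /contact_op; case: ifP => _.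
  exact: (@whomog_mderiv d 0 p hp).
apply: whomogD; first exact: (@whomog_mderiv d 1 p hp).
have := @whomog_mulX _ 0 _ (@whomog_mderiv d 2 p hp).
by rewrite -addrA.
Qed.

Lemma whomog_neg d p : d < 0 -> whomog d p -> p = 0.
Proof.
move=> d0 /whomogP hp; apply/mpolyP => m; rewrite mcoeff0.
by apply/eqP; apply: contraTT isT => /hp; lia.
Qed.

Lemma whomog_const d p : d != 0 -> whomog d p -> p@_0%MM = 0.
Proof.
move=> d0 /whomogP hp; apply/eqP; apply: contraNT d0 => /hp <-.
by rewrite /mnm_weight !mnm0E.
Qed.

Lemma whomog_contact_vf (k : int) f : whomog (k + 2) f ->
  K1_grade k (contact_vf f).
Proof.
move=> hf; split; first exact: contact_vf_contact.
have d i := @whomog_mderiv _ i _ hf.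
apply: ord3_ind; rewrite ffunE /=.
- by have := whomogN (d 1); congr weighted_homogeneous; rewrite /K1_weight /=; lia.
- apply: whomogD.
    by have := d 0; congr weighted_homogeneous; rewrite /K1_weight /=; lia.
  by have := @whomog_mulX _ 1 _ (d 2); congr weighted_homogeneous; rewrite /K1_weight /=; lia.
- apply: whomogD; first by rewrite /K1_weight.
  apply: whomogN; have := @whomog_mulX _ 1 _ (d 1).
  by congr weighted_homogeneous; rewrite /K1_weight /=; lia.
Qed.

Lemma K1_grade_whomog (k : int) (D : vector_field F 3) : K1_grade k D ->
  whomog (k + 2) (D 2 - 'X_1 * D 0).
Proof.
move=> [_ hD]; apply: whomogD; first exact: (hD 2).
apply: whomogN; have := @whomog_mulX _ 1 _ (hD 0).
by congr weighted_homogeneous; rewrite /K1_weight /=; lia.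
Qed.

End Weights.

(** * Hamiltonians of elements of g and the isomorphism with K(1) *)

Section ContactAlgebraIso.
Variables (F : numFieldType) (g : glaType F) (v : 'I_2 -> g).
Hypothesis H : free_prolongation 2 v.
Let gv := fp_grade H.
Local Notation poly3 := {mpoly F[3]}.
Local Notation whomog := (@weighted_homogeneous F 3 K1_weight).
Local Notation e3 := [lie v 0, v 1].
Variable lam : g -> F.
Hypothesis lam_lin : forall a x y, lam (a *: x + y) = a * lam x + lam y.
Hypothesis lam_e3 : lam e3 = 1.
Hypothesis lam_grade : forall p x, p != - 2 -> grade p x -> lam x = 0.

Fixpoint lie_word (s : seq 'I_2) (x : g) : g :=
  if s is i :: s' then lie_word s' [lie v i, x] else x.

(* f is the Hamiltonian of x: as [v 0] and [v 1] correspond to - x_2 and x_1,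
   words in their adjoint actions become differential operators on f. *)
Definition hamiltonian (f : poly3) (x : g) :=
  forall s, lam (lie_word s x) = (contact_word s f)@_0%MM.

Lemma lam0 : lam 0 = 0.
Proof. by apply: (lam_grade (p := 0)) (grade0 _ _). Qed.
Lemma lamD x y : lam (x + y) = lam x + lam y.
Proof. by rewrite -[x]scale1r lam_lin mul1r scale1r. Qed.
Lemma lamZ a x : lam (a *: x) = a * lam x.
Proof. by rewrite -[a *: x]addr0 lam_lin lam0 addr0. Qed.
Lemma lamN x : lam (- x) = - lam x.
Proof. by rewrite -scaleN1r lamZ mulN1r. Qed.
Definition lamE := (lamD, lamN, lamZ, lam0, lam_e3).

Lemma lie_word_lin s a x y : lie_word s (a *: x + y) = a *: lie_word s x + lie_word s y.
Proof. by elim: s x y => //= i s IHs x y; rewrite lie_bracketPr IHs. Qed.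

Lemma hamiltonian_lin a f h x y : hamiltonian f x -> hamiltonian h y ->
  hamiltonian (a *: f + h) (a *: x + y).
Proof.
move=> hf hh s; rewrite lie_word_lin contact_word_lin mcoeffD mcoeffZ.
by rewrite lam_lin hf hh.
Qed.
Lemma lie_word0 s : lie_word s 0 = 0.
Proof. by elim: s => //= i s; rewrite lie0r. Qed.
Lemma hamiltonian0 : hamiltonian 0 0.
Proof.
move=> s; rewrite lie_word0; have -> : contact_word s 0 = 0 :> poly3 by elim: s => //= i s; rewrite contact_op0.
by rewrite lam0 mcoeff0.
Qed.
Lemma hamiltonianD f h x y : hamiltonian f x -> hamiltonian h y ->
  hamiltonian (f + h) (x + y).
Proof. by move=> hf hh; have := hamiltonian_lin 1 hf hh; rewrite !scale1r. Qed.
Lemma hamiltonianN f x : hamiltonian f x -> hamiltonian (- f) (- x).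
Proof. by move=> hf; have := hamiltonian_lin (- 1) hf hamiltonian0; rewrite !scaleN1r !addr0. Qed.
Lemma hamiltonian_op i f x : hamiltonian f x -> hamiltonian (contact_op i f) [lie v i, x].
Proof. by move=> hf s; apply: (hf (i :: s)). Qed.

Lemma hamiltonian_inj f h x : hamiltonian f x -> hamiltonian h x -> f = h.
Proof.
move=> hf hh; apply/eqP; rewrite -subr_eq0; apply/eqP; apply: contact_word_eq0 => s.
rewrite addrC -scaleN1r -(hamiltonian_lin (- 1) hh hf s) scaleN1r addNr.
by rewrite lie_word0 lam0.
Qed.

Lemma e3_central i : [lie v i, e3] = 0.
Proof. exact: triple_bracket0. Qed.

Lemma grade_e3 : grade (- 2) e3. Proof. exact: grade_vv. Qed.

Lemma lam_e3P x : grade (- 2) x -> x = lam x *: e3.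
Proof.
apply: (degree2_ind H (P := fun x => x = lam x *: e3)).
  split=> [|a y z hy hz]; first by rewrite lam0 scale0r.
  by rewrite {1}hy {1}hz lam_lin; lmod.
apply: ord2_ind; apply: ord2_ind; rewrite ?lie_bracketxx ?lamE ?scale0r ?scale1r //.
by rewrite lieC lamE lam_e3 scaleN1r.
Qed.

Lemma V_ind2 (P : g -> Prop) : is_subspace P -> P (v 0) -> P (v 1) ->
  forall x, grade (- 1) x -> P x.
Proof.
have [xi [xi_lin xiv _]] := coord_exists H.
by move=> sP P0 P1; apply: (V_ind H xi_lin xiv) => //; apply: ord2_ind.
Qed.

(** The contact bracket at the origin, with lam x and the lam of [v_0, x], [v_1, x], [e3, x] as the
    value and derivatives of the Hamiltonian. For homogeneous x and y of total degree -2, x has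
    degree -2, -1 or 0, or else one of the two lies below degree -2 and is 0. *)
Lemma lam_lie x y : lam [lie x, y] = lam x * lam [lie e3, y] - lam [lie e3, x] * lam y
  + lam [lie v 0, x] * lam [lie v 1, y] - lam [lie v 1, x] * lam [lie v 0, y].
Proof.
move: y; apply: grade_ind.
  by split=> [|a y z hy hz]; rewrite ?lie0r ?lam0 ?lie_bracketPr ?lam_lin ?hy ?hz; ring.
move=> q y gy; move: x; apply: grade_ind.
  by split=> [|a x z hx hz]; rewrite ?lie0r ?lie0l ?lam0 ?lie_bracketPr ?lie_bracketPl
    ?lam_lin ?hx ?hz; ring.
move=> p x gx.
have l0 r z : grade r z -> r != - 2 -> lam z = 0 by move=> gz r2; apply: lam_grade gz.
have gxv i : grade (p - 1) [lie v i, x] by apply: (grade_lie_eq (gv i) gx); lia.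
have gxe : grade (p - 2) [lie e3, x] by apply: (grade_lie_eq grade_e3 gx); lia.
have gxy := gradeL gx gy.
have [p2|p2] := eqVneq p (- 2).
  rewrite p2 in gx; rewrite (lam_e3P gx) !lieE lie_bracketxx !e3_central !lamE; ring.
have [p1|p1] := eqVneq p (- 1).
  rewrite p1 in gx; move: x gx {gxv gxe gxy}; apply: V_ind2.
  - by split=> [|a x z hx hz]; rewrite ?lie0r ?lie0l ?lam0 ?lie_bracketPr ?lie_bracketPl
      ?lam_lin ?hx ?hz; ring.
  - rewrite lie_bracketxx [[lie e3, v 0]]lieC e3_central [[lie v 1, v 0]]lieC !lamE.
    rewrite (l0 _ _ (gv 0)) //; ring.
  - rewrite lie_bracketxx [[lie e3, v 1]]lieC e3_central !lamE.
    rewrite (l0 _ _ (gv 1)) //; ring.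
rewrite (l0 _ _ gx) // !(l0 _ _ (gxv _)); try by lia.
have [p0|p0] := eqVneq p 0; last first.
  rewrite (l0 _ _ gxe); last by lia.
  have [pq|pq] := eqVneq (p + q) (- 2); last by rewrite (l0 _ _ gxy) //; ring.
  have [pn|pn] := ltP p 0.
    by rewrite (fp_low H _ gx) ?lie0l ?lam0; [ring|lia].
  by rewrite (fp_low H _ gy) ?lie0r ?lam0; [ring|lia].
have [q2|q2] := eqVneq q (- 2); last first.
  by rewrite (l0 _ _ gxy) ?(l0 _ _ gy) //; [ring|rewrite p0 add0r].
rewrite q2 in gy; rewrite (lam_e3P gy) lieC !lieE !lamE; ring.
Qed.

(** Induction on the word: [lam_lie] is the empty word, and both brackets obey the Leibniz rule, for
    ad v_i and for [contact_op i] respectively. *)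
Lemma hamiltonian_bracket f h x y : hamiltonian f x -> hamiltonian h y ->
  hamiltonian (contact_bracket f h) [lie x, y].
Proof.
move=> hf hh s; elim: s f h x y hf hh => [|i s IHs] f h x y hf hh.
  have e w (z : g) q : hamiltonian q z -> lam (lie_word w z) = (contact_word w q)@_0%MM by apply.
  have e3E q (z : g) : hamiltonian q z -> lam [lie e3, z] = (mderiv 2 q)@_0%MM.
    move=> hq; rewrite lieJl lamD lamN -contact_opC mcoeffB.
    by rewrite (hq [:: 1; 0]) (hq [:: 0; 1]).
  have x1 : (contact_op 1 f)@_0%MM = (mderiv 1 f)@_0%MM.
    by rewrite mcoeffD mcoeff_mulX mnm0E /= addr0.
  have x1' : (contact_op 1 h)@_0%MM = (mderiv 1 h)@_0%MM.
    by rewrite mcoeffD mcoeff_mulX mnm0E /= addr0.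
  rewrite /= lam_lie (e3E _ _ hf) (e3E _ _ hh) (hf [::]) (hh [::]).
  rewrite (hf [:: 0]) (hf [:: 1]) (hh [:: 0]) (hh [:: 1]) /= x1 x1'.
  rewrite /contact_bracket !(mcoeffD, mcoeffN, mcoeffB, mcoeff0M).
  have X1 : ('X_1 : poly3)@_0%MM = 0 by rewrite -['X_1]mulr1 mcoeff_mulX mnm0E.
  by rewrite X1 /contact_op /=; ring.
rewrite /= contact_op_bracket -[contact_bracket (contact_op i f) h]scale1r.
rewrite contact_word_lin mcoeffD mcoeffZ mul1r.
rewrite lieJr -[[lie [lie v i, x], y]]scale1r lie_word_lin lam_lin mul1r.
by rewrite (IHs _ _ _ _ (hamiltonian_op i hf) hh) (IHs _ _ _ _ hf (hamiltonian_op i hh)).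
Qed.

Definition mnm_fact (m : 'X_{1..3}) : F := ((m 0%R)`! * (m 1%R)`! * (m 2%R)`!)%N%:R.
(** Brackets in one fixed order; since e3 commutes with v_0 and v_1, [adn_reorder] reduces the
    others to it. *)
Definition ordered_bracket (x : g) (m : 'X_{1..3}) : g :=
  adn e3 (m 2) (adn (v 1) (m 1) (adn (v 0) (m 0) x)).

Lemma mnm_factU m i : mnm_fact (m + U_(i)) = (m i).+1%:R * mnm_fact m.
Proof.
rewrite /mnm_fact !mnmDE !mnm1E -natrM; congr (_%:R); move: i.
by apply: ord3_ind; rewrite /= ?addn0 ?addn1 factS; lia.
Qed.

Lemma mnm_fact_neq0 m : mnm_fact m != 0.
Proof. by rewrite pnatr_eq0 -lt0n !muln_gt0 !fact_gt0. Qed.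

(** Each of the a factors ad v_0 leaves one e3 when v_1 passes it; this mirrors the term x_1 d/dx_3
    of [contact_op 1]. *)
Lemma adn_reorder a x : adn (v 0) a [lie v 1, x] =
  [lie v 1, adn (v 0) a x] + a%:R *: [lie e3, adn (v 0) a.-1 x].
Proof.
elim: a x => [|a IHa] x; first by rewrite scale0r addr0.
rewrite adnS IHa lieDr lieZr lieJr (adnS (v 0) a x) /=.
rewrite [[lie v 0, [lie e3, _]]]lieJr e3_central lie0l add0r.
case: a {IHa} => [|a] /=; first by lmod.
by rewrite -[a.+2%:R]natr1; lmod.
Qed.

(* R_3^c R_2^b R_1^a f evaluated at 0 is a! b! c! times a coefficient of f. *)
Lemma hamiltonian_coef f x :
  (forall m, f@_m * mnm_fact m = lam (ordered_bracket x m)) -> hamiltonian f x.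
Proof.
move=> hf s; elim: s f x hf => [|i s IHs] f x hf.
  have := hf 0%MM; rewrite /ordered_bracket /mnm_fact !mnm0E !fact0 !muln1 mulr1.
  by move=> ->.
have step j m : (mderiv j f)@_m * mnm_fact m = lam (ordered_bracket x (m + U_(j))).
  by rewrite -hf mcoeff_deriv mnm_factU -mulr_natr; ring.
apply: IHs => m; rewrite /contact_op; move: i; apply: ord2_ind => /=.
  rewrite step /ordered_bracket !mnmDE !mnm1E /= !addn0 addn1.
  by rewrite /adn iterSr.
rewrite mcoeffD mulrDl step /ordered_bracket !mnmDE !mnm1E /= !addn0 addn1.
rewrite adn_reorder !adnE lamD lamZ; congr (_ + _); first by rewrite /adn iterSr.
(* Multiplication by x_1 lowers the exponent m 0 by one, and the ratio of factorials is the
   multiplicity a of [adn_reorder]. *)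
rewrite mcoeff_mulX; have [->|m0] := eqVneq (m 0) 0%N; first by rewrite !mul0r.
have mE := @submK _ U_(0) m; rewrite lep1mP in mE; have {}mE := mE m0.
have -> : mnm_fact m = (m 0)%:R * mnm_fact (m - U_(0)).
  by rewrite -[in LHS]mE mnm_factU mnmBE mnm1E /= subn1 prednK ?lt0n.
rewrite mulrCA step /ordered_bracket !mnmDE !mnmBE !mnm1E /=.
rewrite !subn0 !addn0 addn1 subn1; congr (_ * lam _).
have ce u : [lie e3, adn (v 1) (m 1) u] = adn (v 1) (m 1) [lie e3, u].
  by apply: adn_der; rewrite lieC e3_central oppr0.
by rewrite -ce -adnSr.
Qed.

Lemma grade_ordered_bracket p x m : grade p x ->
  grade (p - (mnm_weight m)%:Z) (ordered_bracket x m).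
Proof.
move=> gx; have g1 := adn_grade (m 0) (gv 0) gx; have g2 := adn_grade (m 1) (gv 1) g1.
have g3 (u : g) q k : grade q u -> grade (q - (2 * k)%N%:Z) (adn e3 k u).
  move=> gu; elim: k => [|k IHk]; first by rewrite muln0 subr0.
  by rewrite adnS; apply: (grade_lie_eq grade_e3 IHk); lia.
by have := g3 _ _ (m 2) g2; congr grade; rewrite /mnm_weight; lia.
Qed.

(** The Taylor coefficients vanish except in weight k + 2, so the series is a polynomial. *)
Lemma hamiltonian_homog_exists (k : int) x : grade k x -> exists f,
  hamiltonian f x /\ whomog (k + 2) f.
Proof.
move=> gx; have l0 m : (mnm_weight m)%:Z != k + 2 -> lam (ordered_bracket x m) = 0.
  move=> mk; apply: (lam_grade _ (grade_ordered_bracket m gx)).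
  by move: mk; lia.
have [|f fE] := @mcoeff_exists F (absz (k + 2)).+1 (fun m => lam (ordered_bracket x m) / mnm_fact m).
  move=> m; rewrite mdegE sum_ord3 => mk; rewrite l0 ?mul0r //.
  by apply/eqP => e; move: mk; rewrite -e /mnm_weight /=; lia.
exists f; split; first by apply: hamiltonian_coef => m; rewrite fE divfK ?mnm_fact_neq0.
apply/whomogP => m; rewrite fE => fm; apply/eqP; apply: contraNT fm => /l0 ->.
by rewrite mul0r.
Qed.

Lemma hamiltonian_exists x : exists f, hamiltonian f x.
Proof.
move: x; apply: grade_ind => [|k x /hamiltonian_homog_exists [f []]]; last by exists f.
split=> [|a x y [f hf] [h hh]]; first by exists 0; apply: hamiltonian0.
by exists (a *: f + h); apply: hamiltonian_lin.
Qed.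

Lemma lie_word_pr p s x : lie_word s (pr p x) = pr (p - (size s)%:Z) (lie_word s x).
Proof.
elim: s p x => [|i s IHs] p x /=; first by rewrite subr0.
rewrite -(pr_lie p x (gv i)) IHs; congr pr; lia.
Qed.

(** For a homogeneous component y, induction on its degree gives [v_i, y] = 0. Then y = 0 by
    transitivity in nonnegative degrees and by nondegeneracy of the bracket V x V -> g_(-2) in
    degree -1. *)
Lemma hamiltonian_zero x : hamiltonian 0 x -> x = 0.
Proof.
move=> hx; have wx s : lam (lie_word s x) = 0.
  by rewrite hx -(hamiltonian0 s) lie_word0 lam0.
apply: pr_eq => p; rewrite linear0; have {wx} : forall s, lam (lie_word s (pr p x)) = 0.
  move=> s; rewrite lie_word_pr; set q := p - _; set y := lie_word s x.
  have [q2|q2] := eqVneq q (- 2); last exact: lam_grade q2 (grade_pr _ _).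
  (* [lam] sees only the component of degree -2. *)
  rewrite -(wx s) -/y; transitivity (lam (pr (- 2) y)); first by rewrite q2.
  apply/eqP; rewrite -subr_eq0; apply/eqP; rewrite -lamN -lamD.
  move: (y); apply: grade_ind => [|r z gz].
    split=> [|a u z hu hz]; first by rewrite linear0 subr0 lam0.
    transitivity (a * lam (pr (- 2) u - u) + lam (pr (- 2) z - z)).
      by rewrite -lam_lin linearP /=; congr lam; lmod.
    by rewrite hu hz mulr0 addr0.
  rewrite (pr_grade _ gz); case: eqP => [_|/eqP r2]; first by rewrite subrr lam0.
  by rewrite sub0r lamN (lam_grade _ gz) ?oppr0 // eq_sym.
move: (grade_pr p x); move: (pr p x) => {hx} y gy wy.
have [p2|p2] := ltP p (- 2); first exact: (fp_low H p2 gy).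
have [k pk] : exists k : nat, p = k%:Z - 2 by exists (absz (p + 2)); lia.
elim: k p y gy wy pk {p2} => [|k IHk] p y gy wy pk.
  have gy2 : grade (- 2) y by rewrite pk in gy.
  by rewrite (lam_e3P gy2) (wy [::]) scale0r.
have vy i : [lie v i, y] = 0.
  apply: (IHk (p - 1)) => [|s|]; last by rewrite pk; lia.
    by apply: (grade_lie_eq (gv i) gy); lia.
  exact: (wy (i :: s)).
case: k pk {IHk} => [|k] pk.
  have gy1 : grade (- 1) y by rewrite pk in gy.
  have [xi [xi_lin xiv _]] := coord_exists H.
  have h0 : lam [lie v 0, y] = xi 1 y.
    move: gy1; move: (y); apply: V_ind2.
    - by split=> [|a u z hu hz]; rewrite ?lie0r ?(dual0 xi_lin) ?lam0 // lie_bracketPr lam_lin xi_lin hu hz.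
    - by rewrite lie_bracketxx lam0 xiv.
    - by rewrite lam_e3 xiv.
  have h1 : lam [lie v 1, y] = - xi 0 y.
    move: gy1; move: (y); apply: V_ind2.
    - by split=> [|a u z hu hz]; rewrite ?lie0r ?(dual0 xi_lin) ?lam0 ?oppr0 // lie_bracketPr lam_lin xi_lin hu hz; ring.
    - by rewrite lieC lamN lam_e3 xiv.
    - by rewrite lie_bracketxx lam0 xiv oppr0.
  apply: (V_eq0 H xi_lin xiv gy1); apply: ord2_ind.
    by apply/eqP; rewrite -oppr_eq0 -h1 vy lam0.
  by rewrite -h0 vy lam0.
have gyk : grade k%:Z y by have -> : k%:Z = p by rewrite pk; lia.
by apply: (trans_v H gyk) => i; rewrite lieC vy oppr0.
Qed.

Lemma hamiltonian_eq f x y : hamiltonian f x -> hamiltonian f y -> x = y.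
Proof.
move=> hx hy; apply/eqP; rewrite -subr_eq0; apply/eqP; apply: hamiltonian_zero.
by rewrite -(subrr f); apply: hamiltonianD => //; apply: hamiltonianN.
Qed.

(** Induction on the weight: an x with Hamiltonian f must have [v_i, x] realizing [contact_op i f].
    These y_i exist by induction and are glued into x by extending a derivation. *)
Lemma hamiltonian_realized (d : nat) f : whomog d%:Z f ->
  exists2 x, grade (d%:Z - 2) x & hamiltonian f x.
Proof.
elim: d f => [|d IHd] f hf.
  have op0 i : contact_op i f = 0 by apply: (whomog_neg _ (@whomog_op F _ i _ hf)).
  exists (f@_0%MM *: e3); first by apply: gradeZ; apply: grade_e3.
  move=> -[|i s] /=; first by rewrite !lamE mulr1.
  by rewrite lieZr e3_central scaler0 op0; apply: hamiltonian0.
have f0 : f@_0%MM = 0 by apply: (whomog_const _ hf).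
have op_d i : whomog d%:Z (contact_op i f).
  by have := @whomog_op F _ i _ hf; congr weighted_homogeneous; lia.
have [y yP] := choice (fun i => let: ex_intro2 y gy hy := IHd _ (op_d i) in
  ex_intro (fun y => grade (d%:Z - 2) y /\ hamiltonian (contact_op i f) y) y (conj gy hy)).
have gy i : grade (d%:Z - 2) (y i) := (yP i).1.
have hy i : hamiltonian (contact_op i f) (y i) := (yP i).2.
suff [x gx xv] : exists2 x, grade (d.+1%:Z - 2) x & forall i, [lie v i, x] = y i.
  exists x => // -[|i s] /=; last by rewrite xv; apply: hy.
  by rewrite f0; apply: lam_grade gx; lia.
(* Weight 1 means degree -1, whereas [two_step_extension] yields degrees >= 0; here x is solved for
   directly in V. *)
case: d gy op_d {IHd yP hf} => [|d] gy op_d.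
  have ye i : y i = lam (y i) *: e3 by apply: lam_e3P; apply: gy.
  exists (lam (y 0) *: v 1 - lam (y 1) *: v 0).
    by apply: gradeB; apply: gradeZ; apply: gv.
  apply: ord2_ind; rewrite [RHS]ye !lieE lie_bracketxx ?[[lie v 1, v 0]]lieC; lmod.
have gyd i : grade (d%:Z - 1) (y i).
  by have := gy i; congr grade; lia.
have [i|i j l|x gx xv] := two_step_extension H (k := d) (A := fun i => - y i).
- exact: gradeN.
- have -> : [lie - y i, [lie v j, v l]] + [lie v i, [lie - y j, v l] + [lie v j, - y l]]
      = [lie v j, [lie v l, y i]] - [lie v l, [lie v j, y i]]
        + ([lie v i, [lie v l, y j]] - [lie v i, [lie v j, y l]]).
    rewrite -lieJl lieNl -[RHS]addrC [[lie [lie v j, v l], y i]]lieC.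
    by rewrite lieNl [[lie y j, v l]]lieC !lieE; lmod.
  (* The obstruction has a Hamiltonian, and it is 0 because the commutator of the two operators,
     d/dx_3, commutes with both. *)
  apply: hamiltonian_zero.
  have := hamiltonianD (hamiltonianD (hamiltonian_op j (hamiltonian_op l (hy i)))
     (hamiltonianN (hamiltonian_op l (hamiltonian_op j (hy i)))))
   (hamiltonianD (hamiltonian_op i (hamiltonian_op l (hy j)))
     (hamiltonianN (hamiltonian_op i (hamiltonian_op j (hy l))))).
  congr hamiltonian.
  have c10 q := contact_opC q.
  have comm k q : contact_op k (contact_op 0 (contact_op 1 q)) -
      contact_op k (contact_op 1 (contact_op 0 q)) =
      contact_op 0 (contact_op 1 (contact_op k q)) - contact_op 1 (contact_op 0 (contact_op k q)).
    by rewrite -contact_opB !contact_opC contact_op_mderiv2.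
  move: j l; apply: ord2_ind; apply: ord2_ind; rewrite ?subrr ?addr0 //.
    by rewrite -comm; ring.
  by rewrite comm; ring.
- exists x; first by have := gx; congr grade; lia.
  by move=> i; rewrite lieC xv opprK.
Qed.

Lemma contact_algebra_iso : gla_iso_K1 g.
Proof.
have [f fP] := choice hamiltonian_exists.
have f_lin a x y : contact_vf (f (a *: x + y)) = a *: contact_vf (f x) + contact_vf (f y).
  by rewrite -contact_vf_lin; congr contact_vf; apply: hamiltonian_inj (fP _) (hamiltonian_lin _ _ _).
have [phi phiE] := linearize f_lin.
have real (k : int) h : whomog (k + 2) h -> exists2 x, grade k x & f x = h.
  move=> hh; have [k2|k2] := ltP (k + 2) 0.
    exists 0; first exact: grade0.
    rewrite (whomog_neg k2 hh); apply: hamiltonian_inj (fP 0) hamiltonian0.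
  have kE : k + 2 = (absz (k + 2))%:Z by lia.
  rewrite kE in hh; have [x gx hx] := hamiltonian_realized hh.
  exists x; last exact: hamiltonian_inj (fP x) hx.
  by have := gx; congr grade; lia.
have surj h : exists x, f x = h.
  rewrite [h]mpolyE; elim: (msupp h) => [|m s [x xh]].
    by exists 0; rewrite big_nil; apply: hamiltonian_inj (fP 0) hamiltonian0.
  have [y _ yh] : exists2 y, grade ((mnm_weight m)%:Z - 2) y & f y = 'X_[m].
    apply: real; rewrite subrK; apply/whomogP => m'; rewrite mcoeffX.
    by case: (m =P m') => [->//|_]; rewrite eqxx.
  exists (h@_m *: y + x); rewrite big_cons -xh -yh.
  exact: hamiltonian_inj (fP _) (hamiltonian_lin _ (fP y) (fP x)).
exists phi; split.
- move=> x y; rewrite !phiE -contact_vf_bracket; congr contact_vf.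
  exact: hamiltonian_inj (fP _) (hamiltonian_bracket (fP x) (fP y)).
- move=> x y; rewrite !phiE => e; apply: (hamiltonian_eq (f := f x)) => //.
  by rewrite -(contact_vfK (f x)) e contact_vfK.
- move=> D; split=> [cD|[x <-]]; last by rewrite phiE; apply: contact_vf_contact.
  have [x xE] := surj (D 2 - 'X_1 * D 0).
  by exists x; rewrite phiE xE -contact_fieldE.
- move=> k D; split=> [kD|[x gx <-]].
    have [x gx xE] := real _ _ (K1_grade_whomog kD).
    by exists x => //; rewrite phiE xE -contact_fieldE //; case: kD.
  rewrite phiE; apply: whomog_contact_vf.
  have [h [hx hh]] := hamiltonian_homog_exists gx.
  by rewrite (hamiltonian_inj (fP x) hx).
Qed.

Lemma contact_grade_neq0 (k : nat) : exists2 x : g, grade k%:Z x & x <> 0.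
Proof.
(* x_1^(k+2) is a nonzero Hamiltonian of weight k + 2, hence gives degree k. *)
have hX : whomog k.+2%:Z ('X_[U_(0) *+ k.+2] : poly3).
  apply/whomogP => m; rewrite mcoeffX.
  case: (_ =P m) => [<- _|_]; last by rewrite eqxx.
  by rewrite /mnm_weight !mulmnE !mnm1E /= mul1n !mul0n; lia.
have [x gx hx] := hamiltonian_realized hX; exists x.
  by have := gx; congr grade; lia.
move=> x0; rewrite x0 in hx; have := hamiltonian_inj hx hamiltonian0.
move/(congr1 (mcoeff (U_(0) *+ k.+2))); rewrite mcoeffX eqxx mcoeff0 => /eqP.
by rewrite oner_eq0.
Qed.

Lemma contact_infinite_dim : ~ finite_dim (fun _ : g => True).
Proof.
case=> n [b [_ _ spb]].
have [x xP] := choice (fun k => let: ex_intro2 x gx x0 := contact_grade_neq0 k in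
  ex_intro (fun x => grade k%:Z x /\ x <> 0) x (conj gx x0)).
have [a aE] := choice (fun k => spb (x k) I).
pose M : 'M[F]_(n.+1, n) := \matrix_(i, j) a i j.
have : kermx M != 0 by rewrite kermx_eq0 /row_free; have := rank_leq_col M; lia.
case/rowV0Pn => u /sub_kermxP uM u0.
have ux : \sum_(i < n.+1) u 0 i *: x i = 0.
  rewrite (eq_bigr (fun i : 'I_n.+1 => \sum_j (u 0 i * a i j) *: b j)); last first.
    by move=> i _; rewrite {1}aE scaler_sumr; apply: eq_bigr => j _; rewrite scalerA.
  rewrite exchange_big big1 //= => j _; rewrite -scaler_suml.
  have <- : (u *m M) 0 j = \sum_i u 0 i * a i j.
    by rewrite mxE; apply: eq_bigr => i _; rewrite [M i j]mxE.
  by rewrite uM mxE scale0r.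
case/eqP: u0; apply/rowP => i; rewrite mxE.
have := congr1 (pr (i : nat)%:Z) ux; rewrite linear0 linear_sum (bigD1 i) //=.
rewrite linearZ /= (pr_id (xP i).1) big1 ?addr0.
  by move/eqP; rewrite scaler_eq0 => /orP[/eqP//|/eqP/(xP i).2].
move=> j ji; rewrite linearZ /= (pr_grade _ (xP j).1); case: eqP => [e|_].
  by case/eqP: ji; apply/val_inj => /=; lia.
by rewrite scaler0.
Qed.

End ContactAlgebraIso.

(** * Assembly of the three cases *)

Section Assembly.
Variables (F : numFieldType) (g : glaType F).

Lemma gl_basis_exists n mu (v : 'I_n -> g) : free_prolongation mu v ->
  (forall A : 'I_n -> g, (forall i, grade (- 1) (A i)) ->
    exists2 x, grade 0 x & forall i, [lie x, v i] = A i) ->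
  (forall b : 'I_n -> F, exists2 X, grade 1 X & Gam mu v X b) ->
  exists (E : 'I_n -> 'I_n -> g) (c : 'I_n -> g),
  [/\ forall i j, grade 0 (E i j),
      forall i j k, [lie E i j, v k] = (k == j)%:R *: v i,
      forall k, grade 1 (c k)
    & forall k, Gam mu v (c k) (fun i => (i == k)%:R)].
Proof.
move=> H gl deg1; have gv := fp_grade H.
have hE (ij : 'I_n * 'I_n) : exists x, grade 0 x /\
    forall k, [lie x, v k] = (k == ij.2)%:R *: v ij.1.
  have [k|x gx xv] := gl (fun k => (k == ij.2)%:R *: v ij.1); last by exists x.
  exact: gradeZ.
have hc k : exists X, grade 1 X /\ Gam mu v X (fun i => (i == k)%:R).
  by have [X gX hX] := deg1 (fun i => (i == k)%:R); exists X.
have [E EP] := choice hE; have [c cP] := choice hc.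
exists (fun i j => E (i, j)), c; split=> [i j|i j k|k|k].
- by case: (EP (i, j)).
- by case: (EP (i, j)) => _ ->.
- by case: (cP k).
- by case: (cP k).
Qed.

Lemma degree_one_neq0 n mu (v : 'I_n -> g) (xi : 'I_n -> g -> F) X k :
  (forall i a x y, xi i (a *: x + y) = a * xi i x + xi i y) ->
  (forall i j, xi i (v j) = (j == i)%:R) ->
  Gam mu v X (fun i => (i == k)%:R) -> X <> 0.
Proof.
move=> xi_lin xiv hX X0; rewrite X0 in hX.
have := Gam_inj xi_lin xiv hX (Gam0 mu v) k; rewrite /= eqxx => /eqP.
by rewrite oner_eq0.
Qed.

Lemma prolongation_typeB n (v : 'I_n -> g) : free_prolongation 2 v -> (2 < n)%N ->
  ~ is_zero (@grade F g 1) /\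
  simple_gla_of_type g (cartanB n) [set i : 'I_n | i.+1 == n].
Proof.
move=> H n3; have [xi [xi_lin xiv _]] := coord_exists H.
have [E [c [gE Ev gc cG]]] := gl_basis_exists H (two_step_gl H) (two_step_degree1 H).
split; last exact: (typeB_type H n3 xi_lin xiv gE Ev gc cG).
pose i0 := Ordinal (ltnW (ltnW n3)).
by move=> /(_ _ (gc i0)); apply: degree_one_neq0 xi_lin xiv (cG i0).
Qed.

Lemma prolongation_typeG (v : 'I_2 -> g) : free_prolongation 3 v ->
  ~ is_zero (@grade F g 1) /\ simple_gla_of_type g cartanG2 [set 0 : 'I_2].
Proof.
move=> H; have [xi [xi_lin xiv _]] := coord_exists H.
have [E [c [gE Ev gc cG]]] := gl_basis_exists H (three_step_gl H) (three_step_degree1 H).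
split; last exact: (typeG_type H xi_lin xiv gE Ev gc cG).
by move=> /(_ _ (gc 0)); apply: degree_one_neq0 xi_lin xiv (cG 0).
Qed.

Lemma prolongation_contact (v : 'I_2 -> g) : free_prolongation 2 v ->
  ~ finite_dim (fun _ : g => True) /\ gla_iso_K1 g.
Proof.
move=> H; have [om [om_lin omv om0]] := coord2_exists H.
have om_e : om 0 1 [lie v 0, v 1] = 1 by rewrite omv !ord2_delta; ring.
split; first exact: (contact_infinite_dim H (om_lin 0 1) om_e (om0 0 1)).
exact: (contact_algebra_iso H (om_lin 0 1) om_e (om0 0 1)).
Qed.

Lemma gla_iso_refl : gla_iso g g.
Proof.
by exists (idfun : {linear g -> g}); [split|exists id].
Qed.

(** [rank_gt1] leaves only n >= 2, so the cases are exhaustive. In the simple cases g itself is the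
    algebra s. *)
Lemma prolongation_trichotomy n mu (v : 'I_n -> g) : free_prolongation mu v ->
  [\/ (~ ((2 <= n)%N /\ mu = 2%N) /\ ~ (n = 2%N /\ mu = 3%N)) /\
      is_zero (@grade F g 1),
      (((3 <= n)%N /\ mu = 2%N) \/ (n = 2%N /\ mu = 3%N)) /\
      [/\ finite_dim (fun _ : g => True),
          ~ is_zero (@grade F g 1),
          (3 <= n)%N -> exists2 s : glaType F,
            simple_gla_of_type s (cartanB n) [set i : 'I_n | i.+1 == n]
            & gla_iso g s
        & n = 2%N -> exists2 s : glaType F,
            simple_gla_of_type s cartanG2 [set 0 : 'I_2]
            & gla_iso g s]
    | (n = 2%N /\ mu = 2%N) /\
      (~ finite_dim (fun _ : g => True) /\ gla_iso_K1 g)].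
Proof.
move=> H; have n1 := rank_gt1 H; have mu1 := fp_mu H.
have [mu2|mu2] := eqVneq mu 2%N.
  subst mu; have [n3|n2] := ltnP 2 n.
    have [g1 gB] := prolongation_typeB H n3.
    constructor 2; split; first by left.
    split=> //; first by case: gB.
      by move=> _; exists g => //; apply: gla_iso_refl.
    by move=> n2; rewrite n2 in n3.
  have n2' : n = 2%N by apply/eqP; rewrite eqn_leq n2.
  by subst n; constructor 3; split=> //; apply: prolongation_contact H.
have [/andP[/eqP n2 /eqP mu3]|not23] := boolP ((n == 2%N) && (mu == 3%N)).
  subst n mu; have [g1 gG] := prolongation_typeG H.
  constructor 2; split; first by right.
  split=> //; first by case: gG.
  by move=> _; exists g => //; apply: gla_iso_refl.
constructor 1; split.
  split=> [[_ e]|[e1 e2]]; first by rewrite e in mu2.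
  by rewrite e1 e2 in not23.
move=> x gx; apply: (degree_one_zero H) gx; first by lia.
by move: not23; lia.
Qed.

End Assembly.

Theorem theorem1 (R : realType) (n mu : nat) (m g : glaType R[i])
    (iota : {linear m -> g})
    (free_m : is_free_FGLA m n mu) (g_prol : is_prolongation iota) :
  [\/ (~ ((2 <= n)%N /\ mu = 2%N) /\ ~ (n = 2%N /\ mu = 3%N)) /\
      is_zero (@grade R[i] g 1),
      (((3 <= n)%N /\ mu = 2%N) \/ (n = 2%N /\ mu = 3%N)) /\
      [/\ finite_dim (fun _ : g => True),
          ~ is_zero (@grade R[i] g 1),
          (3 <= n)%N -> exists2 s : glaType R[i],
            simple_gla_of_type s (cartanB n) [set i : 'I_n | i.+1 == n]
            & gla_iso g s
        & n = 2%N -> exists2 s : glaType R[i],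
            simple_gla_of_type s cartanG2 [set 0 : 'I_2]
            & gla_iso g s]
    | (n = 2%N /\ mu = 2%N) /\
      (~ finite_dim (fun _ : g => True) /\ gla_iso_K1 g)].
Proof.
have [v H] := prolongation_free free_m g_prol.
exact: (@prolongation_trichotomy R[i] g n mu v H).
Qed.
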